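(* The conjugacy problem in finitely generated virtually free groups can be solved in linear time. That is, for every finitely generated virtually free group $G$ there is an algorithm which, given two words $u,v$ over a fixed finite generating set of $G$ (closed under inversion), decides in time $O(|u|+|v|)$ whether $u$ and $v$ represent conjugate elements of $G$.
   Context: A group is virtually free if it has a free subgroup of finite index. The group $G$ (with its generating set) is fixed and not part of the input; the input size is the total length $|u|+|v|$ of the words. *)

(* Defs.v *)
From HB Require Import structures.
From mathcomp Require Import all_boot finmap.
From mathcomp Require Import boolp classical_sets functions cardinality.

Set Implicit Arguments.
Unset Strict Implicit.
Unset Printing Implicit Defensive.

Local Open Scope classical_set_scope.
Local Open Scope group_scope.

(** * Virtually free groups *)

Section Groups.
Variable G : groupType.

Definition is_subgroup (H : set G) : Prop :=
  [/\ H 1, forall x y, H x -> H y -> H (x * y) & forall x, H x -> H x^-1].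

Definition finite_index (H : set G) : Prop :=
  finite_set (range (fun g : G => [set g * h | h in H])).

(** The signed letter [(x, false)] stands for [x], and [(x, true)] for
    [x^-1]. *)
Definition signed_val (l : G * bool) : G := if l.2 then l.1^-1 else l.1.

Definition reduced (w : seq (G * bool)) : bool :=
  sorted (fun l m => ~~ ((l.1 == m.1) && (l.2 != m.2))) w.

(** [X] is a free basis of [H]. *)
Definition free_basis (X H : set G) : Prop :=
  X `<=` H /\
  forall h, H h ->
    exists! w : seq (G * bool),
      [/\ reduced w, forall l, l \in w -> X l.1
        & \big[*%g/1]_(l <- w) signed_val l = h].

Definition is_free (H : set G) : Prop := exists X, free_basis X H.

Definition virtually_free : Prop :=
  exists H : set G, [/\ is_subgroup H, is_free H & finite_index H].

(** * Words over a finite subset [S] *)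

Definition inv_closed (S : {fset G}) : Prop := forall x, x \in S -> x^-1 \in S.

Definition word_val (S : {fset G}) (w : seq S) : G :=
  \big[*%g/1]_(s <- w) val s.

(** Inverse letters are omitted: this is only used for inversion-closed [S]. *)
Definition generates (S : {fset G}) : Prop :=
  forall g : G, exists w : seq S, word_val w = g.

Definition conjugate (x y : G) : Prop := exists g : G, x ^ g = y.

End Groups.

(** * Deterministic multitape Turing machines

    Tape symbols are the blank [None], the input letters [Some (inl a)] and
    the auxiliary symbols [Some (inr b)].  There are [tm_ntapes.+1] two-way
    infinite tapes, with the input on tape [ord0].  A state [q] is halting when
    [tm_halt q] is [Some b], and then [b] is the answer. *)

Inductive move := MoveLeft | Stay | MoveRight.

Record turing_machine (A : finType) := TuringMachine {
  tm_aux : finType;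
  tm_ntapes : nat;
  tm_state : finType;
  tm_start : tm_state;
  tm_halt : tm_state -> option bool;
  tm_trans : tm_state -> {ffun 'I_tm_ntapes.+1 -> option (A + tm_aux)} ->
    tm_state * {ffun 'I_tm_ntapes.+1 -> option (A + tm_aux) * move}
}.

Section Tapes.
Variable X : Type.

(** Both sides are listed from the head outwards; all cells beyond them are
    blank. *)
Record tape := Tape {
  tape_left : seq (option X);
  tape_head : option X;
  tape_right : seq (option X)
}.

Definition tape_write (x : option X) (t : tape) : tape :=
  Tape (tape_left t) x (tape_right t).

Definition tape_move (m : move) (t : tape) : tape :=
  let: Tape l x r := t in
  match m with
  | MoveLeft => Tape (behead l) (head None l) (x :: r)
  | Stay => t
  | MoveRight => Tape (x :: l) (head None r) (behead r)
  end.

Definition tape_of_seq (s : seq X) : tape :=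
  Tape [::] (ohead s) (map Some (behead s)).

End Tapes.

Section Run.
Variables (A : finType) (M : turing_machine A).

Definition tm_config : Type :=
  tm_state M * {ffun 'I_(tm_ntapes M).+1 -> tape (A + tm_aux M)}.

Definition tm_init (s : seq A) : tm_config :=
  (tm_start M,
   [ffun i => tape_of_seq (if i == ord0 then map inl s else [::])]).

Definition tm_step (c : tm_config) : tm_config :=
  if tm_halt c.1 is Some _ then c else
  let: (q, act) := tm_trans c.1 [ffun i => tape_head (c.2 i)] in
  (q, [ffun i => tape_move (act i).2 (tape_write (act i).1 (c.2 i))]).

(** Halting configurations are fixed by [tm_step], so [n] is an upper bound on
    the running time. *)
Definition answers_within (s : seq A) (n : nat) (b : bool) : Prop :=
  tm_halt (iter n tm_step (tm_init s)).1 = Some b.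

(** [M] decides [P] on the instances [x : I], presented as [enc x] and of size
    [sz x], in time O([sz x]).  The successor accounts for instances of size
    0. *)
Definition decides_in_linear_time (I : Type) (enc : I -> seq A) (sz : I -> nat)
    (P : I -> Prop) : Prop :=
  exists c : nat, forall x : I, exists b : bool,
    answers_within (enc x) (c * (sz x).+1)%N b /\ (b <-> P x).

End Run.

(** The pair [(u, v)] is written [u # v], the separator [#] being [None]. *)
Definition encode_pair (T : Type) (p : seq T * seq T) : seq (option T) :=
  map Some p.1 ++ None :: map Some p.2.

(* Main.v *)
Require Import Defs.
From HB Require Import structures.
From mathcomp Require Import all_boot finmap.
From mathcomp Require Import boolp classical_sets cardinality.
From mathcomp Require Import all_fingroup cyclic zify.

Set Implicit Arguments.
Unset Strict Implicit.
Unset Printing Implicit Defensive.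

(** Let [H] be a free subgroup of finite index of [G], with finitely many right
    cosets [H rho_j], let [sigma] be the action of [G] on these cosets, and let
    [k] be the order of the group of permutations of the cosets.  Then
    [sigma g ^+ k = 1], so the [k]-th power of every [g] lies in [ker sigma],
    hence in [H].  Moreover [u] and [v] are conjugate in [G] if and only if, for
    some [j], an element of [H] conjugates [u] to [rho_j v rho_j^-1], and there
    are finitely many [j] to try.  The tables of the coset rewriting
    [rho_i s = w rho_i'], with [w] a word over the basis of [H], let a machine
    read a word over the generators and keep the reduced form of the part read
    on a stack, in linear time ([read_step_spec]).

    Elements of infinite order.  The stack is used to compute the reduced words
    of [u ^+ k] and [(rho_j v rho_j^-1) ^+ k].  In a free group conjugacy means
    that the cyclically reduced forms are rotations of each other, but a
    conjugator of the [k]-th powers need not conjugate [u] itself.  Therefore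
    every letter of the cyclic word is labelled with the image under [sigma] of
    the conjugate of [u] by the prefix before that letter.  If the labelled
    cyclic words are rotations of each other, then there is [x] in [H] such that
    [u ^ x] and [rho_j v rho_j^-1] have the same nontrivial [k]-th power and the
    same image under [sigma], and two such elements are equal
    ([power_sigma_inj]): their quotient lies in [ker sigma] and commutes with
    their common power, so it has a power that is central in the centralizer of
    that element ([power_central]), and then uniqueness of roots and
    absence of torsion in free groups make it trivial.  So conjugacy by an
    element of [H] amounts to a rotation of labelled words ([conj_iff_rot]).
    Rotations are recognized in linear time on tapes by the comparison that
    computes minimal rotations ([beat_mismatch], [not_beaten],
    [exec_matching]).

    Elements of finite order, that is, with [u ^+ k = 1].  Write [u] as
    [h rho_i] with [h] reduced over the basis of [H].  While [u] is conjugated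
    by the successive prefixes of [h], a stack holds a reduced word and a second
    tape counts its length.  If no such conjugate of bounded length is met, then
    [u] maps the set of reduced words with some nonempty prefix into itself, far
    from its boundary, and all powers of [u] are nontrivial ([no_torsion],
    [torsion_short]).  Conjugacy of [u] and [v] is then read off from a finite
    table of the pairs of short elements.

    The programs are written with machines that return a value and can be
    sequenced and iterated; the rules for them bound the number of steps, and
    [exec_tm] translates them into Turing machines. *)

Local Open Scope nat_scope.

(** * Machines that return a value *)

Section Machines.
Variables (A aux : finType) (nt : nat).
Local Notation X := (A + aux)%type.
Local Notation cell := (option X).

(** Streams are used because two tapes that differ only by blanks at the ends
    of their lists have equal pairs of streams: the contents of a tape can be
    rewritten with plain equalities.  The second stream starts under the
    head. *)
Definition stream := nat -> cell.
Definition scons (x : cell) (s : stream) : stream :=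
  fun k => if k is k'.+1 then s k' else x.
Definition stail (s : stream) : stream := fun k => s k.+1.

Definition atape : Type := stream * stream.
Definition head_read (t : atape) : cell := t.2 0.
Definition head_write (x : cell) (t : atape) : atape := (t.1, scons x (stail t.2)).
Definition head_move (m : move) (t : atape) : atape :=
  match m with
  | MoveLeft => (stail t.1, scons (t.1 0) t.2)
  | Stay => t
  | MoveRight => (scons (t.2 0) t.1, stail t.2)
  end.

Definition zipper (l r : seq X) : atape := (onth l, onth r).

Lemma scons_onth x (l : seq X) : scons (Some x) (onth l) = onth (x :: l).
Proof. by apply/funext => -[]. Qed.
Lemma scons_nil : scons None (onth [::]) = onth ([::] : seq X).
Proof. by apply/funext => -[|k] //=; rewrite !onth0n. Qed.
Lemma stail_onth (l : seq X) : stail (onth l) = onth (behead l).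
Proof. by apply/funext => k; case: l => [|x l]; rewrite /stail ?onth0n. Qed.
Lemma stail_scons x s : stail (scons x s) = s.
Proof. by []. Qed.

Definition view (t : tape X) : atape :=
  (nth None (tape_left t), nth None (tape_head t :: tape_right t)).

Local Arguments tape_move : simpl never.
Local Arguments tape_write : simpl never.

Lemma view_act x m t : view (tape_move m (tape_write x t)) = head_move m (head_write x (view t)).
Proof.
case: t => l h r; case: m; rewrite /view /head_move /head_write /tape_move /tape_write /=; congr pair;
  apply/funext => k; rewrite /stail /scons /=.
- by case: l => [|y l]; rewrite /= ?nth_nil.
- by case: l => [|y l]; case: k => [|[|k]].
- by case: k.
- by case: k.
- by case: r => [|y r]; case: k => [|k]; rewrite /= ?nth_nil.
Qed.

Lemma view_of_seq s : view (tape_of_seq s) = zipper [::] s.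
Proof.
rewrite /view /zipper; congr pair; apply/funext => k; rewrite ?onthE //=.
by case: s k => [|x s] [|k] //=; rewrite nth_nil.
Qed.

(** One tape is accessed per step, so that the rule for a step names only that
    tape.  The values returned become the branches of sequencing and loops. *)
Record mach (O : Type) := Mach {
  mach_state : finType;
  mach_start : mach_state;
  mach_tape : mach_state -> 'I_nt.+1;
  mach_act : mach_state -> cell -> (mach_state + O) * (cell * move)
}.

Definition blank : atape := zipper [::] [::].
Definition tape_act (T : seq atape) (i : nat) (a : cell * move) : seq atape :=
  set_nth blank T i (head_move a.2 (head_write a.1 (nth blank T i))).

Inductive reach (O : Type) (M : mach O) : mach_state M -> seq atape -> nat -> O -> seq atape -> Prop :=
| ReachExit s T o a :
    mach_act s (head_read (nth blank T (mach_tape s))) = (inr o, a) ->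
    reach s T 1 o (tape_act T (mach_tape s) a)
| ReachStep s s' T a n o T' :
    mach_act s (head_read (nth blank T (mach_tape s))) = (inl s', a) ->
    reach s' (tape_act T (mach_tape s) a) n o T' ->
    reach s T n.+1 o T'.

Definition exec (O : Type) (M : mach O) T n o T' := exists2 k, k <= n & reach (mach_start M) T k o T'.

Lemma exec_le O (M : mach O) T n n' o T' : exec M T n o T' -> n <= n' -> exec M T n' o T'.
Proof. by case=> k le1 R le2; exists k => //; apply: leq_trans le2. Qed.

Definition op (O : Type) (i : 'I_nt.+1) (f : cell -> O * (cell * move)) : mach O :=
  @Mach O unit tt (fun=> i) (fun _ x => (inr (f x).1, (f x).2)).

Lemma exec_op O i (f : cell -> O * (cell * move)) T :
  exec (op i f) T 1 (f (head_read (nth blank T i))).1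
     (tape_act T i (f (head_read (nth blank T i))).2).
Proof. by exists 1 => //; apply: ReachExit. Qed.

Definition ret (O : Type) (o : O) : mach O := op ord0 (fun x => (o, (x, Stay))).

Section Bind.
Variables (O : finType) (O' : Type) (M : mach O) (K : O -> mach O').

(* The value returned by [M] has to be remembered while [K] runs, so [O] is
   finite and indexes the states of the second part. *)
Definition bind_st : finType := (mach_state M + {o : O & mach_state (K o)})%type.
Definition bind : mach O' :=
  @Mach O' bind_st (inl (mach_start M))
    (fun s => match s with inl s => mach_tape s | inr s => mach_tape (tagged s) end)
    (fun s x => match s with
      | inl s => let (r, a) := mach_act s x in
          (match r with
           | inl s' => inl (inl s')
           | inr o => inl (inr (Tagged (fun o => mach_state (K o)) (mach_start (K o))))
           end, a)
      | inr s => let (r, a) := mach_act (tagged s) x in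
          (match r with
           | inl s' => inl (inr (Tagged (fun o => mach_state (K o)) s'))
           | inr o => inr o
           end, a)
      end).

Lemma exec_bind T n o T1 n' o' T2 :
  exec M T n o T1 -> exec (K o) T1 n' o' T2 -> exec bind T (n + n') o' T2.
Proof.
case=> k lk R1 [k' lk' R2]; exists (k + k'); first exact: leq_add.
have lift o3 (s : mach_state (K o3)) T3 r T4 : @reach _ (K o3) s T3 r o' T4 ->
    @reach _ bind (inr (Tagged (fun o => mach_state (K o)) s)) T3 r o' T4.
  elim=> {s T3 r o' T4 R2} [s T3 o' b e | s s' T3 b r o' T4 e _ IH].
  - by apply: (@ReachExit _ bind (inr (Tagged (fun o => mach_state (K o)) s))); rewrite /= e.
  - apply: (@ReachStep _ bind (inr (Tagged (fun o => mach_state (K o)) s))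
      (inr (Tagged (fun o => mach_state (K o)) s')) _ b) IH.
    by rewrite /= e.
change (@reach _ bind (inl (mach_start M)) T (k + k') o' T2).
elim: R1 R2 {lk} => {T k o T1} [s T o a e R2 | s s' T a k o T' e _ IH R2].
- apply: (@ReachStep _ bind (inl s) (inr (Tagged (fun o => mach_state (K o)) (mach_start (K o)))) T a).
    by rewrite /= e.
  exact: lift.
- rewrite addSn; apply: (@ReachStep _ bind (inl s) (inl s') T a); last exact: IH.
  by rewrite /= e.
Qed.
End Bind.

Section Loop.
Variables (Z : finType) (O : Type) (body : Z -> mach (Z + O)).

Definition loop (z : Z) : mach O :=
  @Mach O {z : Z & mach_state (body z)} (Tagged (fun z => mach_state (body z)) (mach_start (body z)))
    (fun s => mach_tape (tagged s))
    (fun s x => let (r, a) := mach_act (tagged s) x in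
       (match r with
        | inl s' => inl (Tagged (fun z => mach_state (body z)) s')
        | inr (inl z) => inl (Tagged (fun z => mach_state (body z)) (mach_start (body z)))
        | inr (inr o) => inr o
        end, a)).

Lemma reach_loop_start z z' (s : {z : Z & mach_state (body z)}) T n o T' :
  @reach _ (loop z) s T n o T' -> @reach _ (loop z') s T n o T'.
Proof.
elim=> {s T n o T'} [s T o a e | s s' T a n o T' e _ IH].
  exact: (@ReachExit _ (loop z')).
exact: (@ReachStep _ (loop z') _ _ _ _ _ _ _ e IH).
Qed.

Lemma reach_loop z (s : mach_state (body z)) T n r T' : reach s T n r T' ->
  match r with
  | inr o => @reach _ (loop z) (Tagged (fun z => mach_state (body z)) s) T n o T'
  | inl z' => forall n' o T2, @reach _ (loop z') (mach_start (loop z')) T' n' o T2 ->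
     @reach _ (loop z) (Tagged (fun z => mach_state (body z)) s) T (n + n') o T2
  end.
Proof.
elim=> {s T n r T'}.
- move=> s T [z'|o] a e.
  + move=> n' o T2 /(@reach_loop_start _ z) R; rewrite add1n.
    apply: (@ReachStep _ (loop z) (Tagged (fun z => mach_state (body z)) s)
      (Tagged (fun z => mach_state (body z)) (mach_start (body z'))) T a) R.
    by rewrite /= e.
  + by apply: (@ReachExit _ (loop z) (Tagged (fun z => mach_state (body z)) s)); rewrite /= e.
- move=> s s' T a n [z'|o] T' e _ IH.
  + move=> n' o T2 R; rewrite addSn.
    apply: (@ReachStep _ (loop z) (Tagged (fun z => mach_state (body z)) s)
      (Tagged (fun z => mach_state (body z)) s') T a); first by rewrite /= e.
    exact: IH.
  + apply: (@ReachStep _ (loop z) (Tagged (fun z => mach_state (body z)) s)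
      (Tagged (fun z => mach_state (body z)) s') T a); first by rewrite /= e.
    exact: IH.
Qed.

Lemma exec_loop_exit z T n o T' :
  exec (body z) T n (inr o) T' -> exec (loop z) T n o T'.
Proof. by case=> k lk /reach_loop R; exists k. Qed.

Lemma exec_loop_next z z' T n T1 n' o T2 :
  exec (body z) T n (inl z') T1 -> exec (loop z') T1 n' o T2 ->
  exec (loop z) T (n + n') o T2.
Proof.
case=> k lk /reach_loop R [k' lk' /R R2].
by exists (k + k') => //; apply: leq_add.
Qed.
End Loop.

(** A step rewrites one tape; the other tapes write back what they read.  Each
    returned boolean becomes a halting state. *)
Definition tm_of (M : mach bool) : turing_machine A :=
  @TuringMachine A aux nt (mach_state M + bool)%type (inl (mach_start M))
    (fun s => if s is inr b then Some b else None)
    (fun s h => match s with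
      | inl s => let (r, a) := mach_act s (h (mach_tape s)) in
         (r, [ffun i => if i == mach_tape s then a else (h i, Stay)])
      | inr b => (inr b, [ffun i => (h i, Stay)])
      end).

Definition represents (c : {ffun 'I_nt.+1 -> tape X}) (T : seq atape) :=
  size T = nt.+1 /\ forall i : 'I_nt.+1, nth blank T i = view (c i).

Lemma reach_tm (M : mach bool) (s : mach_state M) T n b T' c :
  reach s T n b T' -> represents c T ->
  tm_halt (iter n (@tm_step _ (tm_of M)) (inl s, c)).1 = Some b.
Proof.
have step s0 T0 r a c0 : mach_act s0 (head_read (nth blank T0 (mach_tape s0))) = (r, a) ->
   represents c0 T0 -> exists2 c1, @tm_step _ (tm_of M) (inl s0, c0) = (r, c1) & represents c1 (tape_act T0 (mach_tape s0) a).
  move=> e [sz st]; rewrite /tm_step /= ffunE.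
  have -> : tape_head (c0 (mach_tape s0)) = head_read (nth blank T0 (mach_tape s0)) by rewrite st.
  rewrite e; eexists; first by [].
  split=> [|i]; first by rewrite /tape_act size_set_nth sz; apply/maxn_idPr; case: (mach_tape s0).
  rewrite /tape_act nth_set_nth !ffunE [in LHS]/= (inj_eq val_inj).
  case: eqP => [->|_]; rewrite view_act st //.
  by case: (c0 i) => l h r0; rewrite /view /head_write /head_move /tape_move /tape_write /=; congr pair; apply/funext => -[].
move=> R; elim: R c => {s T n b T'}.
- by move=> s T b a e c /(step _ _ _ _ _ e) [c1 /= -> _].
- move=> s s' T a n b T' e R IH c /(step _ _ _ _ _ e) [c1 e1 s1].
  by rewrite iterSr e1; apply: IH.
Qed.

Definition init_tapes (s : seq A) : seq atape :=
  zipper [::] (map inl s) :: nseq nt blank.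

Lemma tm_halt_iter (M : turing_machine A) (c : tm_config M) k b :
  tm_halt c.1 = Some b -> iter k (@tm_step _ M) c = c.
Proof. by move=> e; elim: k => //= k ->; rewrite /tm_step e. Qed.

Lemma exec_tm (M : mach bool) s n b T' :
  exec M (init_tapes s) n b T' -> @answers_within _ (tm_of M) s n b.
Proof.
case=> k lk R; rewrite /answers_within.
have st : represents [ffun i => tape_of_seq (if i == ord0 then map inl s else [::])] (init_tapes s).
  split=> [|i]; first by rewrite /= size_nseq.
  rewrite ffunE view_of_seq; case: i => -[|i] //= Hi.
  by rewrite nth_nseq if_same.
have := reach_tm R st => H.
by rewrite -(subnK lk) iterD (tm_halt_iter _ H).
Qed.

End Machines.

Arguments ret {A aux nt O} o.
Arguments blank {A aux}.

Arguments head_move : simpl never.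
Arguments head_write : simpl never.

(** * Elementary operations on tapes *)

Section Prims.
Variables (A aux : finType) (nt : nat).
Local Notation X := (A + aux)%type.
Local Notation cell := (option X).
Local Notation idx := 'I_nt.+1.
Local Notation tapes := (seq (atape A aux)).
Local Notation mach := (@mach A aux nt).
Implicit Types (T : tapes) (i j : idx) (l r : seq X) (x : X).

Definition cur T (i : nat) := nth blank T i.
Definition upd T (i : nat) t : tapes := set_nth blank T i t.

Lemma cur_upd T i t : cur (upd T i t) i = t.
Proof. by rewrite /cur nth_set_nth /= eqxx. Qed.
Lemma cur_upd_ne T (i j : nat) t : j != i -> cur (upd T i t) j = cur T j.
Proof. by rewrite /cur nth_set_nth /= => /negPf->. Qed.
Lemma upd_upd T (i : nat) t t' : upd (upd T i t) i t' = upd T i t'.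
Proof. by rewrite /upd set_set_nth eqxx. Qed.
Lemma upd_updC T (i j : nat) t t' : i != j -> upd (upd T i t) j t' = upd (upd T j t') i t.
Proof. by rewrite /upd set_set_nth => /negPf->. Qed.
Lemma size_upd T i t : i < size T -> size (upd T i t) = size T.
Proof. by rewrite size_set_nth => /maxn_idPr. Qed.
Lemma upd_id T (i : nat) t : i < size T -> cur T i = t -> upd T i t = T.
Proof.
move=> lt <-; apply: (@eq_from_nth _ blank).
  by rewrite size_set_nth; apply/maxn_idPr.
by move=> k _; rewrite nth_set_nth /=; case: eqP => // ->.
Qed.

Lemma head_move_right l r x : head_move MoveRight (head_write (Some x) (zipper l r)) = zipper (x :: l) (behead r).
Proof. by rewrite /head_move /head_write /zipper /= scons_onth !stail_onth. Qed.
Lemma head_stay l x r : head_move Stay (head_write (Some x) (zipper l (x :: r))) = zipper l (x :: r).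
Proof. by rewrite /head_move /head_write /zipper /= stail_onth scons_onth. Qed.
Lemma head_stay_end l : head_move Stay (head_write None (zipper l [::])) = zipper l ([::] : seq X).
Proof. by rewrite /head_move /head_write /zipper /= stail_onth scons_nil. Qed.

(** At the end of the word the head stays, so that it always lies on the word
    or on the first blank after it. *)
Definition fetch i : mach cell :=
  op i (fun c => (c, (c, if c is Some _ then MoveRight else Stay))).

Lemma exec_fetch T i l x r : cur T i = zipper l (x :: r) ->
  exec (fetch i) T 1 (Some x) (upd T i (zipper (x :: l) r)).
Proof.
rewrite /cur => e; have := @exec_op A aux nt _ i (fun c => (c, (c, if c is Some _ then MoveRight else Stay))) T.
by rewrite /tape_act e /= head_move_right.
Qed.

Lemma exec_fetch_nil T i l : cur T i = zipper l [::] ->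
  exec (fetch i) T 1 None (upd T i (zipper l [::])).
Proof.
rewrite /cur => e; have := @exec_op A aux nt _ i (fun c => (c, (c, if c is Some _ then MoveRight else Stay))) T.
by rewrite /tape_act e /= head_stay_end.
Qed.

Definition peek i : mach cell := op i (fun c => (c, (c, Stay))).

Lemma exec_peek T i l r : cur T i = zipper l r ->
  exec (peek i) T 1 (ohead r) (upd T i (zipper l r)).
Proof.
rewrite /cur => e; have := @exec_op A aux nt _ i (fun c => (c, (c, Stay))) T.
by rewrite /tape_act e /=; case: r e => [|x r] /= e; rewrite ?head_stay ?head_stay_end.
Qed.

Definition push i x : mach unit := op i (fun _ => (tt, (Some x, MoveRight))).

Lemma exec_push T i l x : cur T i = zipper l [::] ->
  exec (push i x) T 1 tt (upd T i (zipper (x :: l) [::])).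
Proof.
rewrite /cur => e; have := @exec_op A aux nt _ i (fun _ => (tt, (Some x, MoveRight))) T.
by rewrite /tape_act e /= head_move_right.
Qed.

Definition chop i : mach cell :=
  op i (fun c => (c, (None, if c is Some _ then MoveRight else Stay))).

Lemma exec_chop T i x r : cur T i = zipper [::] (x :: r) ->
  exec (chop i) T 1 (Some x) (upd T i (zipper [::] r)).
Proof.
rewrite /cur => e.
have := @exec_op A aux nt _ i (fun c => (c, (None, if c is Some _ then MoveRight else Stay))) T.
by rewrite /tape_act e /= /head_move /head_write /zipper /= scons_nil stail_scons stail_onth.
Qed.

Definition mleft i : mach unit := op i (fun c => (tt, (c, MoveLeft))).

Lemma scons_stail (s : stream A aux) : scons (s 0) (stail s) = s.
Proof. by apply/funext => -[]. Qed.

Lemma exec_mleft T i : exec (mleft i) T 1 tt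
  (upd T i (stail (cur T i).1, scons ((cur T i).1 0) (cur T i).2)).
Proof.
have := @exec_op A aux nt _ i (fun c => (tt, (c, MoveLeft))) T.
by rewrite /tape_act -/(cur _ _) -/(upd _ _ _) /head_move /head_write /head_read /= scons_stail.
Qed.

Lemma exec_leftop O T i (f : cell -> O * (cell * move)) t o a :
  t = (stail (cur T i).1, scons ((cur T i).1 0) (cur T i).2) ->
  f ((cur T i).1 0) = (o, a) ->
  exec (bind (mleft i) (fun _ => op i f)) T 2 o (upd T i (head_move a.2 (head_write a.1 t))).
Proof.
move=> et ef; apply: (exec_bind (exec_mleft T i)); rewrite -et.
have := @exec_op A aux nt _ i f (upd T i t).
by rewrite /tape_act -/(cur _ _) cur_upd -/(upd _ _ _) upd_upd et /head_read /= ef.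
Qed.

(** Being on the first letter is detected by meeting a blank on the left, and
    the step to the left is then undone.  The same device serves [pop]. *)
Definition back i : mach cell :=
  bind (mleft i) (fun _ => op i (fun c => (c, (c, if c is Some _ then Stay else MoveRight)))).

Lemma zipper_left x l r :
  zipper l (x :: r) = (stail (zipper (x :: l) r).1, scons ((zipper (x :: l) r).1 0) (zipper (x :: l) r).2).
Proof. by rewrite /zipper /= stail_onth scons_onth. Qed.

Lemma zipper_left0 r :
  (onth [::], scons None (onth r)) =
  (stail (zipper [::] r).1, scons ((zipper [::] r).1 0) (zipper [::] r).2).
Proof. by rewrite /zipper /= stail_onth. Qed.

Lemma exec_back T i x l r : cur T i = zipper (x :: l) r ->
  exec (back i) T 2 (Some x) (upd T i (zipper l (x :: r))).
Proof.
move=> e; rewrite -(head_stay l x r).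
apply: (@exec_leftop _ _ _ _ _ _ (Some x, Stay)); rewrite e //; exact: zipper_left.
Qed.

Lemma exec_back_nil T i r : cur T i = zipper [::] r ->
  exec (back i) T 2 None (upd T i (zipper [::] r)).
Proof.
move=> e; have -> : zipper [::] r = head_move MoveRight (head_write None (onth [::], scons None (onth r))).
  by rewrite /head_move /head_write /= !stail_scons scons_nil.
by apply: (@exec_leftop _ _ _ _ _ _ (None, MoveRight)); rewrite e // -zipper_left0.
Qed.

Definition pop i : mach cell :=
  bind (mleft i) (fun _ => op i (fun c => (c, (None, if c is Some _ then Stay else MoveRight)))).

Lemma exec_pop T i x l : cur T i = zipper (x :: l) [::] ->
  exec (pop i) T 2 (Some x) (upd T i (zipper l [::])).
Proof.
move=> e; have -> : zipper l [::] = head_move Stay (head_write None (zipper l [:: x])).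
  by rewrite /head_move /head_write /zipper /= stail_onth scons_nil.
apply: (@exec_leftop _ _ _ _ _ _ (None, Stay)); rewrite e //; exact: zipper_left.
Qed.

Lemma exec_pop_nil T i : cur T i = zipper [::] [::] ->
  exec (pop i) T 2 None (upd T i (zipper [::] [::])).
Proof.
move=> e; have -> : zipper [::] [::] = head_move MoveRight (head_write None (onth [::], scons None (onth ([::] : seq X)))).
  by rewrite /head_move /head_write /= !stail_scons scons_nil.
by apply: (@exec_leftop _ _ _ _ _ _ (None, MoveRight)); rewrite e // -zipper_left0.
Qed.

Lemma exec_ret O (o : O) T : 0 < size T -> exec (ret o : mach O) T 1 o T.
Proof.
move=> lt; have stay (t : atape A aux) : head_move Stay (head_write (head_read t) t) = t.
  by case: t => L R; rewrite /head_move /head_write /head_read /= scons_stail.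
have := @exec_op A aux nt _ ord0 (fun c => (o, (c, Stay))) T.
by rewrite /tape_act /fst /snd stay -/(upd _ _ _) upd_id.
Qed.
End Prims.

Arguments fetch {A aux nt} i.
Arguments peek {A aux nt} i.
Arguments chop {A aux nt} i.
Arguments mleft {A aux nt} i.
Arguments back {A aux nt} i.
Arguments pop {A aux nt} i.

(** * Stacks of letters with free cancellation *)

Section FreeReduction.
Variables (E : finType) (inv : E -> E).
Definition pushr (st : seq E) (e : E) : seq E :=
  if st is y :: st' then if y == inv e then st' else e :: st else [:: e].
Definition inv_word (w : seq E) := rev (map inv w).

Lemma size_pushr st e : size (pushr st e) <= (size st).+1.
Proof. by case: st => //= y st; case: ifP => _ //=; lia. Qed.

Lemma size_pushrs st ws : size (foldl pushr st ws) <= size st + size ws.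
Proof.
elim: ws st => [|e ws IH] st /=; first by lia.
by have := IH (pushr st e); have := size_pushr st e; lia.
Qed.
End FreeReduction.

(** * Loops over tapes *)

Section Loops.
Variables (A aux : finType) (nt : nat).
Local Notation X := (A + aux)%type.
Local Notation cell := (option X).
Local Notation idx := 'I_nt.+1.
Local Notation tapes := (seq (atape A aux)).
Local Notation mach := (@mach A aux nt).
Implicit Types (T : tapes) (i j : idx) (l r : seq X) (x : X).

Lemma size_gt0 T i l r : 0 < size (upd T i (zipper l r)).
Proof. by rewrite /upd size_set_nth; lia. Qed.

Lemma exec_seq (O : finType) O' (M : mach O) (K : O -> mach O') T n o T1 n' o' T2 N :
  exec M T n o T1 -> exec (K o) T1 n' o' T2 -> n + n' <= N -> exec (bind M K) T N o' T2.
Proof. by move=> h h'; apply: exec_le (exec_bind h h'). Qed.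

Definition rewind i : mach unit :=
  loop (fun _ : unit => bind (back i) (fun c => ret (if c is Some _ then inl tt else inr tt))) tt.

Lemma exec_rewind T i l r : cur T i = zipper l r ->
  exec (rewind i) T (3 * size l + 3) tt (upd T i (zipper [::] (catrev l r))).
Proof.
elim: l T r => [|x l IH] T r e.
  apply: exec_loop_exit; apply: (exec_bind (exec_back_nil e)); exact: exec_ret (size_gt0 _ _ _ _).
rewrite -(upd_upd T i (zipper l (x :: r))) /=.
apply: (@exec_le _ _ _ _ _ _ (2 + 1 + (3 * size l + 3))); last by lia.
apply: (@exec_loop_next _ _ _ _ _ _ tt tt); last by apply: IH; rewrite cur_upd.
apply: (exec_bind (exec_back e)); exact: exec_ret (size_gt0 _ _ _ _).
Qed.

Definition fwd i : mach unit :=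
  loop (fun _ : unit => bind (fetch i) (fun c => ret (if c is Some _ then inl tt else inr tt))) tt.

Lemma exec_fwd T i l r : cur T i = zipper l r ->
  exec (fwd i) T (2 * size r + 2) tt (upd T i (zipper (catrev r l) [::])).
Proof.
elim: r T l => [|x r IH] T l e.
  apply: exec_loop_exit; apply: (exec_bind (exec_fetch_nil e)); exact: exec_ret (size_gt0 _ _ _ _).
rewrite -(upd_upd T i (zipper (x :: l) r)) /=.
apply: (@exec_le _ _ _ _ _ _ (1 + 1 + (2 * size r + 2))); last by lia.
apply: (@exec_loop_next _ _ _ _ _ _ tt tt); last by apply: IH; rewrite cur_upd.
apply: (exec_bind (exec_fetch e)); exact: exec_ret (size_gt0 _ _ _ _).
Qed.

Definition drain i : mach unit :=
  loop (fun _ : unit => bind (pop i) (fun c => ret (if c is Some _ then inl tt else inr tt))) tt.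

Lemma exec_drain T i l : cur T i = zipper l [::] ->
  exec (drain i) T (3 * size l + 3) tt (upd T i (zipper [::] [::])).
Proof.
elim: l T => [|x l IH] T e.
  apply: exec_loop_exit; apply: (exec_bind (exec_pop_nil e)); exact: exec_ret (size_gt0 _ _ _ _).
rewrite -(upd_upd T i (zipper l [::])) /=.
apply: (@exec_le _ _ _ _ _ _ (2 + 1 + (3 * size l + 3))); last by lia.
apply: (@exec_loop_next _ _ _ _ _ _ tt tt); last by apply: IH; rewrite cur_upd.
apply: (exec_bind (exec_pop e)); exact: exec_ret (size_gt0 _ _ _ _).
Qed.

Definition clear i : mach unit := bind (fwd i) (fun _ => drain i).

Lemma exec_clear T i l r : cur T i = zipper l r ->
  exec (clear i) T (5 * (size r + size l) + 5) tt (upd T i (zipper [::] [::])).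
Proof.
move=> /exec_fwd e; rewrite -(upd_upd T i (zipper (catrev r l) [::])).
have h := @exec_drain (upd T i (zipper (catrev r l) [::])) i (catrev r l) (cur_upd _ _ _).
apply: exec_le; first by apply: (exec_bind e); exact: h.
rewrite catrevE size_cat size_rev; lia.
Qed.

(** The correctness of a scan is a statement about [foldl]: the contents of the
    other tapes are a function [mk] of an abstract state [d], of which the
    machine knows the finite part [getz d]. *)
Section Scan.
Variables (Z : finType) (i : idx) (f : Z -> X -> mach Z).

Definition scan (z : Z) : mach Z :=
  loop (fun z => bind (fetch i) (fun c =>
    if c is Some x then bind (f z x) (fun z' => ret (inl z')) else ret (inr z))) z.

Variables (Y D : Type) (h : Y -> X) (getz : D -> Z) (mk : D -> atape A aux -> tapes)
  (step : D -> Y -> D) (c : nat).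
Hypothesis (curmk : forall d t, cur (mk d t) i = t).
Hypothesis (updmk : forall d t t', upd (mk d t) i t' = mk d t').
Hypothesis (szmk : forall d t, 0 < size (mk d t)).
Hypothesis (body : forall d y t,
  exec (f (getz d) (h y)) (mk d t) c (getz (step d y)) (mk (step d y) t)).

Lemma exec_scan l w d :
  exec (scan (getz d)) (mk d (zipper l (map h w))) ((c + 2) * size w + 2)
    (getz (foldl step d w)) (mk (foldl step d w) (zipper (catrev (map h w) l) [::])).
Proof.
elim: w l d => [|y w IH] l d /=.
  apply: exec_loop_exit.
  have e := exec_fetch_nil (curmk d (zipper l [::])); rewrite updmk in e.
  by rewrite muln0; apply: (exec_bind e); apply: exec_ret.
have e := exec_fetch (curmk d (zipper l (h y :: map h w))); rewrite updmk in e.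
apply: (@exec_le _ _ _ _ _ _ (1 + (c + 1) + ((c + 2) * size w + 2))); last by lia.
apply: (@exec_loop_next _ _ _ _ _ _ _ (getz (step d y))) (IH (h y :: l) (step d y)).
by apply: (exec_bind e); apply: (exec_bind (body _ _ _)); apply: exec_ret.
Qed.
End Scan.

Definition copy i j (g : X -> X) : mach unit := scan i (fun _ x => push j (g x)) tt.

Lemma exec_copy T i j g Y (h : Y -> X) l w lj : i != j -> i < size T -> j < size T ->
  cur T i = zipper l (map h w) -> cur T j = zipper lj [::] ->
  exec (copy i j g) T (3 * size w + 2) tt
    (upd (upd T i (zipper (catrev (map h w) l) [::]))
       j (zipper (catrev (map (g \o h) w) lj) [::])).
Proof.
move=> ne lti ltj ei ej.
have ne' : i != j :> nat by rewrite (inj_eq val_inj).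
pose mk (d : seq X) t := upd (upd T i t) j (zipper d [::]).
pose step (d : seq X) (y : Y) := g (h y) :: d.
have e0 : T = mk lj (zipper l (map h w)).
  by rewrite /mk (upd_id lti ei) (upd_id ltj ej).
have fe d : foldl step d w = catrev (map (g \o h) w) d by elim: w d {ei e0} => //=.
rewrite [in exec _ T]e0 -fe.
apply: (@exec_scan unit i _ Y (seq X) h (fun=> tt) mk step 1).
- by move=> d t; rewrite /mk cur_upd_ne ?cur_upd.
- by move=> d t t'; rewrite /mk upd_updC 1?eq_sym // upd_upd.
- by move=> d t; rewrite size_gt0.
- move=> d y t; rewrite -[mk (step d y) t](upd_upd _ _ (zipper d [::])).
  by apply: exec_push; rewrite cur_upd.
Qed.

Section PushCancel.
Variables (E : finType) (inv : E -> E) (sym : E -> X).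
Hypothesis sym_inj : injective sym.

(** The top letter is popped to be compared with the new one, and written back
    if they do not cancel. *)
Definition pushC i (e : E) : mach unit :=
  bind (pop i) (fun c =>
    if c is Some y then
      if y == sym (inv e) then ret tt
      else bind (push i y) (fun _ => push i (sym e))
    else push i (sym e)).

Lemma exec_pushC T i st e : cur T i = zipper (map sym st) [::] ->
  exec (pushC i e) T 4 tt (upd T i (zipper (map sym (pushr inv st e)) [::])).
Proof.
case: st => [|y st] /= ce.
  apply: (exec_seq (n' := 1) (exec_pop_nil ce)) => //.
  rewrite -[upd _ _ (zipper [:: _] _)](upd_upd _ _ (zipper [::] [::])).
  by apply: exec_push; rewrite cur_upd.
apply: (exec_seq (n' := 2) (exec_pop ce)) => //.
rewrite (inj_eq sym_inj); case: eqP => _.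
  by apply: (@exec_le _ _ _ _ _ _ 1) => //; apply: exec_ret; apply: size_gt0.
rewrite -[upd _ _ (zipper (map _ [:: e , y & st]) _)](upd_upd _ _ (zipper (sym y :: map sym st) [::])).
apply: (@exec_seq _ _ _ _ _ 1 tt _ 1) (isT : 1 + 1 <= 2); last by apply: exec_push; rewrite cur_upd.
rewrite -[upd _ _ (zipper (sym y :: _) _)](upd_upd _ _ (zipper (map sym st) [::])).
by apply: exec_push; rewrite cur_upd.
Qed.

Fixpoint pushCs i (ws : seq E) : mach unit :=
  if ws is e :: ws' then bind (pushC i e) (fun _ => pushCs i ws') else ret tt.

Lemma exec_pushCs T i st ws : i < size T -> cur T i = zipper (map sym st) [::] ->
  exec (pushCs i ws) T (4 * size ws + 1) tt
    (upd T i (zipper (map sym (foldl (pushr inv) st ws)) [::])).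
Proof.
move=> lt; elim: ws T lt st => [|e ws IH] T lt st ce /=.
  rewrite upd_id //; apply: exec_ret; lia.
rewrite -(upd_upd T i (zipper (map sym (pushr inv st e)) [::])).
apply: (exec_seq (exec_pushC _ ce) (IH _ _ _ (cur_upd _ _ _))); last by lia.
by rewrite size_upd.
Qed.

End PushCancel.
End Loops.
Arguments rewind {A aux nt} i.
Arguments fwd {A aux nt} i.
Arguments drain {A aux nt} i.
Arguments clear {A aux nt} i.

(** * Comparison of cyclic words *)

Section Rotations.
Variables (Y : finType) (a0 : Y).
Implicit Types (x y : seq Y).

Definition letter_rank (a : Y) : nat := enum_rank a.
Lemma letter_rank_inj : injective letter_rank. Proof. by move=> a b /ord_inj /enum_rank_inj. Qed.
Lemma letter_rank_lt a : letter_rank a < #|Y|. Proof. exact: ltn_ord. Qed.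

(** The number with digits [w] in base [#|Y|], after the leading part [v]: for
    words of equal length, the lexicographic order becomes the order of
    numbers. *)
Fixpoint code (v : nat) (w : seq Y) : nat :=
  if w is a :: w' then code (v * #|Y| + letter_rank a) w' else v.

Lemma code_cat v w w' : code v (w ++ w') = code (code v w) w'.
Proof. by elim: w v => /=. Qed.

Lemma code_split v w : code v w = v * #|Y| ^ size w + code 0 w.
Proof.
elim: w v => [|a w IH] v /=; first by rewrite muln1 addn0.
by rewrite IH (IH (0 * _ + _)) mul0n add0n expnS mulnDl mulnA addnA.
Qed.

Lemma code_bound w : code 0 w < #|Y| ^ size w.
Proof.
elim: w => [|a w IH] //=; rewrite code_split mul0n add0n expnS.
by have := letter_rank_lt a; move: (code 0 w) #|Y| (#|Y| ^ _) IH => c B D IH; nia.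
Qed.

Lemma code_lt w a b w1 w2 : size w1 = size w2 -> letter_rank a < letter_rank b ->
  code 0 (w ++ a :: w1) < code 0 (w ++ b :: w2).
Proof.
move=> es lt; rewrite !code_cat /= (code_split _ w1) (code_split _ w2) es.
have := code_bound w1; rewrite es.
move: (code 0 w1) (code 0 w2) (code 0 w * _) (#|Y| ^ _) => c1 c2 v D; nia.
Qed.

Definition cyc_nth x t := nth a0 x (t %% size x).
Definition turn x p := mkseq (fun t => cyc_nth x (p + t)) (size x).

Lemma cyc_nth_rot x r t : r <= size x -> cyc_nth (rot r x) t = cyc_nth x (t + r).
Proof.
rewrite /cyc_nth size_rot; case: (posnP (size x)) => [/size0nil -> |n0] lr; first by rewrite !nth_nil.
rewrite -modnDml; set s := t %% _; have : s < size x by rewrite ltn_mod.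
rewrite /rot nth_cat size_drop => ls; case: ltnP => h.
  by rewrite nth_drop modn_small 1?addnC //; lia.
rewrite nth_take; last by lia.
have -> : s + r = (s - (size x - r)) + size x by lia.
by rewrite modnDr modn_small //; lia.
Qed.

Lemma eq_cyc_nth x y : size x = size y -> (forall t, t < size x -> cyc_nth x t = cyc_nth y t) -> x = y.
Proof.
move=> es h; apply: (@eq_from_nth _ a0) => // t lt.
by have := h t lt; rewrite /cyc_nth -es modn_small.
Qed.

(** If [x] and [y] are rotations of each other, this means that the rotation of
    [x] at [p] is not the smallest one. *)
Definition beat x y p := exists q, code 0 (turn y q) < code 0 (turn x p).

(** The smallest rotation of [x] exceeds no rotation of [rot r x], since these
    are rotations of [x]. *)
Lemma not_beaten x r : 0 < size x -> ~ (forall p, p < size x -> beat x (rot r x) p).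
Proof.
move=> n0 h.
case: (@arg_minnP _ (Ordinal n0) predT (fun p : 'I_(size x) => code 0 (turn x p))) => // p _ pmin.
have [q] := h p (ltn_ord p).
have -> : turn (rot r x) q = turn x ((q + minn r (size x)) %% size x).
  rewrite /turn size_rot; apply: eq_map => t.
  have -> : rot r x = rot (minn r (size x)) x.
    case: (leqP r (size x)) => // /ltnW lr.
    by rewrite rot_oversize // rot_size.
  rewrite cyc_nth_rot ?geq_minr // /cyc_nth modnDml; congr nth; congr (_ %% _); lia.
have lt : (q + minn r (size x)) %% size x < size x by rewrite ltn_mod.
by have := pmin (Ordinal lt) isT; rewrite /= leqNgt => /negP.
Qed.

(** The first mismatch between the rotations at [i] and [j] occurs after [k]
    letters; for each [p <= k], dropping [p] of these common letters from both
    leaves two rotations with the same first mismatch.  One comparison thus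
    disqualifies [k.+1] starting points at once, and this is why the comparison
    of cyclic words takes linear time. *)
Lemma beat_mismatch x y i j k : size x = size y -> k < size x ->
  (forall t, t < k -> cyc_nth x (i + t) = cyc_nth y (j + t)) ->
  letter_rank (cyc_nth y (j + k)) < letter_rank (cyc_nth x (i + k)) ->
  forall p, p <= k -> beat x y (i + p).
Proof.
move=> es lk eqt lt p lp; exists (j + p).
have split z l : size z = size x -> turn z (l + p) =
   mkseq (fun t => cyc_nth z (l + p + t)) (k - p) ++ cyc_nth z (l + k)
     :: mkseq (fun t => cyc_nth z (l + k.+1 + t)) (size x - (k - p).+1).
  move=> ez; rewrite /turn ez -{1}(subnKC (_ : k - p < size x)); last by lia.
  rewrite addSn -addnS /mkseq iotaD map_cat /= add0n; congr (_ ++ _ :: _).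
    by congr cyc_nth; lia.
  rewrite -[(k - p).+1]addn0 iotaDl -map_comp; apply: eq_map => t /=.
  by congr cyc_nth; lia.
rewrite (split x) // (split y) //.
have -> : mkseq (fun t => cyc_nth x (i + p + t)) (k - p) = mkseq (fun t => cyc_nth y (j + p + t)) (k - p).
  apply/eq_in_map => t; rewrite mem_iota add0n => /andP[_ lt'].
  by rewrite -!addnA eqt //; lia.
by apply: code_lt; rewrite ?size_mkseq.
Qed.

Lemma match_rot x y i j : size x = size y -> i < size x -> j < size x ->
  (forall t, t < size x -> cyc_nth x (i + t) = cyc_nth y (j + t)) -> exists r, rot r x = y.
Proof.
move=> es li lj h.
have e : rot i x = rot j y.
  apply: eq_cyc_nth; first by rewrite !size_rot.
  by move=> t; rewrite size_rot => lt; rewrite !cyc_nth_rot -?es 1?ltnW // ![t + _]addnC h.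
by exists (rot_add x i (size y - j)); rewrite -rot_rot_add e -(size_rot j) -/(rotr _ _) rotK.
Qed.
End Rotations.

(** * The tapes of the algorithm *)

Section Algo.
Variables (S E : finType) (inv : E -> E) (m : nat).
Notation Q := {perm 'I_m}.
Variables (sigmaS : S -> Q) (sigmaE : E -> Q) (tab : 'I_m -> S -> seq E)
  (tabE : 'I_m -> E -> seq E) (twist : 'I_m -> Q) (i0 : 'I_m) (reps C L : nat).
Hypothesis tabL : forall i s, size (tab i s) <= L.
Hypothesis tabEL : forall i e, size (tabE i e) <= L.
Hypothesis LC : L < C.

(** The auxiliary symbols are basis letters, labelled basis letters with a flag
    for the second copy in a doubled word, the numbers shown by the counter, and
    a mark. *)
Definition auxT : finType := (E + (Q * E) * bool + option 'I_C.+1)%type.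
Local Notation A := (option S).
Local Notation X := (A + auxT)%type.
Local Notation cell := (option X).
Local Notation tape := (atape A auxT).
Local Notation mach := (@mach A auxT 10).
Local Notation tapes := (seq tape).

Definition symS (s : S) : X := inl (Some s).
Definition symE (e : E) : X := inr (inl (inl e)).
Definition symL b (l : Q * E) : X := inr (inl (inr (l, b))).
Definition symD (d : 'I_C.+1) : X := inr (inr (Some d)).
Definition mark : X := inr (inr None).

Lemma symE_inj : injective symE. Proof. by move=> ? ? []. Qed.

Definition setb (f : bool -> tape) (b : bool) (t : tape) : bool -> tape :=
  fun b' => if b' == b then t else f b'.

Lemma setbE f b t : setb f b t b = t. Proof. by rewrite /setb eqxx. Qed.
Lemma setb_id f b t : f b = t -> setb f b t = f.
Proof. by move=> <-; apply/funext => b'; rewrite /setb; case: eqP => // ->. Qed.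
Lemma setbb f b t t' : setb (setb f b t) b t' = setb f b t'.
Proof. by apply/funext => b'; rewrite /setb; case: eqP. Qed.

(** The tapes are the input [t], the two input words [W], a stack [B], a stack
    of marks [M], the labelled words [P], the doubled labelled words [D] and the
    counters [K].  In the search for short conjugates [P] and [D] are used for
    the word read and for the stack.  Numbering the tapes of a pair by booleans
    lets one program serve both words. *)
Definition bank (t : tape) (W : bool -> tape) (B M : tape) (P D K : bool -> tape) : tapes :=
  [:: t; W false; W true; B; M; P false; P true; D false; D true; K false; K true].
Definition iI : 'I_11 := ord0.
Definition iW (b : bool) : 'I_11 := if b then @Ordinal 11 2 isT else @Ordinal 11 1 isT.
Definition iB : 'I_11 := @Ordinal 11 3 isT.
Definition iM : 'I_11 := @Ordinal 11 4 isT.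
Definition iP (b : bool) : 'I_11 := if b then @Ordinal 11 6 isT else @Ordinal 11 5 isT.
Definition iD (b : bool) : 'I_11 := if b then @Ordinal 11 8 isT else @Ordinal 11 7 isT.
Definition iK (b : bool) : 'I_11 := if b then @Ordinal 11 10 isT else @Ordinal 11 9 isT.

Arguments iW : simpl never.
Arguments iP : simpl never.
Arguments iD : simpl never.
Arguments iK : simpl never.

Lemma exec_eq O (M : mach O) T n o o' T1 T2 :
  exec M T n o T1 -> T1 = T2 -> o = o' -> exec M T n o' T2.
Proof. by move=> h <- <-. Qed.

Section BankRules.
Variables (t : tape) (W : bool -> tape) (B M : tape) (P D K : bool -> tape) (b : bool) (u : tape).
Notation T := (bank t W B M P D K).
Lemma cur_I : cur T iI = t. Proof. by []. Qed.
Lemma cur_W : cur T (iW b) = W b. Proof. by case: b. Qed.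
Lemma cur_B : cur T iB = B. Proof. by []. Qed.
Lemma cur_M : cur T iM = M. Proof. by []. Qed.
Lemma cur_P : cur T (iP b) = P b. Proof. by case: b. Qed.
Lemma cur_D : cur T (iD b) = D b. Proof. by case: b. Qed.
Lemma cur_K : cur T (iK b) = K b. Proof. by case: b. Qed.
Lemma upd_I : upd T iI u = bank u W B M P D K. Proof. by []. Qed.
Lemma upd_W : upd T (iW b) u = bank t (setb W b u) B M P D K. Proof. by case: b. Qed.
Lemma upd_B : upd T iB u = bank t W u M P D K. Proof. by []. Qed.
Lemma upd_M : upd T iM u = bank t W B u P D K. Proof. by []. Qed.
Lemma upd_P : upd T (iP b) u = bank t W B M (setb P b u) D K. Proof. by case: b. Qed.
Lemma upd_D : upd T (iD b) u = bank t W B M P (setb D b u) K. Proof. by case: b. Qed.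
Lemma upd_K : upd T (iK b) u = bank t W B M P D (setb K b u). Proof. by case: b. Qed.
End BankRules.

Definition curE := (cur_I, cur_W, cur_B, cur_M, cur_P, cur_D, cur_K, setbE).
Definition updE := (upd_I, upd_W, upd_B, upd_M, upd_P, upd_D, upd_K, setbb).

(** One instruction of a program: the rule [lem] is applied, its premises on the
    contents of tapes are looked up in the bank and the update is carried out
    there.  The bound on the remaining time is left open, or is [k] in
    [step_within]. *)
Ltac tape_rules := rewrite ?curE; try reflexivity; try eassumption.
Ltac step_with lem := eapply exec_bind; [eapply lem; tape_rules | rewrite ?updE /=].
Ltac last_with lem := eapply exec_eq; [eapply lem; tape_rules | rewrite ?updE //= | try done].
Ltac step_within k lem := eapply (exec_seq (n' := k)); [eapply lem; tape_rules | rewrite ?updE /= | try lia].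
Ltac ret_within := eapply exec_le; [by apply: exec_ret | try lia].

(** * Reading a word *)

Implicit Types (i : 'I_11) (j : 'I_m) (q : Q) (T : tapes).

(** If the part read is [x], the first component is [sigma x] and the stack
    holds the element of [H] in [rho_j x = h rho_(sigma x j)]. *)
Definition read_step (j : 'I_m) (d : Q * seq E) (s : S) : Q * seq E :=
  ((d.1 * sigmaS s)%g, foldl (pushr inv) d.2 (tab (d.1 j) s)).

Definition pass (i b : 'I_11) (j : 'I_m) (q : Q) : mach Q :=
  scan i (fun (q : Q) x => if x is inl (Some s) then
    bind (pushCs inv symE b (tab (q j) s)) (fun _ => ret (q * sigmaS s)%g) else ret q) q.

Lemma exec_pass T i (b : 'I_11) j q l w st : i != b -> i < size T -> b < size T ->
  cur T i = zipper l (map symS w) -> cur T b = zipper (map symE st) [::] ->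
  exec (pass i b j q) T ((4 * L + 4) * size w + 2) (foldl (read_step j) (q, st) w).1
    (upd (upd T i (zipper (catrev (map symS w) l) [::])) b
      (zipper (map symE (foldl (read_step j) (q, st) w).2) [::])).
Proof.
move=> ne lti ltb ei eb.
have ne' : i != b :> nat by rewrite (inj_eq val_inj).
pose mk (d : Q * seq E) t := upd (upd T i t) b (zipper (map symE d.2) [::]).
have e0 : T = mk (q, st) (zipper l (map symS w)).
  by rewrite /mk (upd_id lti ei) (upd_id ltb eb).
rewrite [in exec _ T]e0 (_ : (4 * L + 4) = (4 * L + 1 + 1) + 2); last by lia.
apply: (@exec_scan _ _ _ Q i _ S (Q * seq E) symS fst mk (read_step j) (4 * L + 1 + 1)
  _ _ _ _ l w (q, st)).
- by move=> d t; rewrite /mk cur_upd_ne ?cur_upd.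
- by move=> d t t'; rewrite /mk upd_updC // upd_upd upd_updC // eq_sym.
- by move=> d t; rewrite size_gt0.
- move=> [p ss] s t; apply: (exec_bind (n := 4 * L + 1)); last first.
    by apply: exec_ret; rewrite /mk /= size_gt0.
  apply: (@exec_le _ _ _ _ _ _ (4 * size (tab (p j) s) + 1)); last by have := tabL (p j) s; lia.
  have := @exec_pushCs _ _ _ _ inv _ symE_inj (mk (p, ss) t) b ss (tab (p j) s).
  rewrite {2 3}/mk upd_upd cur_upd; apply => //.
  by rewrite /mk !size_upd // size_upd.
Qed.

Definition push_run (j : 'I_m) (k : nat) (w : seq S) (d : Q * seq E) : Q * seq E :=
  iter k (fun d => foldl (read_step j) d w) d.

Lemma size_read_steps j d w : size (foldl (read_step j) d w).2 <= size d.2 + L * size w.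
Proof.
elim: w d => [|s w IH] d /=; first by lia.
apply: leq_trans (IH _) _; rewrite /read_step /= mulnS.
have := size_pushrs inv d.2 (tab (d.1 j) s); have := tabL (d.1 j) s. lia.
Qed.

Lemma size_push_run j k w d : size (push_run j k w d).2 <= size d.2 + k * (L * size w).
Proof.
elim: k => [|k IH] /=; first by lia.
by apply: leq_trans (size_read_steps _ _ _) _; rewrite -/(push_run _ _ _ _) mulSn; lia.
Qed.

Definition reread (i b : 'I_11) (j : 'I_m) (q : Q) : mach Q :=
  bind (rewind i) (fun _ => pass i b j q).

Fixpoint rounds (i b : 'I_11) (j : 'I_m) (k : nat) (q : Q) : mach unit :=
  if k is k'.+1 then bind (reread i b j q) (fun q' => rounds i b j k' q') else ret tt.

(** The first reading of [w] also yields the permutation [sigma w]; the next [k]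
    readings multiply the stack by further copies of [w]. *)
Definition push_power (i b : 'I_11) (j : 'I_m) (k : nat) : mach Q :=
  bind (reread i b j 1%g) (fun q => bind (rounds i b j k q) (fun _ => ret q)).

Definition wtape (w : seq S) : tape := zipper (rev (map symS w)) [::].
Definition stape (st : seq E) : tape := zipper (map symE st) [::].

Lemma exec_reread T i (b : 'I_11) j q w st : i != b -> i < size T -> b < size T ->
  cur T i = wtape w -> cur T b = stape st ->
  exec (reread i b j q) T ((4 * L + 7) * size w + 5)
    (foldl (read_step j) (q, st) w).1
    (upd T b (stape (foldl (read_step j) (q, st) w).2)).
Proof.
move=> ne lti ltb ei eb.
have ne' : i != b :> nat by rewrite (inj_eq val_inj).
have e1 := exec_rewind ei.
apply: (exec_seq (n' := (4 * L + 4) * size w + 2) e1); last first.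
  by rewrite size_rev size_map mulnDl mulnDl; lia.
rewrite catrevE revK cats0; set T1 := upd T i _.
have -> : upd T b (stape (foldl (read_step j) (q, st) w).2) =
  upd (upd T1 i (zipper (catrev (map symS w) [::]) [::])) b
      (zipper (map symE (foldl (read_step j) (q, st) w).2) [::]).
  by rewrite upd_upd (upd_id lti) // ei catrevE cats0.
apply: exec_pass; rewrite ?size_upd ?cur_upd // cur_upd_ne 1?eq_sym //.
Qed.

Lemma exec_rounds T i (b : 'I_11) j k q w st : i != b -> i < size T -> b < size T ->
  cur T i = wtape w -> cur T b = stape st ->
  exec (rounds i b j k q) T (k * ((4 * L + 7) * size w + 5) + 1) tt
    (upd T b (stape (push_run j k w (q, st)).2)).
Proof.
move=> ne lti ltb ei eb; elim: k q st T lti ltb ei eb => [|k IH] q st T lti ltb ei eb.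
  by rewrite /= upd_id //; apply: exec_ret; lia.
have ne' : i != b :> nat by rewrite (inj_eq val_inj).
have h := exec_reread j q ne lti ltb ei eb.
have := IH (foldl (read_step j) (q, st) w).1 (foldl (read_step j) (q, st) w).2
  (upd T b (stape (foldl (read_step j) (q, st) w).2)).
rewrite !size_upd // upd_upd cur_upd_ne // cur_upd -surjective_pairing.
move=> /(_ lti ltb ei erefl) h'; rewrite /push_run iterSr -/(push_run _ _ _ _).
by apply: (exec_seq h h'); rewrite mulSn; lia.
Qed.

Lemma exec_push_power T i (b : 'I_11) j k w : i != b -> i < size T -> b < size T ->
  cur T i = wtape w -> cur T b = stape [::] ->
  exec (push_power i b j k) T (k.+1 * ((4 * L + 7) * size w + 5) + 2)
    (foldl (read_step j) (1%g, [::]) w).1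
    (upd T b (stape (push_run j k.+1 w (1%g, [::])).2)).
Proof.
move=> ne lti ltb ei eb.
have ne' : i != b :> nat by rewrite (inj_eq val_inj).
have h := exec_reread j 1%g ne lti ltb ei eb.
have := @exec_rounds (upd T b (stape (foldl (read_step j) (1%g, [::]) w).2)) i b j k
  (foldl (read_step j) (1%g, [::]) w).1 w (foldl (read_step j) (1%g, [::]) w).2 ne.
rewrite !size_upd // upd_upd cur_upd_ne // cur_upd -surjective_pairing.
move=> /(_ lti ltb ei erefl) h'; rewrite /push_run iterSr -/(push_run _ _ _ _).
apply: (exec_seq h); first by apply: (exec_bind h'); apply: exec_ret; rewrite size_upd //; lia.
by rewrite mulSn; lia.
Qed.

(** * Labelling and cyclic reduction *)

(** A letter that follows the prefix [p] of [w] is labelled with the conjugate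
    of [q] by the permutation of [p]. *)
Fixpoint labels (q : Q) (w : seq E) : seq (Q * E) :=
  if w is e :: w' then (q, e) :: labels (q ^ sigmaE e)%g w' else [::].
Definition slide (q : Q) (w : seq E) : Q := foldl (fun q e => q ^ sigmaE e)%g q w.

Lemma labels_cat q w w' : labels q (w ++ w') = labels q w ++ labels (slide q w) w'.
Proof. by elim: w q => //= e w IH q; rewrite IH. Qed.
Lemma map_labels q w : map snd (labels q w) = w.
Proof. by elim: w q => //= e w IH q; rewrite IH. Qed.
Lemma size_labels q w : size (labels q w) = size w.
Proof. by rewrite -(size_map snd) map_labels. Qed.

Definition ltape (b : bool) (x : seq (Q * E)) : tape := zipper (rev (map (symL b) x)) [::].

Definition labelling (p : bool) (q : Q) : mach Q :=
  bind (rewind iB) (fun _ => scan iB (fun (q : Q) x =>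
    if x is inr (inl (inl e)) then
      bind (push (iP p) (symL false (q, e))) (fun _ => ret (q ^ sigmaE e)%g)
    else ret q) q).

Lemma exec_labelling t W st M P D K p q :
  exec (labelling p q) (bank t W (stape st) M (setb P p blank) D K)
    (7 * size st + 5) (slide q (rev st))
    (bank t W (stape st) M (setb P p (ltape false (labels q (rev st)))) D K).
Proof.
eapply exec_le; [eapply exec_bind; first by eapply exec_rewind; tape_rules | ].
- rewrite updE catrevE cats0 -map_rev.
  pose mk (d : Q * seq (Q * E)) u := bank t W u M (setb P p (zipper (map (symL false) d.2) [::])) D K.
  pose step (d : Q * seq (Q * E)) e := ((d.1 ^ sigmaE e)%g, (d.1, e) :: d.2).
  have -> : slide q (rev st) = (foldl step (q, [::]) (rev st)).1.
    have sE : forall w r acc, (foldl step (r, acc) w).1 = slide r w by elim=> //= e w IH r acc; rewrite IH.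
    by rewrite sE.
  have -> : bank t W (stape st) M (setb P p (ltape false (labels q (rev st)))) D K =
     mk (foldl step (q, [::]) (rev st)) (zipper (catrev (map symE (rev st)) [::]) [::]).
    rewrite /mk catrevE cats0 -map_rev revK /ltape -map_rev; congr bank; congr setb; congr zipper.
    have fE : forall w r acc, (foldl step (r, acc) w).2 = catrev (labels r w) acc by elim=> //= e w IH r acc; rewrite IH.
    by rewrite fE catrevE cats0.
  apply: (@exec_scan _ _ _ Q iB _ E (Q * seq (Q * E)) symE fst mk step 2 _ _ _ _ _ _ (q, [::])) => //.
  move=> [r acc] e u.
  apply: (@exec_bind _ _ _ _ _ _ _ _ 1 tt _ 1); last by apply: exec_ret.
  have := @exec_push _ _ 10 (mk (r, acc) u) (iP p) (map (symL false) acc) (symL false (r, e)).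
  by rewrite /mk ?curE ?updE; apply.
- by rewrite size_map size_rev; lia.
Qed.

(** The letters at the two ends of the word must be compared, but a tape has one
    head: the labelled word is consumed from its left end while the stack
    provides the same letters from the right end.  The marks count the letters
    that [trim] then removes from the right end of the labelled word. *)
Definition peel (p : bool) : mach unit :=
  loop (fun _ : unit => bind (peek (iP p)) (fun x =>
    if x is Some (inr (inl (inr ((q, e), _)))) then
      bind (pop iB) (fun y => if y is Some y' then
        if y' == symE (inv e) then
          bind (chop (iP p)) (fun _ => bind (push iM mark) (fun _ => ret (inl tt)))
        else bind (push iB y') (fun _ => ret (inr tt))
      else ret (inr tt))
    else ret (inr tt))) tt.

Definition cyc_reduced (c : seq E) := if c is e :: c' then last e c' != inv e else true.

Lemma exec_peel t W P D K p s1 s c r lw k :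
  map snd lw = s ++ c ++ r -> cyc_reduced c -> (c = [::] -> lw = [::]) ->
  exec (peel p) (bank t W (stape (rev (s1 ++ s ++ c ++ inv_word inv s))) (zipper (nseq k mark) [::])
      (setb P p (zipper [::] (map (symL false) lw))) D K) (6 * size s + 5) tt
    (bank t W (stape (rev (s1 ++ s ++ c))) (zipper (nseq (size s + k) mark) [::])
      (setb P p (zipper [::] (map (symL false) (drop (size s) lw)))) D K).
Proof.
elim: s s1 lw k => [|e s IH] s1 lw k elw redc c0.
  rewrite cats0 /= drop0; move: elw; rewrite /= => elw.
  apply: exec_loop_exit; step_within 4 exec_peek; case: lw elw c0 => [|[q e] lw] /= elw c0; first by ret_within.
  case: c elw redc c0 => [_ _ c0|e' c [ee _]]; first by move: (c0 erefl) => H; discriminate H.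
  rewrite -{e'}ee => redc _.
  have -> : rev (s1 ++ e :: c) = last e c :: rev (s1 ++ belast e c).
    by rewrite lastI -cats1 catA rev_cat.
  step_within 2 exec_pop.
  rewrite (inj_eq symE_inj) (negPf redc).
  step_within 1 exec_push; ret_within.
have -> : s1 ++ (e :: s) ++ c ++ inv_word inv (e :: s) = (rcons s1 e ++ s ++ c ++ inv_word inv s) ++ [:: inv e].
  by rewrite /inv_word /= rev_cons -!cats1 -!catA.
have -> : s1 ++ (e :: s) ++ c = rcons s1 e ++ s ++ c by rewrite cat_rcons.
rewrite [size (e :: s) + k]addSnnS rev_cat; case: lw elw c0 => [|[q e'] lw] //= [-> elw] c0.
have {}c0 : c = [::] -> lw = [::] by move/c0.
apply: (@exec_le _ _ _ _ _ _ (6 + (6 * size s + 5))); last by rewrite /=; lia.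
apply: (@exec_loop_next _ _ _ _ _ _ tt tt); last exact: (IH (rcons s1 e) lw k.+1 elw redc c0).
step_within 5 exec_peek; step_within 3 exec_pop; rewrite eqxx.
by step_within 2 exec_chop; step_within 1 exec_push; ret_within.
Qed.

Definition trim (p : bool) : mach unit :=
  loop (fun _ : unit => bind (pop iM) (fun c =>
    if c is Some _ then bind (pop (iP p)) (fun _ => ret (inl tt)) else ret (inr tt))) tt.

Lemma exec_trim t W B P D K p k l : k <= size l ->
  exec (trim p) (bank t W B (zipper (nseq k mark) [::]) (setb P p (zipper l [::])) D K)
    (5 * k + 3) tt
    (bank t W B blank (setb P p (zipper (drop k l) [::])) D K).
Proof.
elim: k l => [|k IH] l lk.
  by apply: exec_loop_exit; rewrite drop0; step_within 1 exec_pop_nil; ret_within.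
case: l lk => // x l lk.
apply: (@exec_le _ _ _ _ _ _ (5 + (5 * k + 3))); last by lia.
apply: (@exec_loop_next _ _ _ _ _ _ tt tt); last exact: IH.
by step_within 3 exec_pop; step_within 1 exec_pop; ret_within.
Qed.

Definition cyc_reduce (p : bool) : mach unit :=
  bind (rewind (iP p)) (fun _ => bind (peel p) (fun _ => bind (fwd (iP p)) (fun _ =>
    bind (trim p) (fun _ => clear iB)))).

Lemma exec_cyc_reduce t W P D K p q st s c :
  rev st = s ++ c ++ inv_word inv s -> cyc_reduced c -> (c = [::] -> s = [::]) ->
  exec (cyc_reduce p) (bank t W (stape st) blank (setb P p (ltape false (labels q (rev st)))) D K)
    (30 * size st + 30) tt
    (bank t W blank blank (setb P p (ltape false (labels (slide q s) c))) D K).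
Proof.
move=> est redc c0.
have sst : size st = size s + (size c + size s).
  by rewrite -size_rev est !size_cat /inv_word size_rev size_map.
eapply exec_le; [step_with exec_rewind | ].
rewrite catrevE revK cats0.
eapply exec_bind.
  have := @exec_peel t W P D K p [::] s c (inv_word inv s) (labels q (rev st)) 0.
  rewrite /= -est revK; apply=> //; first by rewrite map_labels.
  by move=> c1; move: est; rewrite c1 c0 //= => ->.
rewrite addn0.
step_with exec_fwd.
eapply exec_bind.
  apply: exec_trim.
  by rewrite catrevE cats0 size_rev size_map size_drop size_labels size_rev; lia.
have -> : drop (size s) (catrev (map (symL false) (drop (size s) (labels q (rev st)))) [::]) =
   rev (map (symL false) (labels (slide q s) c)).
  rewrite catrevE cats0 est labels_cat drop_cat size_labels ltnn subnn drop0.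
  rewrite labels_cat map_cat rev_cat drop_cat size_rev size_map size_labels.
  by rewrite /inv_word size_rev size_map ltnn subnn drop0.
- last_with exec_clear.
- rewrite !(size_map, size_rev, size_drop, size_labels, size_cat) /=. lia.
Qed.

Definition relabel (b : bool) (x : X) : X :=
  if x is inr (inl (inr (l, _))) then symL b l else x.

(** Doubling the word makes each of its rotations a factor.  The flag of the
    second copy tells the machine that all starting points have been tried. *)
Definition double (p : bool) : mach unit :=
  bind (rewind (iP p)) (fun _ => bind (copy (iP p) (iD p) (relabel false)) (fun _ =>
  bind (rewind (iP p)) (fun _ => bind (copy (iP p) (iD p) (relabel true)) (fun _ =>
    rewind (iD p))))).

Definition dtape (x : seq (Q * E)) : tape :=
  zipper [::] (map (symL false) x ++ map (symL true) x).

Lemma exec_double t W B M P D K p x :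
  exec (double p) (bank t W B M (setb P p (ltape false x)) (setb D p blank) K)
    (20 * size x + 20) tt
    (bank t W B M (setb P p (ltape false x)) (setb D p (dtape x)) K).
Proof.
have ne : iP p != iD p by case: p.
have cat2 (y z : seq X) : catrev y z = rev y ++ z by rewrite catrevE.
have e1 (b : bool) : map (relabel b \o symL false) x = map (symL b) x by [].
have cp (b : bool) l : exec (copy (iP p) (iD p) (relabel b))
    (bank t W B M (setb P p (zipper [::] (map (symL false) x))) (setb D p (zipper l [::])) K)
    (3 * size x + 2) tt
    (bank t W B M (setb P p (ltape false x)) (setb D p (zipper (rev (map (symL b) x) ++ l) [::])) K).
  eapply exec_eq; [eapply (exec_copy _ (h := symL false) (w := x) ne); tape_rules | | done].
  - by case: (p).
  - by case: (p).
  - by rewrite ?updE !cat2 cats0 e1.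
eapply exec_le; [step_with exec_rewind | ].
rewrite cat2 revK !cats0.
eapply exec_bind; first eapply (cp false [::]).
step_with exec_rewind; rewrite cat2 revK !cats0.
eapply exec_bind; first exact: (cp true (rev (map (symL false) x))).
last_with exec_rewind; first by rewrite !cat2 !cats0 rev_cat !revK.
by rewrite !(size_cat, size_rev, size_map); lia.
Qed.

(** * Preparing one word *)

(** The stack holds the power of [rho_j w rho_j^-1], whose image under [sigma]
    is the conjugate of [sigma w] by [(sigma rho_j)^-1]. *)
Definition prep (p : bool) (j : 'I_m) : mach unit :=
  bind (push_power (iW p) iB j reps) (fun q => bind (labelling p (q ^ (twist j)^-1)%g) (fun _ =>
    bind (cyc_reduce p) (fun _ => double p))).

Definition prep_stack (j : 'I_m) (w : seq S) : seq E := (push_run j reps.+1 w (1%g, [::])).2.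
Definition prep_label (j : 'I_m) (w : seq S) : Q :=
  ((foldl (read_step j) (1, [::]) w).1 ^ (twist j)^-1)%g.
Definition prep_cost (n : nat) : nat := reps.+1 * ((4 * L + 7) * n + 5) + 2.

Lemma size_prep_stack j w : size (prep_stack j w) <= prep_cost (size w).
Proof.
apply: leq_trans (size_push_run _ _ _ _) _; rewrite /= add0n /prep_cost.
apply: leq_trans (leq_addr _ _); rewrite leq_mul2l; apply/orP; right; nia.
Qed.

Lemma exec_prep t W P D K p j w s c : W p = wtape w -> P p = blank -> D p = blank ->
  rev (prep_stack j w) = s ++ c ++ inv_word inv s -> cyc_reduced c -> (c = [::] -> s = [::]) ->
  let x := labels (slide (prep_label j w) s) c in
  exec (prep p j) (bank t W blank blank P D K) (60 * prep_cost (size w) + 60) tt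
    (bank t W blank blank (setb P p (ltape false x)) (setb D p (dtape x)) K).
Proof.
move=> eW eP eD est redc c0 x.
rewrite -{1}(setb_id eP) -{1}(setb_id eD).
eapply exec_le; [eapply exec_bind |].
- eapply (@exec_push_power _ _ _ _ _ w); tape_rules; by case: (p).
- rewrite updE.
  eapply exec_bind; first exact: exec_labelling.
  rewrite -/(prep_stack j w) -/(prep_label j w). eapply exec_bind; first exact: (exec_cyc_reduce _ _ _ _ _ _ _ est redc c0).
  exact: exec_double.
- have := size_prep_stack j w; have : size c <= size (prep_stack j w).
    by rewrite -(size_rev (prep_stack j w)) est !size_cat; lia.
  rewrite size_labels /prep_cost /prep_stack; set N := reps.+1 * _; lia.
Qed.

(** * Comparing two cyclic words *)

Definition tape_at (d : seq X) (k : nat) : tape := zipper (rev (take k d)) (drop k d).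

Lemma tape_at_size d : tape_at d (size d) = zipper (rev d) [::].
Proof. by rewrite /tape_at take_size drop_size. Qed.
Lemma tape_at0 d : tape_at d 0 = zipper [::] d.
Proof. by rewrite /tape_at take0 drop0. Qed.
Lemma tape_atS x0 d k : k < size d -> tape_at d k = zipper (rev (take k d)) (nth x0 d k :: drop k.+1 d).
Proof. by move=> lt; rewrite /tape_at (drop_nth x0). Qed.
Lemma tape_atSl x0 d k : k < size d -> tape_at d k.+1 = zipper (nth x0 d k :: rev (take k d)) (drop k.+1 d).
Proof. by move=> lt; rewrite /tape_at (take_nth x0) // rev_rcons. Qed.

Lemma exec_fetch_tape_at x0 T i d k : cur T i = tape_at d k -> k < size d ->
  exec (fetch i) T 1 (Some (nth x0 d k)) (upd T i (tape_at d k.+1)).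
Proof. by move=> e lt; rewrite (tape_atSl x0) //; apply: exec_fetch; rewrite e (tape_atS x0). Qed.
Lemma exec_fetch_end T i d : cur T i = tape_at d (size d) ->
  exec (fetch i) T 1 None (upd T i (tape_at d (size d))).
Proof. by rewrite tape_at_size; apply: exec_fetch_nil. Qed.
Lemma exec_peek_tape_at x0 T i d k : cur T i = tape_at d k -> k < size d ->
  exec (peek i) T 1 (Some (nth x0 d k)) (upd T i (tape_at d k)).
Proof. by move=> e lt; move: e; rewrite (tape_atS x0) // => e; exact: (exec_peek e). Qed.
Lemma exec_peek_end T i d : cur T i = tape_at d (size d) ->
  exec (peek i) T 1 None (upd T i (tape_at d (size d))).
Proof. by rewrite tape_at_size => e; exact: (exec_peek e). Qed.
Lemma exec_back_tape_at x0 T i d k : cur T i = tape_at d k.+1 -> k < size d ->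
  exec (back i) T 2 (Some (nth x0 d k)) (upd T i (tape_at d k)).
Proof. by move=> e lt; rewrite (tape_atS x0) //; apply: exec_back; rewrite e (tape_atSl x0). Qed.
Lemma exec_back_start T i d : cur T i = tape_at d 0 ->
  exec (back i) T 2 None (upd T i (tape_at d 0)).
Proof. by rewrite tape_at0; apply: exec_back_nil. Qed.
Lemma exec_rewind_tape_at T i d k : cur T i = tape_at d k ->
  exec (rewind i) T (3 * size d + 3) tt (upd T i (tape_at d 0)).
Proof.
move=> e; apply: (@exec_le _ _ _ _ _ _ (3 * size (rev (take k d)) + 3)).
  eapply exec_eq; [eapply exec_rewind; eassumption | | done].
  by rewrite catrevE revK cat_take_drop tape_at0.
by rewrite size_rev size_take_min; lia.
Qed.
Lemma exec_clear_tape_at T i d k : cur T i = tape_at d k ->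
  exec (clear i) T (5 * size d + 5) tt (upd T i blank).
Proof.
move=> e; eapply exec_le; first by eapply exec_clear; eassumption.
by rewrite size_rev [_ + size (take _ _)]addnC -size_cat cat_take_drop.
Qed.

Notation Y := (prod Q E).
Implicit Types (x y : seq Y).
Definition ptape x k : tape := tape_at (map (symL false) x) k.
Definition dsyms x : seq X := map (symL false) x ++ map (symL true) x.
Lemma size_dsyms x : size (dsyms x) = 2 * size x.
Proof. by rewrite size_cat !size_map; lia. Qed.
Lemma nth_dsyms (y0 : Y) x k : k < 2 * size x ->
  nth (symL false y0) (dsyms x) k = symL (size x <= k) (cyc_nth y0 x k).
Proof.
move=> lt; rewrite nth_cat size_map; case: ltnP => h.
  by rewrite (nth_map y0) // /cyc_nth modn_small.
have lt2 : k - size x < size x by lia.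
rewrite (nth_map y0) // /cyc_nth -{2}(subnK h) modnDr modn_small //.
Qed.

Definition same_length : mach bool :=
  loop (fun _ : unit => bind (fetch (iP false)) (fun a => bind (fetch (iP true)) (fun b =>
    ret (match a, b with
         | Some _, Some _ => inl tt
         | None, None => inr true
         | _, _ => inr false
         end)))) tt.

Lemma exec_same_length t W B M P D K x y k : k <= size x -> k <= size y ->
  P false = ptape x k -> P true = ptape y k ->
  exists P' k' l', [/\ exec same_length (bank t W B M P D K) (3 * (size x - k) + 3) (size x == size y)
    (bank t W B M P' D K), P' false = ptape x k' & P' true = ptape y l'].
Proof.
have [n le] := ubnP (size x - k); elim: n k P le => // n IH k P le lx ly eP0 eP1.
have [ltx|gex] := ltnP k (size x); have [lty|gey] := ltnP k (size y).
- have [] := IH k.+1 (setb (setb P false (ptape x k.+1)) true (ptape y k.+1)) _ ltx lty.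
  + lia.
  + by rewrite /setb /=.
  + by rewrite /setb /=.
  move=> P' [k' [l' [ex e0 e1]]]; exists P', k', l'; split=> //.
  apply: (@exec_le _ _ _ _ _ _ (3 + (3 * (size x - k.+1) + 3))); last by lia.
  apply: exec_loop_next ex.
  eapply (exec_seq (n' := 2)); [eapply (@exec_fetch_tape_at mark); [by tape_rules|by rewrite size_map] | rewrite ?updE /= | done].
  eapply (exec_seq (n' := 1)); [eapply (@exec_fetch_tape_at mark); [by tape_rules|by rewrite size_map] | rewrite ?updE /= | done].
  by ret_within.
- exists (setb (setb P false (ptape x k.+1)) true (ptape y k)), k.+1, k; split=> //.
  have -> : (size x == size y) = false by apply/negP; lia.
  have ey : k = size (map (symL false) y) by rewrite size_map; lia.
  apply: exec_loop_exit.
  eapply (exec_seq (n' := 2)); [eapply (@exec_fetch_tape_at mark); [by tape_rules|by rewrite size_map] | rewrite ?updE /= | lia].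
  eapply (exec_seq (n' := 1)); [eapply (@exec_fetch_end _ _ (map (symL false) y)); rewrite -ey; by tape_rules | rewrite ?updE /= | done].
  by rewrite -ey; ret_within.
- exists (setb (setb P false (ptape x k)) true (ptape y k.+1)), k, k.+1; split=> //.
  have -> : (size x == size y) = false by apply/negP; lia.
  have ex : k = size (map (symL false) x) by rewrite size_map; lia.
  apply: exec_loop_exit.
  eapply (exec_seq (n' := 2)); [eapply (@exec_fetch_end _ _ (map (symL false) x)); rewrite -ex; by tape_rules | rewrite ?updE /= | lia].
  eapply (exec_seq (n' := 1)); [eapply (@exec_fetch_tape_at mark); [by tape_rules|by rewrite size_map] | rewrite ?updE /= | done].
  by rewrite -ex; ret_within.
- exists (setb (setb P false (ptape x k)) true (ptape y k)), k, k; split=> //.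
  have -> : (size x == size y) = true by apply/eqP; lia.
  have ex : k = size (map (symL false) x) by rewrite size_map; lia.
  have ey : k = size (map (symL false) y) by rewrite size_map; lia.
  apply: exec_loop_exit.
  eapply (exec_seq (n' := 2)); [eapply (@exec_fetch_end _ _ (map (symL false) x)); rewrite -ex; by tape_rules | rewrite ?updE /= | lia].
  eapply (exec_seq (n' := 1)); [eapply (@exec_fetch_end _ _ (map (symL false) y)); rewrite -ey; by tape_rules | rewrite ?updE /= | done].
  by rewrite -ex -ey; ret_within.
Qed.

(** After a mismatch that follows [k] agreeing letters, one of the two heads has
    to go back by [k]; the head on [P false] stands at position [k] and serves
    as the counter. *)
Definition rewind_together (p : bool) : mach unit :=
  loop (fun _ : unit => bind (back (iP false)) (fun c =>
    if c is Some _ then bind (back (iD p)) (fun _ => ret (inl tt)) else ret (inr tt))) tt.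

Lemma exec_rewind_together t W B M P D K p x z k s : k <= size x -> s + k <= size z ->
  P false = ptape x k -> D p = tape_at z (s + k) ->
  exec (rewind_together p) (bank t W B M P D K) (5 * k + 3) tt
    (bank t W B M (setb P false (ptape x 0)) (setb D p (tape_at z s)) K).
Proof.
elim: k P D => [|k IH] P D lk lz eP eD.
  apply: exec_loop_exit.
  eapply (exec_seq (n' := 1)); [eapply (exec_back_start (d := map (symL false) x)); by tape_rules | rewrite ?updE /= | done].
  by rewrite addn0 in eD; rewrite (setb_id eD); ret_within.
apply: (@exec_le _ _ _ _ _ _ (5 + (5 * k + 3))); last by lia.
rewrite -(setbb P false (ptape x k)) -(setbb D p (tape_at z (s + k))).
apply: exec_loop_next; last by apply: IH; rewrite ?setbE //; lia.
eapply (exec_seq (n' := 3)); [eapply (@exec_back_tape_at mark _ _ (map (symL false) x)); [by tape_rules|by rewrite size_map] | rewrite ?updE /= | done].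
eapply (exec_seq (n' := 1)); [eapply (@exec_back_tape_at mark _ _ z (s + k)); [by rewrite ?curE eD addnS | lia] | rewrite ?updE /= | done].
by ret_within.
Qed.

Definition getL (c : cell) : option (Y * bool) :=
  if c is Some (inr (inl (inr l))) then Some l else None.

(** The next starting point in the word [p] is just after the mismatch, where
    its head already is. *)
Definition advance (p : bool) : mach (unit + bool)%type :=
  bind (rewind_together (~~ p)) (fun _ => bind (fetch (iD p)) (fun _ =>
    bind (peek (iD p)) (fun c =>
      ret (if getL c is Some (_, true) then inr false else inl tt)))).

(** The word with the larger letter at the mismatch is the one whose starting
    points are disqualified. *)
Definition compare (la lb : Y) : mach (unit + bool)%type :=
  if la == lb then
    bind (fetch (iP false)) (fun _ => bind (fetch (iD false)) (fun _ =>
      bind (fetch (iD true)) (fun _ => ret (inl tt))))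
  else advance (letter_rank la < letter_rank lb).

Definition matching_body : mach (unit + bool)%type :=
  bind (peek (iP false)) (fun c => if c is None then ret (inr true) else
    bind (peek (iD false)) (fun a => bind (peek (iD true)) (fun b =>
    match getL a, getL b with
    | Some (la, _), Some (lb, _) => compare la lb
    | _, _ => ret (inr false)
    end))).

Definition matching : mach bool := loop (fun _ : unit => matching_body) tt.

(** Invariant: all starting points before [pos p] in the word [p] are beaten by
    the other word, and the rotations at the two current starting points agree
    on [k] letters.  If [k] reaches [n] the words are rotations of each other;
    if a starting point passes [n], all rotations of that word are beaten, which
    [not_beaten] excludes for rotations of each other.  The time is paid by the
    potential in the statement: a mismatch after [k] letters gives up the
    [7 * k] gained and costs [5 * k + 9], and in return a starting point advances by [k.+1]. *)
Lemma exec_matching (y0 : Y) t W B M P D K (x : bool -> seq Y) (pos : bool -> nat) n k :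
  (forall p, size (x p) = n) -> 0 < n -> (forall p, pos p < n) -> k <= n ->
  P false = ptape (x false) k -> (forall p, D p = tape_at (dsyms (x p)) (pos p + k)) ->
  (forall p (i : nat), i < pos p -> beat y0 (x p) (x (~~ p)) i) ->
  (forall s, s < k -> cyc_nth y0 (x false) (pos false + s) = cyc_nth y0 (x true) (pos true + s)) ->
  exists P' D' k' pos' b, [/\ exec matching (bank t W B M P D K)
     (12 * (2 * n - (pos false + pos true)) + 7 * (n - k) + 5 * n + 10) b (bank t W B M P' D' K),
     P' true = P true, P' false = ptape (x false) k', (forall p, D' p = tape_at (dsyms (x p)) (pos' p)) &
     b <-> exists r, rot r (x false) = x true].
Proof.
move=> sx n0.
have [N le] := ubnP (12 * (2 * n - (pos false + pos true)) + 7 * (n - k)).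
elim: N k pos P D le => // N IH k pos P D le lpos lk eP eD hbeat heq.
have [ek|ltk] : k = n \/ k < n by lia.
  exists (setb P false (ptape (x false) k)), D, k, (fun p => pos p + k), true; split=> //.
  - apply: exec_loop_exit.
    eapply (exec_seq (n' := 1)); [eapply (exec_peek_end (d := map (symL false) (x false))) | rewrite ?updE /= | lia].
      by rewrite curE eP ek -(sx false) size_map.
    by rewrite size_map sx -ek; ret_within.
  - split=> // _; apply: (match_rot (a0 := y0) (i := pos false) (j := pos true)); rewrite ?sx //.
    by rewrite -ek.
have eDp p : pos p + k < 2 * size (x p) by rewrite sx; have := lpos p; lia.
have body n' r T' : exec (compare (cyc_nth y0 (x false) (pos false + k)) (cyc_nth y0 (x true) (pos true + k)))
   (bank t W B M P D K) n' r T' -> exec matching_body (bank t W B M P D K) (3 + n') r T'.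
  move=> h.
  eapply (exec_seq (n' := 2 + n')); [eapply (@exec_peek_tape_at (symL false y0) _ _ (map (symL false) (x false))); [by tape_rules|by rewrite size_map sx] | rewrite ?updE /= (setb_id eP) | done].
  eapply (exec_seq (n' := 1 + n')); [eapply (@exec_peek_tape_at (symL false y0)); [rewrite curE; exact: eD|by rewrite size_dsyms] | rewrite ?updE (setb_id (eD _)) | done].
  eapply (exec_seq (n' := n')); [eapply (@exec_peek_tape_at (symL false y0)); [rewrite curE; exact: eD|by rewrite size_dsyms] | rewrite ?updE (setb_id (eD _)) | done].
  by rewrite !nth_dsyms.
case: (cyc_nth y0 (x false) (pos false + k) =P cyc_nth y0 (x true) (pos true + k)) => [eq|ne].
  pose P1 := setb P false (ptape (x false) k.+1).
  pose D1 := setb (setb D false (tape_at (dsyms (x false)) (pos false + k.+1))) true (tape_at (dsyms (x true)) (pos true + k.+1)).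
  have [|||||||P' [D' [k' [pos' [b [ex eP1 eP0 eD' hb]]]]]] := IH k.+1 pos P1 D1 => //.
  - lia.
  - by case; rewrite /D1 /setb.
  - move=> s; rewrite ltnS leq_eqVlt => /orP[/eqP->|] //; exact: heq.
  exists P', D', k', pos', b; split=> //.
  apply: (@exec_le _ _ _ _ _ _ (7 + (12 * (2 * n - (pos false + pos true)) + 7 * (n - k.+1) + 5 * n + 10))); last by lia.
  apply: (@exec_loop_next _ _ _ _ _ _ tt tt) ex.
  apply: (body 4); rewrite /compare eq eqxx.
  eapply (exec_seq (n' := 3)); [eapply (@exec_fetch_tape_at (symL false y0) _ _ (map (symL false) (x false))); [by tape_rules|by rewrite size_map sx] | rewrite ?updE /= | done].
  eapply (exec_seq (n' := 2)); [eapply (@exec_fetch_tape_at (symL false y0)); [rewrite curE; exact: eD|by rewrite size_dsyms] | rewrite ?updE | done].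
  eapply (exec_seq (n' := 1)); [eapply (@exec_fetch_tape_at (symL false y0)); [rewrite ?curE /setb /=; exact: eD|by rewrite size_dsyms] | rewrite ?updE | done].
  by rewrite -!addnS; ret_within.
set la := cyc_nth _ _ _ in ne body; set lb := cyc_nth _ _ _ in ne body.
pose p := letter_rank la < letter_rank lb.
pose pos1 := fun p' => if p' == p then pos p + k.+1 else pos p'.
pose P1 := setb P false (ptape (x false) 0).
pose D1 := setb (setb D (~~ p) (tape_at (dsyms (x (~~ p))) (pos (~~ p)))) p (tape_at (dsyms (x p)) (pos p + k.+1)).
have eD1 p' : D1 p' = tape_at (dsyms (x p')) (pos1 p' + 0).
  by rewrite /D1 /pos1 /setb addn0; case: (p); case: (p').
have hbeat1 p' (i : nat) : i < pos1 p' -> beat y0 (x p') (x (~~ p')) i.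
  rewrite /pos1; case: eqP => [->|_]; last exact: hbeat.
  have [lt|ge] := ltnP i (pos p); first by move=> _; apply: hbeat.
  rewrite addnS ltnS => le1; rewrite -(subnKC ge).
  apply: (@beat_mismatch _ _ _ _ _ (pos (~~ p)) k) => //.
  + by rewrite !sx.
  + by rewrite sx.
  + by move=> s ls; case: (p) => /=; rewrite heq.
  + rewrite /p; case: (ltngtP (letter_rank la) (letter_rank lb)) => //= h.
    by case: ne; apply: letter_rank_inj.
  + lia.
have adv r : (if n <= pos1 p then inr false else inl tt) = r ->
   exec matching_body (bank t W B M P D K) (5 * k + 9) r (bank t W B M P1 D1 K).
  move=> er.
  apply: (@exec_le _ _ _ _ _ _ (3 + (5 * k + 6))); last by lia.
  apply: body; rewrite /compare (introF eqP ne) -/p.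
  eapply (exec_seq (n' := 3)); [eapply (@exec_rewind_together _ _ _ _ _ _ _ _ (x false) (dsyms (x (~~ p))) k (pos (~~ p))) => // | | lia].
  - by rewrite sx.
  - by rewrite size_dsyms ltnW.
  eapply (exec_seq (n' := 2)); [eapply (@exec_fetch_tape_at (symL false y0) _ _ (dsyms (x p)) (pos p + k)); [by rewrite ?curE /setb; case: (p) => /=; exact: eD|by rewrite size_dsyms] | rewrite ?updE -addnS | done].
  eapply (exec_seq (n' := 1)); [eapply (@exec_peek_tape_at (symL false y0) _ _ (dsyms (x p)) (pos p + k.+1)); [by tape_rules |rewrite size_dsyms] | rewrite ?updE | done].
    by have := lpos p; rewrite sx; lia.
  rewrite nth_dsyms; last by have := lpos p; rewrite sx; lia.
  rewrite /= sx -er /pos1 eqxx; case: leqP => _; by ret_within.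
have [ge|lt] := leqP n (pos1 p).
  exists P1, D1, 0, pos1, false; split=> //.
  - apply: exec_loop_exit; apply: exec_le; first by apply: adv; rewrite ge.
    have := lpos p; have := lpos (~~ p); case: (p) => /=; lia.
  - by move=> p'; rewrite eD1 addn0.
  - split=> // -[r er]; exfalso; case: (p) (hbeat1 p) ge => /= hb ge.
    + apply: (@not_beaten _ y0 (x true) (size (x false) - r)); first by rewrite sx.
      have -> : rot (size (x false) - r) (x true) = x false.
        by rewrite -er -(size_rot r) -/(rotr _ _) rotK.
      by move=> i; rewrite sx => lt; exact: (hb i (leq_trans lt ge)).
    + apply: (@not_beaten _ y0 (x false) r); first by rewrite sx.
      by rewrite er => i; rewrite sx => lt; exact: (hb i (leq_trans lt ge)).
have sumE : pos1 false + pos1 true = pos false + pos true + k.+1.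
  by rewrite /pos1; case: (p) => /=; lia.
have lq : pos1 (~~ p) < n by rewrite /pos1; case: (p) => /=; exact: lpos.
have sum2 : pos1 false + pos1 true <= 2 * n.
  by move: lt lq; case: (p) => /= lt lq; clear -lt lq; lia.
have [|||||||P' [D' [k' [pos' [b [ex eP1 eP0 eD' hb]]]]]] := IH 0 pos1 P1 D1 => //.
- lia.
- by move: lt lq; case: (p) => /= lt lq [].
exists P', D', k', pos', b; split=> //.
apply: (@exec_le _ _ _ _ _ _ (5 * k + 9 + (12 * (2 * n - (pos1 false + pos1 true)) + 7 * (n - 0) + 5 * n + 10))).
  by apply: exec_loop_next ex; apply: adv; rewrite leqNgt lt.
lia.
Qed.

(** The second result tells whether the first word is empty, which means that
    the element has finite order. *)
Definition cyc_eq : mach (bool * bool)%type :=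
  bind (rewind (iP false)) (fun _ => bind (rewind (iP true)) (fun _ =>
    bind same_length (fun b => bind (rewind (iP false)) (fun _ => bind (peek (iP false)) (fun c =>
    if c is None then ret (b, true)
    else if b then bind matching (fun b' => ret (b', false)) else ret (false, false)))))).

Lemma exec_cyc_eq t W B M P D K (x : bool -> seq Y) :
  (forall p, P p = ltape false (x p)) -> (forall p, D p = dtape (x p)) ->
  exists P' D' k l b, [/\ exec cyc_eq (bank t W B M P D K)
     (60 * (size (x false) + size (x true)) + 60) (b, nilp (x false)) (bank t W B M P' D' K),
     (forall p, P' p = ptape (x p) (k p)), (forall p, D' p = tape_at (dsyms (x p)) (l p)) &
     b <-> exists r, rot r (x false) = x true].
Proof.
move=> eP eD.
have eP' p : P p = ptape (x p) (size (x p)).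
  by rewrite eP /ltape /ptape -[in tape_at _ _](size_map (symL false)) tape_at_size.
have eD' p : D p = tape_at (dsyms (x p)) 0 by rewrite eD tape_at0.
pose P1 := setb (setb P false (ptape (x false) 0)) true (ptape (x true) 0).
have [P2 [k [l [ex2 e0 e1]]]] := @exec_same_length t W B M P1 D K (x false) (x true) 0 isT isT erefl erefl.
pose P3 := setb P2 false (ptape (x false) 0).
have szP p : size (map (symL false) (x p)) = size (x p) by rewrite size_map.
have start n' o T' : exec (bind (peek (iP false)) (fun c =>
    if c is None then ret (size (x false) == size (x true), true)
    else if size (x false) == size (x true) then bind matching (fun b' => ret (b', false)) else ret (false, false)))
   (bank t W B M P3 D K) n' o T' ->
   exec cyc_eq (bank t W B M P D K) (30 * (size (x false) + size (x true)) + 30 + n') o T'.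
  move=> h; eapply exec_le; [eapply exec_bind; [eapply exec_rewind_tape_at; rewrite curE; exact: eP' | rewrite ?updE] |].
  - eapply exec_bind; [eapply (exec_rewind_tape_at (d := map (symL false) (x true)) (k := size (x true))); by rewrite curE /setb /= eP' | rewrite ?updE].
    eapply exec_bind; [exact: ex2 |].
    eapply exec_bind; [eapply exec_rewind_tape_at; rewrite curE; exact: e0 | rewrite ?updE]; exact: h.
  - rewrite !szP; lia.
have eP3 p : P3 p = ptape (x p) (if p then l else 0) by case: p.
have [xn|xn] := posnP (size (x false)).
  exists P3, D, (fun p => if p then l else 0), (fun=> 0), (size (x false) == size (x true)); split=> //.
  - have -> : nilp (x false) = true by rewrite /nilp xn.
    apply: (@exec_le _ _ _ _ _ _ (30 * (size (x false) + size (x true)) + 30 + 2)); last by lia.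
    apply: start.
    eapply (exec_seq (n' := 1)); [eapply (exec_peek_end (d := map (symL false) (x false))) | rewrite ?updE /= | lia].
      by rewrite curE eP3 szP xn.
    by rewrite szP xn; ret_within.
  - split=> [/eqP e|[r <-]]; last by rewrite size_rot.
    by exists 0; rewrite rot0 (size0nil xn) (size0nil (etrans (esym e) xn)).
have pk n' o T' : exec (if size (x false) == size (x true) then bind matching (fun b' => ret (b', false)) else ret (false, false))
    (bank t W B M P3 D K) n' o T' ->
   exec cyc_eq (bank t W B M P D K) (30 * (size (x false) + size (x true)) + 30 + n'.+1) o T'.
  move=> h; apply: start.
  eapply (exec_seq (n' := n')); [eapply (@exec_peek_tape_at mark _ _ (map (symL false) (x false))); [rewrite curE; exact: eP3|by rewrite szP] | rewrite ?updE /= | lia].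
  exact: h.
have [y0 _] : exists y0 : Y, True by case: (x false) xn => // a0; exists a0.
have -> : nilp (x false) = false by apply/negP; rewrite /nilp; lia.
have [es|ns] := eqVneq (size (x false)) (size (x true)).
  have [||||||||P' [D' [k' [pos' [b [ex f1 f0 fD hb]]]]]] :=
    @exec_matching y0 t W B M P3 D K x (fun=> 0) (size (x false)) 0 => //.
    by case.
  exists P', D', (fun p => if p then l else k'), pos', b; split=> //; last by case=> //; rewrite f1 eP3.
  eapply exec_le; first apply: pk.
  - rewrite es eqxx; eapply exec_bind; [exact: ex | by apply: exec_ret].
  - lia.
exists P3, D, (fun p => if p then l else 0), (fun=> 0), false; split=> //.
- eapply exec_le; first apply: pk.
  + by rewrite (negPf ns); apply: exec_ret.
  + lia.
- by split=> // -[r er]; move: ns; rewrite -er size_rot eqxx.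
Qed.

Definition wipe : mach unit :=
  bind (clear (iP false)) (fun _ => bind (clear (iP true)) (fun _ =>
    bind (clear (iD false)) (fun _ => clear (iD true)))).

Lemma exec_wipe t W B M P D K (x : bool -> seq Y) (k l : bool -> nat) :
  (forall p, P p = ptape (x p) (k p)) -> (forall p, D p = tape_at (dsyms (x p)) (l p)) ->
  exec wipe (bank t W B M P D K) (15 * (size (x false) + size (x true)) + 20) tt
    (bank t W B M (fun=> blank) (fun=> blank) K).
Proof.
move=> eP eD.
eapply exec_le; [eapply exec_bind; [eapply exec_clear_tape_at; rewrite curE; exact: eP | rewrite ?updE] |].
- eapply exec_bind; [eapply (exec_clear_tape_at (d := map (symL false) (x true)) (k := k true)); by rewrite curE /setb /= eP | rewrite ?updE].
  eapply exec_bind; [eapply exec_clear_tape_at; rewrite curE; exact: eD | rewrite ?updE].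
  last_with exec_clear_tape_at; first by rewrite /setb /=; exact: eD.
- rewrite !size_dsyms !size_map; lia.
Qed.

Definition try_rep (j : 'I_m) : mach (bool * bool)%type :=
  bind (prep false i0) (fun _ => bind (prep true j) (fun _ =>
    bind cyc_eq (fun r => bind wipe (fun _ => ret r)))).

Definition input_words (u v : seq S) : bool -> tape := fun p => wtape (if p then v else u).

Lemma exec_try_rep t K j u v s c s' c' :
  rev (prep_stack i0 u) = s ++ c ++ inv_word inv s -> cyc_reduced c -> (c = [::] -> s = [::]) ->
  rev (prep_stack j v) = s' ++ c' ++ inv_word inv s' -> cyc_reduced c' -> (c' = [::] -> s' = [::]) ->
  exists b, exec (try_rep j) (bank t (input_words u v) blank blank (fun=> blank) (fun=> blank) K)
     (150 * (prep_cost (size u) + prep_cost (size v)) + 250) (b, nilp c)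
     (bank t (input_words u v) blank blank (fun=> blank) (fun=> blank) K) /\
   (b <-> exists r, rot r (labels (slide (prep_label i0 u) s) c) =
                     labels (slide (prep_label j v) s') c').
Proof.
move=> est redc c0 est' redc' c0'.
pose x p := if p then labels (slide (prep_label j v) s') c' else labels (slide (prep_label i0 u) s) c.
pose P p := ltape false (x p); pose D p := dtape (x p).
have [P' [D' [k [l [b [ex eP eD hb]]]]]] :=
  @exec_cyc_eq t (input_words u v) blank blank P D K x (fun=> erefl) (fun=> erefl).
exists b; split; last exact: hb.
have nx : nilp (x false) = nilp c by rewrite /nilp size_labels.
have sx : size (x false) <= prep_cost (size u).
  apply: leq_trans (size_prep_stack i0 u); rewrite size_labels.
  by rewrite -(size_rev (prep_stack _ _)) est !size_cat; lia.
have sy : size (x true) <= prep_cost (size v).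
  apply: leq_trans (size_prep_stack j v); rewrite size_labels.
  by rewrite -(size_rev (prep_stack _ _)) est' !size_cat; lia.
have e1 := @exec_prep t (input_words u v) (fun=> blank) (fun=> blank) K false i0 u s c erefl erefl erefl est redc c0.
have e2 := @exec_prep t (input_words u v) (setb (fun=> blank) false (P false)) (setb (fun=> blank) false (D false)) K true j v s' c' erefl erefl erefl est' redc' c0'.
have e12 (P0 : bool -> tape) : setb (setb (fun=> blank) false (P0 false)) true (P0 true) = P0.
  by apply/funext => -[].
eapply exec_le; [eapply exec_bind; [exact: e1 |] |].
- eapply exec_bind; [exact: e2 |].
  rewrite -/(x true) -/(P true) -/(D true) !e12.
  eapply exec_bind; [exact: ex |].
  eapply exec_bind; [exact: exec_wipe eP eD |].
  by rewrite nx; apply: exec_ret.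
- lia.
Qed.

(** * Short conjugates of torsion elements *)

(** The cells [0 .. C] of the counter tape contain their own numbers and the
    cells further right are blank.  The position of the head is the value of the
    counter, unbounded, and one reading decides whether it is at most [C]. *)
Definition counter_cell (d : nat) : cell := omap symD (insub d).
Definition counter (n : nat) : tape :=
  (fun k => if k < n then counter_cell (n - k.+1) else None, fun k => counter_cell (n + k)).

Lemma counter0 : counter 0 = zipper [::] (map symD (enum 'I_C.+1)).
Proof.
congr pair; apply/funext => k; first by rewrite onth0n.
rewrite add0n onthE /counter_cell; case: insubP => [d _ <-|]; last first.
  by rewrite -leqNgt => ge; rewrite nth_default // 2!size_map -cardE card_ord.
rewrite -map_comp (nth_map d) -?cardE ?card_ord //=; congr (Some (symD _)).
by apply: val_inj; rewrite /= nth_enum_ord.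
Qed.

Lemma head_counter n : head_read (counter n) = counter_cell n.
Proof. by rewrite /head_read /= addn0. Qed.

Lemma exec_peek_any T i : i < size T -> exec (peek i) T 1 (head_read (cur T i)) T.
Proof.
move=> lt; have stay (u : tape) : head_move Stay (head_write (head_read u) u) = u.
  by case: u => l r; rewrite /head_move /head_write /head_read /= scons_stail.
have := @exec_op A auxT 10 cell i (fun c => (c, (c, Stay))) T.
by rewrite /tape_act; cbn [fst snd]; rewrite -/(cur T i) stay -/(upd _ _ _) upd_id.
Qed.

Definition counter_up (p : bool) : mach unit := op (iK p) (fun c => (tt, (c, MoveRight))).
Definition counter_down (p : bool) : mach unit := mleft (iK p).

Lemma exec_counter_up t W B M P D K p n : K p = counter n ->
  exec (counter_up p) (bank t W B M P D K) 1 tt (bank t W B M P D (setb K p (counter n.+1))).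
Proof.
move=> e; have := @exec_op A auxT 10 unit (iK p) (fun c => (tt, (c, MoveRight))) (bank t W B M P D K).
rewrite /tape_act -/(cur _ _) -/(upd _ _ _) /= curE updE e.
have -> // : head_move MoveRight (head_write (head_read (counter n)) (counter n)) = counter n.+1.
rewrite /head_move /head_write /head_read /= stail_scons addn0; congr pair; apply/funext => -[|k] //=.
- by rewrite subn1.
- by rewrite /stail addn1 addSn addn0.
- by rewrite /stail addnS addSn.
Qed.

Lemma exec_counter_down t W B M P D K p n : K p = counter n.+1 ->
  exec (counter_down p) (bank t W B M P D K) 1 tt (bank t W B M P D (setb K p (counter n))).
Proof.
move=> e; have := @exec_mleft A auxT 10 (bank t W B M P D K) (iK p).
rewrite curE updE e.
have -> // : (stail (counter n.+1).1, scons ((counter n.+1).1 0) (counter n.+1).2) = counter n.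
congr pair; apply/funext => k; rewrite /stail /=.
by case: k => [|k] /=; rewrite ?addn0 ?subn1 // addSn addnS.
Qed.

Definition push_count (p : bool) (e : E) : mach unit :=
  bind (pop (iD p)) (fun c =>
    if c is Some y then
      if y == symE (inv e) then counter_down p
      else bind (push (iD p) y) (fun _ => bind (push (iD p) (symE e)) (fun _ => counter_up p))
    else bind (push (iD p) (symE e)) (fun _ => counter_up p)).

Lemma exec_push_count t W B M P D K p st e n b : size st = n.+1 + b ->
  D p = stape st -> K p = counter n.+1 ->
  exec (push_count p e) (bank t W B M P D K) 5 tt
    (bank t W B M P (setb D p (stape (pushr inv st e)))
       (setb K p (counter (size (pushr inv st e) - b)))).
Proof.
case: st => [|y st] //= es eD eK.
step_within 3 exec_pop.
rewrite (inj_eq symE_inj); case: eqP => _.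
  apply: (@exec_le _ _ _ _ _ _ 1) => //; have -> : size st - b = n by lia.
  exact: exec_counter_down.
step_within 2 exec_push; step_within 1 exec_push.
by have -> : (size (e :: y :: st)) - b = n.+2 by [rewrite /=; lia]; apply: exec_counter_up.
Qed.

Fixpoint pushes_count (p : bool) (ws : seq E) : mach unit :=
  if ws is e :: ws' then bind (push_count p e) (fun _ => pushes_count p ws') else ret tt.

Lemma exec_pushes_count t W B M P D K p st ws n b : size st = n + b -> size ws <= n ->
  D p = stape st -> K p = counter n ->
  exec (pushes_count p ws) (bank t W B M P D K) (5 * size ws + 1) tt
    (bank t W B M P (setb D p (stape (foldl (pushr inv) st ws)))
       (setb K p (counter (size (foldl (pushr inv) st ws) - b)))).
Proof.
elim: ws st n D K => [|e ws IH] st n D K es /= le eD eK.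
  have -> : size st - b = n by lia.
  by rewrite !setb_id //; apply: exec_ret.
case: n es le eK => // n es le eK.
apply: exec_seq; first exact: exec_push_count es eD eK.
- rewrite -(setbb D p (stape (pushr inv st e)) (stape (foldl _ _ _))).
  rewrite -(setbb K p (counter (size (pushr inv st e) - b)) (counter (size (foldl _ _ _) - b))).
  have sz : n + b <= size (pushr inv st e).
    by case: (st) es => //= y st' [<-]; case: ifP => _ //=; lia.
  apply: (IH _ (size (pushr inv st e) - b)); rewrite ?setbE //; lia.
- lia.
Qed.

Definition getE (c : cell) : option E := if c is Some (inr (inl (inl e))) then Some e else None.

(** The state [i] and the stack [w] stand for the word [w] times [rho i].  When
    [j] letters of [h] have been read, the counter shows [size w - j]: this is
    the length of what remains of [w] after division by the prefix of [h] of
    length [j], provided that [w] starts with it. *)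
Definition shorten (p : bool) (i : 'I_m) : mach ('I_C.+1 * 'I_m)%type :=
  loop (fun i : 'I_m => bind (peek (iK p)) (fun c =>
    if c is Some (inr (inr (Some d))) then ret (inr (d, i)) else
    bind (fetch (iP p)) (fun a =>
      if getE a is Some e then
        bind (pushes_count p (tabE i e)) (fun _ => bind (counter_down p) (fun _ => ret (inl (sigmaE e i))))
      else ret (inr (ord0, i))))) i.

Definition orbit_step (d : 'I_m * seq E) (e : E) : 'I_m * seq E :=
  (sigmaE e d.1, foldl (pushr inv) d.2 (tabE d.1 e)).

Lemma size_pushrs_ge st ws : size st <= size (foldl (pushr inv) st ws) + size ws.
Proof.
elim: ws st => [|e ws IH] st /=; first by lia.
have := IH (pushr inv st e); have : size st <= (size (pushr inv st e)).+1.
  by case: st => //= y st; case: ifP => _ /=; lia.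
lia.
Qed.

Lemma exec_shorten t W B M P D K p h l (i1 : 'I_m) st (j j0 : nat) :
  let run (k : nat) := foldl orbit_step (i1, st) (take k h) in
  j0 <= size h -> size (run j0).2 <= j + j0 + C ->
  (forall k, k < j0 -> j + k + C < size (run k).2) ->
  P p = zipper l (map symE h) -> D p = stape st -> K p = counter (size st - j) ->
  exists a, exec (shorten p i1) (bank t W B M P D K) ((5 * L + 5) * j0 + 2)
    (inord (size (run j0).2 - (j + j0)), (run j0).1)
    (bank t W B M (setb P p a) (setb D p (stape (run j0).2))
       (setb K p (counter (size (run j0).2 - (j + j0))))).
Proof.
elim: j0 j i1 st h l P D K => [|j0 IH] j i1 st h l P D K run lh le hrun eP eD eK.
  exists (P p); rewrite /run take0 /= addn0 !setb_id //.
  rewrite /run take0 /= addn0 in le.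
  apply: exec_loop_exit.
  apply: (exec_seq (n' := 1)); first by apply: exec_peek_any; case: (p).
  - rewrite curE eK head_counter /counter_cell insubT; first by lia.
    move=> lt /=; have <- : Sub (size st - j) lt = inord (size st - j) :> 'I_C.+1.
      by apply: val_inj; rewrite /= inordK.
    by apply: exec_ret.
  - by rewrite muln0.
case: h lh @run le hrun eP => // e h lh run le hrun eP.
have big : j + C < size st by have := hrun 0 isT; rewrite addn0.
set ws := tabE i1 e; set st1 := foldl (pushr inv) st ws.
have lws : size ws <= L by exact: tabEL.
have ge1 := size_pushrs_ge st ws; rewrite -/st1 in ge1.
pose P1 := setb P p (zipper (symE e :: l) (map symE h)).
pose D1 := setb D p (stape st1).
pose K1 := setb K p (counter (size st1 - j.+1)).
have [||||||a ex] := IH j.+1 (sigmaE e i1) st1 h (symE e :: l) P1 D1 K1.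
- by [].
- by move: le; rewrite /run /= /orbit_step /= -/ws -/st1; lia.
- by move=> k lk; have := hrun k.+1 lk; rewrite /run /= /orbit_step /= -/ws -/st1; lia.
- by rewrite /P1 setbE.
- by rewrite /D1 setbE.
- by rewrite /K1 setbE.
exists a; rewrite /run -(setbb P p (zipper (symE e :: l) (map symE h))) -(setbb D p (stape st1)).
rewrite -(setbb K p (counter (size st1 - j.+1))) -/P1 -/D1 -/K1 (_ : j + j0.+1 = j.+1 + j0); last by lia.
apply: (@exec_le _ _ _ _ _ _ ((5 * L + 5) + ((5 * L + 5) * j0 + 2))); last by rewrite mulnS; lia.
eapply (@exec_loop_next _ _ _ _ _ _ i1 (sigmaE e i1)); last exact: ex.
apply: (exec_seq (n' := 5 * L + 4)); [by apply: exec_peek_any; case: (p) | | lia].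
rewrite curE eK head_counter /counter_cell insubF /=; last by lia.
step_within (5 * L + 3) exec_fetch.
apply: (exec_seq (n := 5 * L + 1) (n' := 2)); [ | | lia].
- apply: (@exec_le _ _ _ _ _ _ (5 * size ws + 1)); last by lia.
  apply: (exec_pushes_count _ _ _ _ _ _ (n := size st - j) (b := j)) eD eK; rewrite -/ws; clear -big lws LC; lia.
- rewrite -/ws -/st1; have -> : size st1 - j = (size st1 - j.+1).+1 by lia.
  eapply (exec_seq (n' := 1)); [eapply exec_counter_down; by rewrite setbE | rewrite ?updE ?setbb | done].
  by apply: exec_ret.
Qed.

(** The top [d] letters of the stack are what follows the common prefix; they
    form a word of bounded length and fit into the returned value. *)
Fixpoint readoff (p : bool) (d : nat) : mach {bseq C of E} :=
  if d is d'.+1 then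
    bind (pop (iD p)) (fun c => bind (readoff p d') (fun r : {bseq C of E} =>
      ret (if getE c is Some e then insub_bseq C (rcons r e) else r)))
  else ret (insub_bseq C [::]).

Lemma exec_readoff t W B M P D K p st d : d <= size st -> d <= C -> D p = stape st ->
  exec (readoff p d) (bank t W B M P D K) (3 * d + 1) (insub_bseq C (rev (take d st)))
    (bank t W B M P (setb D p (stape (drop d st))) K).
Proof.
elim: d st D => [|d IH] st D last_with lC eD.
  by rewrite take0 drop0 setb_id //; apply: exec_ret.
case: st last_with eD => // y st last_with eD.
eapply (exec_seq (n' := 3 * d + 2)); [eapply exec_pop; rewrite curE; exact: eD | rewrite updE | lia].
apply: (exec_seq (n := 3 * d + 1) (n' := 1)); [ | | lia].
- by apply: (IH st); rewrite ?setbE //; apply: ltnW.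
- rewrite setbb; have -> : insub_bseq C (rev (y :: take d st)) = insub_bseq C (rcons (insub_bseq C (rev (take d st))) y).
    by rewrite rev_cons /insub_bseq !insubdK // -topredE /= size_rev size_take_min; lia.
  by apply: exec_ret.
Qed.

Definition pushall i (ds : seq 'I_C.+1) : mach unit :=
  foldr (fun d k => bind (push i (symD d)) (fun _ => k)) (ret tt) ds.

Lemma exec_pushall t W B M P D K p ds l : K p = zipper l [::] ->
  exec (pushall (iK p) ds) (bank t W B M P D K) (size ds + 1) tt
    (bank t W B M P D (setb K p (zipper (catrev (map symD ds) l) [::]))).
Proof.
elim: ds l K => [|d ds IH] l K eK /=; first by rewrite setb_id //; apply: exec_ret.
step_within (size ds + 1) exec_push.
rewrite -(setbb K p (zipper (symD d :: l) [::]) (zipper (catrev _ _) _)).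
by apply: IH; rewrite setbE.
Qed.

(** The reduced word is both the word to be read and the initial stack. *)
Definition copy_count (p : bool) : mach unit :=
  scan (iD p) (fun _ (a : X) => bind (push (iP p) a) (fun _ => counter_up p)) tt.

Lemma exec_copy_count t W B M P D K p w : D p = zipper [::] (map symE w) ->
  P p = blank -> K p = counter 0 ->
  exec (copy_count p) (bank t W B M P D K) (4 * size w + 2) tt
    (bank t W B M (setb P p (zipper (rev (map symE w)) [::])) (setb D p (stape (rev w)))
       (setb K p (counter (size w)))).
Proof.
move=> eD eP eK.
pose mk (d : nat * seq E) u := bank t W B M (setb P p (stape d.2)) (setb D p u) (setb K p (counter d.1)).
pose step (d : nat * seq E) e := (d.1.+1, e :: d.2).
have fE d : foldl step d w = (d.1 + size w, catrev w d.2).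
  by elim: w d {eD} => [|e w IH] [n s] /=; rewrite ?addn0 // IH /= addSnnS.
have e0 : bank t W B M P D K = mk (0, [::]) (zipper [::] (map symE w)).
  by rewrite /mk !setb_id.
have -> : bank t W B M (setb P p (zipper (rev (map symE w)) [::])) (setb D p (stape (rev w)))
       (setb K p (counter (size w))) =
   mk (foldl step (0, [::]) w) (zipper (catrev (map symE w) [::]) [::]).
  by rewrite fE /mk /= !catrevE !cats0 /stape map_rev.
rewrite e0.
apply: (@exec_scan _ _ _ unit (iD p) _ E (nat * seq E) symE (fun=> tt) mk step 2) => //.
- by move=> d u; rewrite /mk !curE.
- by move=> d u u'; rewrite /mk !updE.
- move=> [n s] e u.
  step_within 1 exec_push.
  rewrite /mk /= -(setbb K p (counter n) (counter n.+1)).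
  by apply: exec_counter_up; rewrite setbE.
Qed.

Definition short_conj (p : bool) : mach ({bseq C of E} * 'I_m)%type :=
  bind (reread (iW p) (iD p) i0 1%g) (fun q =>
  bind (pushall (iK p) (enum 'I_C.+1)) (fun _ => bind (rewind (iK p)) (fun _ =>
  bind (rewind (iD p)) (fun _ => bind (copy_count p) (fun _ => bind (rewind (iP p)) (fun _ =>
  bind (shorten p (q i0)) (fun d : 'I_C.+1 * 'I_m =>
  bind (readoff p d.1) (fun r => ret (r, d.2))))))))).

Lemma exec_short_conj t W B M P D K p w (j0 : nat) :
  let d0 := foldl (read_step i0) (1%g, [::]) w in
  let run (k : nat) := foldl orbit_step (d0.1 i0, d0.2) (take k (rev d0.2)) in
  j0 <= size d0.2 -> j0 <= size (run j0).2 -> size (run j0).2 <= j0 + C ->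
  (forall k, k < j0 -> k + C < size (run k).2) ->
  W p = wtape w -> P p = blank -> D p = blank -> K p = blank ->
  exists a b c, exec (short_conj p) (bank t W B M P D K)
    (((4 * L + 7) * size w + 5) + (5 * L + 20) * size d0.2 + 20 * C + 40)
    (insub_bseq C (rev (take (size (run j0).2 - j0) (run j0).2)), (run j0).1)
    (bank t W B M (setb P p a) (setb D p b) (setb K p c)).
Proof.
move=> d0 run lj ge le hrun eW eP eD eK.
have := @exec_shorten t W B M (setb P p (zipper [::] (map symE (rev d0.2)))) (setb D p (stape d0.2))
  (setb K p (counter (size d0.2))) p (rev d0.2) [::] (d0.1 i0) d0.2 0 j0.
rewrite size_rev !setbE subn0 -/run add0n => /(_ lj le hrun erefl erefl erefl) [a].
rewrite !setbb => exs.
exists a, (stape (drop (size (run j0).2 - j0) (run j0).2)), (counter (size (run j0).2 - j0)).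
eapply exec_le; [eapply exec_bind; [apply: (@exec_reread _ _ _ _ _ w [::]) |] |].
- by case: (p).
- by case: (p).
- by case: (p).
- by rewrite curE.
- by rewrite curE.
- rewrite -/d0 ?updE.
  eapply exec_bind; [exact: (@exec_pushall _ _ _ _ _ _ _ _ (enum 'I_C.+1) [::]) |].
  step_with exec_rewind.
  rewrite !catrevE !cats0 revK -counter0.
  step_with exec_rewind; rewrite catrevE cats0 -map_rev.
  eapply exec_bind; [apply: (@exec_copy_count _ _ _ _ _ _ _ _ (rev d0.2)); rewrite ?setbE // |].
  rewrite ?setbb revK size_rev.
  step_with exec_rewind; rewrite catrevE cats0 revK.
  eapply exec_bind; [exact: exs |].
  rewrite /fst inordK; last by rewrite ltnS; lia.
  eapply exec_bind; [apply: (@exec_readoff _ _ _ _ _ _ _ _ (run j0).2); rewrite ?setbE //; lia |].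
  by rewrite setbb; apply: exec_ret.
- have sE : size (enum 'I_C.+1) = C.+1 by rewrite -cardE card_ord.
  have lm : (5 * L + 5) * j0 <= (5 * L + 5) * size d0.2 by rewrite leq_mul2l lj orbT.
  rewrite !(size_rev, catrevE, cats0) (size_map symD) (size_map symE) sE !(size_rev, size_map).
  have -> : (5 * L + 20) * size d0.2 = (5 * L + 5) * size d0.2 + 15 * size d0.2 by rewrite -mulnDl -addnA.
  move: ((5 * L + 5) * _) ((5 * L + 5) * _) ((4 * L + 7) * _) lm => X1 X2 X3 lm.
  rewrite -/d0; set z := size d0.2; lia.
Qed.

(** * The whole program *)

Definition split_from (z : bool) : mach unit :=
  loop (fun z : bool => bind (fetch iI) (fun c =>
    if c is Some (inl a) then
      if a is Some s then bind (push (iW z) (symS s)) (fun _ => ret (inl z)) else ret (inl true)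
    else ret (inr tt))) z.
Definition split_input := split_from false.

Lemma exec_split_from z (w : seq S) l r W B M P D K n o T' w0 : W z = wtape w0 ->
  exec (split_from z) (bank (zipper (catrev (map symS w) l) r) (setb W z (wtape (w0 ++ w))) B M P D K) n o T' ->
  exec (split_from z) (bank (zipper l (map symS w ++ r)) W B M P D K) (3 * size w + n) o T'.
Proof.
elim: w l W w0 => [|s w IH] l W w0 eW h.
  by move: h; rewrite muln0 cats0 setb_id.
rewrite (_ : 3 * size (s :: w) + n = 3 + (3 * size w + n)); last by rewrite /=; lia.
eapply exec_loop_next; last first.
- apply: (IH (symS s :: l) (setb W z (wtape (rcons w0 s))) (rcons w0 s)); first by rewrite setbE.
  by rewrite setbb cat_rcons.
- step_within 2 exec_fetch; step_within 1 exec_push.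
  by rewrite /wtape map_rcons rev_rcons; apply: exec_ret.
Qed.

Lemma exec_split_input u v B M P D K :
  exists t, exec split_input
    (bank (zipper [::] (map inl (encode_pair (u, v)))) (fun=> blank) B M P D K)
    (3 * (size u + size v) + 5) tt (bank t (input_words u v) B M P D K).
Proof.
have ee : map inl (encode_pair (u, v)) = map symS u ++ (inl None : X) :: (map symS v ++ [::]).
  by rewrite cats0 /encode_pair map_cat /= -!map_comp.
have eW : setb (setb (fun=> blank) false (wtape u)) true (wtape v) = input_words u v.
  by apply/funext => -[].
eexists; rewrite ee (_ : 3 * (size u + size v) + 5 = 3 * size u + (2 + (3 * size v + 3))); last by lia.
apply: (@exec_split_from _ _ _ _ _ _ _ _ _ _ _ _ _ [::]) => //.
eapply exec_loop_next; first by step_within 1 exec_fetch; ret_within.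
apply: (@exec_split_from _ _ _ _ _ _ _ _ _ _ _ _ _ [::]) => //.
apply: exec_loop_exit; step_within 2 exec_fetch_nil.
by rewrite eW; apply: (@exec_le _ _ _ _ _ _ 1) => //; apply: exec_ret.
Qed.

Definition try_all (js : seq 'I_m) : mach (bool * bool)%type :=
  foldr (fun j k => bind (try_rep j) (fun r : bool * bool => if r.1 then ret r else k))
    (ret (false, false)) js.

Variable verdict : {bseq C of E} * 'I_m -> {bseq C of E} * 'I_m -> bool.

(** If the comparison succeeds with an empty cyclic word, then both elements
    have finite order, the labels carry no information, and the decision is left
    to the short conjugates. *)
Definition conj_program : mach bool :=
  bind split_input (fun _ => bind (try_all (enum 'I_m)) (fun r : bool * bool =>
    if r.1 && r.2 then
      bind (short_conj false) (fun cu => bind (short_conj true) (fun cv => ret (verdict cu cv)))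
    else ret r.1)).

Section Correctness.
Variables (u v : seq S) (s c : seq E) (s' c' : 'I_m -> seq E).
Hypotheses (est : rev (prep_stack i0 u) = s ++ c ++ inv_word inv s)
  (redc : cyc_reduced c) (c0 : c = [::] -> s = [::]).
Hypotheses (est' : forall j, rev (prep_stack j v) = s' j ++ c' j ++ inv_word inv (s' j))
  (redc' : forall j, cyc_reduced (c' j)) (c0' : forall j, c' j = [::] -> s' j = [::]).

Definition rot_at (j : 'I_m) : Prop := exists r,
  rot r (labels (slide (prep_label i0 u) s) c) = labels (slide (prep_label j v) (s' j)) (c' j).

Definition try_cost := 150 * (prep_cost (size u) + prep_cost (size v)) + 250.

Lemma exec_try_all t K js : exists b, exec (try_all js)
     (bank t (input_words u v) blank blank (fun=> blank) (fun=> blank) K)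
     ((try_cost + 1) * size js + 1) (b, b && nilp c)
     (bank t (input_words u v) blank blank (fun=> blank) (fun=> blank) K) /\
   (b <-> exists2 j, j \in js & rot_at j).
Proof.
elim: js => [|j js [b [ex hb]]].
  by exists false; split; [rewrite muln0; apply: exec_ret | split=> // -[]].
have [b1 [ex1 hb1]] := exec_try_rep t K est redc c0 (est' j) (redc' j) (@c0' j).
exists (b1 || b); split.
  case: b1 ex1 {hb1} => ex1.
  - by apply: (exec_seq (n' := 1) ex1); [apply: exec_ret | rewrite -/try_cost /= mulnS; move: try_cost (_ * size js) => X1 X2; lia].
  - by apply: (exec_seq ex1); [exact: ex | rewrite -/try_cost /= mulnS; move: try_cost (_ * size js) => X1 X2; lia].
split=> [/orP[/hb1 h|/hb[j' jj h]]|[j']].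
- by exists j; rewrite ?mem_head.
- by exists j'; rewrite // inE jj orbT.
- rewrite inE => /orP[/eqP->|jj] h; apply/orP; first by left; apply/hb1.
  by right; apply/hb; exists j'.
Qed.

Definition tors_cost (n : nat) := (4 * L + 7) * n + 5 + (5 * L + 20) * (L * n) + 20 * C + 40.
Definition total_cost := 3 * (size u + size v) + 5 +
  ((try_cost + 1) * size (enum 'I_m) + 1 + (tors_cost (size u) + (tors_cost (size v) + 1))).

Definition all_blank : bool -> tape := fun=> blank.
Local Notation start := (bank (zipper [::] (map inl (encode_pair (u, v)))) all_blank
  blank blank all_blank all_blank all_blank).

Lemma exec_conj_program_fast (b : bool) : (b <-> exists j, rot_at j) -> ~~ (b && nilp c) ->
  exists T', exec conj_program start total_cost b T'.
Proof.
move=> hb nb; have [t ex1] := exec_split_input u v blank blank all_blank all_blank all_blank.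
have [b' [ex2 hb']] := exec_try_all t all_blank (enum 'I_m).
have eb : b' = b.
  apply/idP/idP => [/hb'[j _ h]|/hb[j h]]; first by apply/hb; exists j.
  by apply/hb'; exists j; rewrite ?mem_enum.
rewrite {}eb in ex2; eexists.
apply: (exec_seq ex1); first apply: (exec_bind ex2).
  rewrite /fst /snd andbA andbb (negPf nb); exact: exec_ret.
rewrite /total_cost; move: ((try_cost + 1) * _) (tors_cost (size u)) (tors_cost (size v)) => X1 X2 X3; lia.
Qed.

Definition tors_run (w : seq S) (k : nat) : 'I_m * seq E :=
  let d0 := foldl (read_step i0) (1%g, [::]) w in
  foldl orbit_step (d0.1 i0, d0.2) (take k (rev d0.2)).

Definition tors_ok (w : seq S) (j0 : nat) : Prop :=
  [/\ j0 <= size (tors_run w 0).2, j0 <= size (tors_run w j0).2, size (tors_run w j0).2 <= j0 + C &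
   forall k, k < j0 -> k + C < size (tors_run w k).2].

Definition tors_word (w : seq S) (j0 : nat) : {bseq C of E} * 'I_m :=
  (insub_bseq C (rev (take (size (tors_run w j0).2 - j0) (tors_run w j0).2)), (tors_run w j0).1).

Lemma exec_short_conj_word t W B M P D K p w (j0 : nat) : tors_ok w j0 ->
  W p = wtape w -> P p = blank -> D p = blank -> K p = blank ->
  exists a b c, exec (short_conj p) (bank t W B M P D K)
    (tors_cost (size w)) (tors_word w j0)
    (bank t W B M (setb P p a) (setb D p b) (setb K p c)).
Proof.
case; rewrite /tors_run take0 /= => h1 h2 h3 h4 eW eP eD eK.
have [a [b [c1 ex]]] := exec_short_conj t B M h1 h2 h3 h4 eW eP eD eK.
exists a, b, c1; apply: exec_le ex _.
have := size_read_steps i0 (1%g, [::]) w; rewrite /= add0n => h.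
rewrite /tors_cost; do 2 rewrite leq_add2r; rewrite leq_add2l.
by rewrite leq_mul2l h orbT.
Qed.

Lemma exec_conj_program_tors (ju jv : nat) : (exists j, rot_at j) -> c = [::] ->
  tors_ok u ju -> tors_ok v jv ->
  exists T', exec conj_program start total_cost (verdict (tors_word u ju) (tors_word v jv)) T'.
Proof.
move=> [j hj] cn hu hv; have [t ex1] := exec_split_input u v blank blank all_blank all_blank all_blank.
have [b' [ex2 hb']] := exec_try_all t all_blank (enum 'I_m).
have eb : b' = true by apply/hb'; exists j; rewrite ?mem_enum.
rewrite {}eb cn in ex2.
have [a [b [c1 ex3]]] := @exec_short_conj_word t (input_words u v) blank blank all_blank all_blank all_blank false u ju hu erefl erefl erefl erefl.
have [a' [b1 [c2 ex4]]] := @exec_short_conj_word t (input_words u v) blank blank (setb all_blank false a)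
   (setb all_blank false b) (setb all_blank false c1) true v jv hv erefl erefl erefl erefl.
eexists; apply: (exec_seq ex1); first apply: (exec_bind ex2).
  eapply exec_bind; [exact: ex3|].
  eapply exec_bind; [exact: ex4|exact: exec_ret].
rewrite /total_cost; move: ((try_cost + 1) * _) (tors_cost (size u)) (tors_cost (size v)) => X1 X2 X3; lia.
Qed.

End Correctness.
End Algo.

Local Open Scope group_scope.

(** * Conjugacy and roots in free groups *)

Section Free.
Variables (G : groupType) (E : finType) (inv : E -> E) (ev : E -> G).
Hypotheses (invK : involutive inv) (inv_ne : forall e, inv e != e)
  (evV : forall e, ev (inv e) = (ev e)^-1).

Definition red (w : seq E) := sorted (fun l m => m != inv l) w.
Definition weval (w : seq E) : G := \big[*%g/1]_(e <- w) ev e.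
Hypothesis weval_inj : forall w w', red w -> red w' -> weval w = weval w' -> w = w'.

Implicit Types (w s c d f : seq E) (e : E).
Local Notation winv := (inv_word inv).
Local Notation cyc_reduced := (cyc_reduced inv).
Local Notation pushr := (pushr inv).

Lemma letter_inv_inj : injective inv. Proof. exact: inv_inj invK. Qed.
Lemma inv_eqC e e' : (e == inv e') = (e' == inv e).
Proof. by apply/eqP/eqP => ->; rewrite invK. Qed.

Lemma weval_nil : weval [::] = 1. Proof. by rewrite /weval big_nil. Qed.
Lemma weval_cons e w : weval (e :: w) = ev e * weval w. Proof. by rewrite /weval big_cons. Qed.
Lemma weval_cat w w' : weval (w ++ w') = weval w * weval w'. Proof. by rewrite /weval big_cat. Qed.
Lemma weval_rcons w e : weval (rcons w e) = weval w * ev e.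
Proof. by rewrite -cats1 weval_cat weval_cons weval_nil mulg1. Qed.
Lemma weval_winv w : weval (winv w) = (weval w)^-1.
Proof.
elim: w => [|e w IH]; first by rewrite weval_nil invg1.
by rewrite /inv_word /= rev_cons weval_rcons -/(winv w) IH evV weval_cons invgM.
Qed.

Lemma red_cat w a b w' : red (rcons w a ++ b :: w') = [&& red (rcons w a), b != inv a & red (b :: w')].
Proof.
rewrite /red; case: w => [|x w] //=.
by rewrite cat_path last_rcons.
Qed.

Lemma red_catl w w' : red (w ++ w') -> red w.
Proof. by rewrite /red; case: w => //= x w; rewrite cat_path => /andP[]. Qed.
Lemma red_catr w w' : red (w ++ w') -> red w'.
Proof.
elim: w => //= x w IH h; apply: IH; move: h; rewrite /red /=.
exact: path_sorted.
Qed.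

Lemma red_rev w : red (rev w) = red w.
Proof.
by rewrite /red rev_sorted; apply: eq_sorted => x y; rewrite inv_eqC.
Qed.
Lemma red_winv w : red (winv w) = red w.
Proof.
rewrite red_rev /red sorted_map; apply: eq_sorted => x y /=.
by rewrite (inj_eq letter_inv_inj).
Qed.

Lemma weval_pushr st e : weval (rev (pushr st e)) = weval (rev st) * ev e.
Proof.
case: st => [|y st] /=; first by rewrite weval_cons weval_nil mul1g mulg1.
case: eqP => [->|_]; last by rewrite rev_cons weval_rcons.
by rewrite rev_cons weval_rcons evV mulgVK.
Qed.
Lemma weval_pushrs st ws : weval (rev (foldl pushr st ws)) = weval (rev st) * weval ws.
Proof.
elim: ws st => [|e ws IH] st /=; first by rewrite weval_nil mulg1.
by rewrite IH weval_pushr weval_cons mulgA.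
Qed.
Lemma red_pushr st e : red st -> red (pushr st e).
Proof.
case: st => [|y st] //= h; case: eqP => [_|/eqP ne]; first exact: path_sorted h.
by rewrite /red /= h andbT.
Qed.
Lemma red_pushrs st ws : red st -> red (foldl pushr st ws).
Proof. by elim: ws st => //= e ws IH st h; apply/IH/red_pushr. Qed.

Lemma red_exists w : exists2 w', red w' & weval w' = weval w.
Proof.
exists (rev (foldl pushr [::] w)); first by rewrite red_rev red_pushrs.
by rewrite weval_pushrs weval_nil mul1g.
Qed.

Lemma cyc_decomp w : red w -> exists s c, [/\ w = s ++ c ++ winv s, cyc_reduced c & (c = [::] -> s = [::])].
Proof.
have [n] := ubnP (size w); elim: n w => // n IH w le rw.
case: w le rw => [|e w] le rw; first by exists [::], [::].
have [eq|ne] := eqVneq (last e w) (inv e); last by exists [::], (e :: w); rewrite cats0.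
case/lastP: w le rw eq => [|w x] le rw /=; first by move/eqP; rewrite eq_sym (negPf (inv_ne e)).
rewrite last_rcons => ex; rewrite {x}ex in le rw *.
have rw' : red w.
  by move: rw; rewrite -cats1 -cat1s => /red_catr/red_catl.
have [|s [c [ew redc c0]]] := IH w _ rw'; first by move: le; rewrite /= size_rcons; lia.
exists (e :: s), c; split=> //.
- by rewrite ew /inv_word /= rev_cons -!cats1 -!catA.
- by move=> c1; move: rw; rewrite ew (c0 c1) c1 /red /= eqxx.
Qed.

Lemma commute_conj (g x y : G) : commute g x -> commute (g ^ y) (x ^ y).
Proof. by rewrite /commute -!conjMg => ->. Qed.
Lemma commute_fix (g x : G) : commute g x -> g ^ x = g.
Proof. by move=> h; rewrite conjgE h mulKg. Qed.

Lemma rot_cons_rcons k e c : k <= size c -> rot k.+1 (e :: c) = rot k (rcons c e).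
Proof. by move=> le; rewrite rotS // rot_rot rot1_cons. Qed.

(** Induction on the conjugator [f].  If its first letter cancels against one end
    of [c], conjugating by that letter rotates [c] by one letter.  If it cancels
    at neither end, the conjugate is not cyclically reduced.  When the rotation
    comes full circle, the conjugator gained a factor [c], which acts trivially
    on the centralizer of [c]; hence on this centralizer the conjugator acts
    like a prefix of [c].  That last clause controls what happens to [u] when
    its power [c] is conjugated. *)
Lemma weval_conj_red c d f : red c -> cyc_reduced c -> c != [::] -> red d -> cyc_reduced d -> red f ->
  weval c ^ weval f = weval d ->
  exists i, [/\ (i <= size c)%N, rot i c = d &
    forall g, commute g (weval c) -> g ^ weval f = g ^ weval (take i c)].
Proof.
elim: f c => [|e f IH] c rc cc cn rd cd rf ecd.
  exists 0%N; split=> //; first by rewrite rot0; apply: weval_inj; rewrite // -ecd weval_nil conjg1.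
  by move=> g _; rewrite take0.
have rf' : red f by move: rf; rewrite /red /=; apply: path_sorted.
have step c' : red c' -> cyc_reduced c' -> c' != [::] -> weval c' = weval c ^ ev e ->
    exists i, [/\ (i <= size c')%N, rot i c' = d &
      forall g, commute g (weval c) -> g ^ weval (e :: f) = g ^ (ev e * weval (take i c'))].
  move=> rc' cc' cn' ev'; have [|||||||i [li ei hi]] := IH c' => //.
    by rewrite ev' -conjgM -weval_cons.
  exists i; split=> // g cg; rewrite weval_cons !conjgM; apply: hi.
  by rewrite ev'; apply: commute_conj.
case: (boolP (head (inv e) c == e)) => [|na].
  case: c rc cc cn ecd step => [|e' c]; first by [].
  move=> rc cc _ ecd step /= /eqP ee; rewrite {e'}ee in rc cc ecd step *.
  have [||||i [li ei hi]] := step (rcons c e).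
  - case/lastP: c rc cc {ecd step} => // c x rc; rewrite /= last_rcons => cc.
    by rewrite -cats1 red_cat (red_catr (w := [:: e])) //= andbT inv_eqC.
  - case: c rc {ecd step cc} => [|x c] /=; first by rewrite eq_sym inv_ne.
    by rewrite last_rcons /red /= => /andP[]; rewrite inv_eqC.
  - by rewrite -size_eq0 size_rcons.
  - by rewrite weval_rcons weval_cons conjgE !mulgA mulVg mul1g.
  (* Rotating the conjugate by all its letters changes nothing: only [e] has moved. *)
  move: li; rewrite size_rcons leq_eqVlt => /orP[/eqP ei'|li].
  - exists 1%N; split=> //; first by rewrite -ei ei' rot1_cons rot_oversize // size_rcons.
    move=> g cg; rewrite hi // ei' take_oversize ?size_rcons //= take0.
    rewrite weval_rcons mulgA -weval_cons conjgM (commute_fix cg).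
    by rewrite weval_cons weval_nil mulg1.
  - exists i.+1; split=> //; first by rewrite rot_cons_rcons.
    by move=> g cg; rewrite hi //= weval_cons -cats1 takel_cat.
case: (boolP (last e c == inv e)) => [|nb].
  case/lastP: c rc cc cn na ecd step => [|c e']; first by [].
  move=> rc cc _ na ecd step; rewrite last_rcons => /eqP ee; rewrite {e'}ee in rc cc na ecd step *.
  have [||||i [li ei hi]] := step (inv e :: c).
  - case: c rc na {cc ecd step} => // x c rc /= na.
    by rewrite /red /= invK na; apply: (@red_catl (x :: c) [:: inv e]); rewrite cats1.
  - case/lastP: c rc {cc na ecd step} => [|c x]; first by rewrite /= invK inv_ne.
    rewrite /= last_rcons invK -[rcons (rcons _ _) _]cats1 red_cat => /and3P[_ h _].
    by apply: contra h => /eqP->.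
  - by [].
  - by rewrite weval_rcons weval_cons evV conjgE mulgVK.
  have ec : weval c = weval (rcons c (inv e)) * ev e by rewrite weval_rcons evV mulgVK.
  case: i li ei hi => [|i] li ei hi.
  - exists (size c); rewrite size_rcons -cats1 rot_size_cat takel_cat // take_size cats1; split=> //.
      by rewrite -ei rot0.
    by move=> g cg; rewrite hi // take0 weval_nil mulg1 ec conjgM (commute_fix cg).
  - exists i; split; first by rewrite size_rcons ltnW.
      by rewrite -rot_cons_rcons.
    by move=> g cg; rewrite hi //= weval_cons evV mulKVg -cats1 takel_cat.
(* Otherwise nothing cancels in the conjugate, which cannot be cyclically reduced. *)
exfalso.
have rw : red (winv (e :: f) ++ c ++ (e :: f)).
  have r1 : red (c ++ e :: f).
    case/lastP: c rc nb cn {na cc ecd step} => // c y rc; rewrite last_rcons => nb _.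
    by rewrite red_cat rc rf inv_eqC nb.
  rewrite /inv_word /= rev_cons -/(winv f).
  case: c na cn r1 {rc nb cc ecd step} => // a c na _ r1.
  rewrite /= red_cat r1 andbT invK na andbT.
  by move: (red_winv (e :: f)); rewrite rf /inv_word /= rev_cons.
have ed : winv (e :: f) ++ c ++ (e :: f) = d.
  by apply: weval_inj => //; rewrite -ecd !weval_cat weval_winv conjgE.
move: cd; rewrite -ed lastI; move: (belast e f) (last e f) => f1 z.
rewrite /inv_word map_rcons rev_rcons /= !last_cat last_rcons invK.
by rewrite eqxx.
Qed.

Definition wpow n c := flatten (nseq n c).
Lemma weval_wpow n c : weval (wpow n c) = weval c ^+ n.
Proof.
elim: n => [|n IH]; first by rewrite weval_nil expg0.
by rewrite /wpow /= weval_cat -/(wpow n c) IH expgS.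
Qed.
Lemma red_wpow n c : red c -> cyc_reduced c -> red (wpow n c).
Proof.
case: c => [|e c] rc cc; first by rewrite /wpow; elim: n.
elim: n => // n IH.
case: n IH => [|n] IH; first by rewrite /wpow /= cats0.
change (is_true (red ((e :: c) ++ e :: (c ++ wpow n (e :: c))))).
change (is_true (red (e :: (c ++ wpow n (e :: c))))) in IH.
by rewrite [X in X ++ _]lastI red_cat -lastI rc IH andbT inv_eqC; exact: cc.
Qed.
Lemma size_wpow n c : size (wpow n c) = (n * size c)%N.
Proof. by rewrite size_flatten /shape map_nseq sumn_nseq mulnC. Qed.

(** The junctions of consecutive copies of [c] are reduced because [c] is
    cyclically reduced, and the outer junctions are those of the given word. *)
Lemma red_sandwich s c n : (0 < n)%N -> red (s ++ c ++ winv s) -> cyc_reduced c -> c != [::] ->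
  red (s ++ wpow n c ++ winv s).
Proof.
case: n => // n _; case: c => // e c rw cc _.
have r1 : red (wpow n.+1 (e :: c) ++ winv s).
  have rcs := red_catr rw.
  elim: n => [|n IH]; first by rewrite /wpow /= cats0.
  have -> : wpow n.+2 (e :: c) ++ winv s = (e :: c) ++ wpow n.+1 (e :: c) ++ winv s by rewrite catA.
  have e1 : wpow n.+1 (e :: c) ++ winv s = e :: (c ++ wpow n (e :: c)) ++ winv s by [].
  rewrite e1 in IH *.
  by rewrite [X in X ++ _]lastI red_cat -lastI (red_catl rcs) IH andbT inv_eqC; exact: cc.
move: rw r1; set t := winv s; case/lastP: s @t => [|s x] t //.
change (red (rcons s x ++ e :: (c ++ t)) -> red (e :: (c ++ wpow n (e :: c)) ++ t) ->
  red (rcons s x ++ e :: (c ++ wpow n (e :: c)) ++ t)).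
by rewrite !red_cat => /and3P[-> -> _] ->.
Qed.

Lemma weval_torsion_free w n : red w -> (0 < n)%N -> weval w ^+ n = 1 -> w = [::].
Proof.
move=> rw n0 e1; have [s [c [ew cc c0]]] := cyc_decomp rw.
have [c1|cn] := eqVneq c [::]; first by rewrite ew (c0 c1) c1.
have : s ++ wpow n c ++ winv s = [::].
  apply: weval_inj => //; first by apply: red_sandwich => //; rewrite -ew.
  rewrite !weval_cat weval_wpow weval_winv weval_nil.
  have := e1; rewrite ew !weval_cat weval_winv.
  have -> : weval s * (weval c * (weval s)^-1) = weval c ^ (weval s)^-1 by rewrite conjgE invgK.
  by rewrite -conjXg => <-; rewrite conjgE invgK.
move/(congr1 size); rewrite !size_cat size_wpow; move: cn; rewrite -size_eq0.
by case: (size c) => // k; case: (n) n0 => //= n' _; rewrite mulSn; lia.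
Qed.

(** After conjugation [a] is cyclically reduced, and then so is its power.  The
    power of [b], written as [s' c'^n s'^-1], is cyclically reduced only if [s']
    is empty; then [c] and [c'] are the prefixes of equal length of one word. *)
Lemma weval_root_uniq a b n : red a -> red b -> (0 < n)%N -> weval a ^+ n = weval b ^+ n -> weval a = weval b.
Proof.
move=> ra rb n0 eab; have [s [c [ea cc c0]]] := cyc_decomp ra.
have [c1|cn] := eqVneq c [::].
  have a1 : a = [::] by rewrite ea (c0 c1) c1.
  rewrite a1 weval_nil expg1n in eab *.
  by rewrite (weval_torsion_free rb n0 (esym eab)) weval_nil.
have rc : red c by move: ra; rewrite ea => /red_catr/red_catl.
have [b' rb' eb'] := red_exists (winv s ++ b ++ s).
have conj_b : weval b' = weval b ^ weval s by rewrite eb' !weval_cat weval_winv conjgE.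
have conj_a : weval c = weval a ^ weval s.
  by rewrite ea !weval_cat weval_winv conjgE !mulgA mulVg mul1g mulgVK.
have [s' [c' [eb cc' c0']]] := cyc_decomp rb'.
have epow : weval c ^+ n = weval b' ^+ n by rewrite conj_a conj_b -!conjXg eab.
have [c1|cn'] := eqVneq c' [::].
  have b1 : b' = [::] by rewrite eb (c0' c1) c1.
  rewrite b1 weval_nil expg1n in epow.
  by have := weval_torsion_free rc n0 epow => c1'; rewrite c1' in cn.
have ew : wpow n c = s' ++ wpow n c' ++ winv s'.
  apply: weval_inj; first exact: red_wpow.
    by apply: red_sandwich => //; rewrite -eb.
  rewrite weval_wpow epow eb !weval_cat !weval_wpow weval_winv.
  have -> : weval s' * (weval c' * (weval s')^-1) = weval c' ^ (weval s')^-1 by rewrite conjgE invgK.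
  by rewrite -conjXg conjgE invgK.
case: s' {c0'} eb ew => [|x s'] eb ew; last first.
  exfalso; case: c cn cc rc ew {ea c0 conj_a epow} => // e c _ cc rc.
  case: n n0 {eab} => // n _; rewrite {1}/wpow /= => -[ex].
  have -> : c ++ flatten (nseq n (e :: c)) = behead (wpow n.+1 (e :: c)) by [].
  move=> ew; have el : last e (behead (wpow n.+1 (e :: c))) = inv x.
    by rewrite ew /inv_word /= rev_cons -cats1 !catA last_cat.
  move: cc; rewrite /=.
  have -> : last e c = last e (behead (wpow n.+1 (e :: c))).
    rewrite /wpow /=; elim: n {ew el} => [|n IH] /=; first by rewrite cats0.
    by rewrite last_cat /=.
  by rewrite el ex eqxx.
have ec : c = c'.
  move: ew; rewrite /= cats0 => ew; have := congr1 size ew; rewrite !size_wpow => /eqP.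
  rewrite eqn_pmul2l // => /eqP es; move: ew; case: (n) n0 => // n' _.
  by rewrite /wpow /= => /eqP; rewrite eqseq_cat // => /andP[/eqP].
apply: (conjg_inj (weval s)); rewrite -conj_a -conj_b eb /= cats0 ec.
by [].
Qed.

(** * Powers in a group with a free subgroup of finite index *)

Section Twisted.
Variable m : nat.
Notation Q := {perm 'I_m}.
Variable sigma : G -> Q.
Hypothesis sigmaM : {morph sigma : x y / x * y}.
Hypothesis ker_weval : forall g, sigma g = 1 -> exists2 w, red w & weval w = g.

Lemma sigma1 : sigma 1 = 1.
Proof. by apply: (mulgI (sigma 1)); rewrite -sigmaM !mulg1. Qed.
Lemma sigmaV x : sigma x^-1 = (sigma x)^-1.
Proof. by apply: (mulgI (sigma x)); rewrite -sigmaM !mulgV sigma1. Qed.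
Lemma sigmaJ x y : sigma (x ^ y) = sigma x ^ sigma y.
Proof. by rewrite !conjgE !sigmaM sigmaV. Qed.
Lemma sigmaX x n : sigma (x ^+ n) = sigma x ^+ n.
Proof. by elim: n => [|n IH]; rewrite ?expg0 ?sigma1 // !expgS sigmaM IH. Qed.

Local Notation k := #|{: Q}|.
Lemma sigma_expk x : sigma (x ^+ k) = 1.
Proof. by rewrite sigmaX -cardsT; apply: (@expg_cardG _ (setT_group _)); rewrite finset.in_setT. Qed.
Lemma k_gt0 : (0 < k)%N.
Proof. by apply/card_gt0P; exists 1. Qed.

(** Every [y ^+ t] fixes [c], so it acts on the centralizer of [c] like one of
    the finitely many prefixes of [c]; two powers of [y] act equally, and the
    quotient of the two is central there. *)
Lemma power_central c y : red c -> cyc_reduced c -> c != [::] -> sigma y = 1 -> commute y (weval c) ->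
  exists2 p, (0 < p)%N & forall g, commute g (weval c) -> commute g (y ^+ p).
Proof.
move=> rc cc cn y1 cy.
pose R (t i : nat) := (i <= size c)%N /\
  forall g, commute g (weval c) -> g ^ (y ^+ t) = g ^ weval (take i c).
have /choice[it itP] : forall t, exists i, R t i.
  move=> t; have [|f rf ef] := @ker_weval (y ^+ t); first by rewrite sigmaX y1 expg1n.
  have e : weval c ^ weval f = weval c.
    by rewrite ef; apply: commute_fix; apply: commuteX; apply: commute_sym.
  have [i [li _ hi]] := weval_conj_red rc cc cn rc cc rf e.
  by exists i; split=> // g cg; rewrite -ef hi.
pose F (t : 'I_(size c).+2) : 'I_(size c).+1 := inord (it t).
have /injectivePn[t1 [t2 ne]] : ~~ injectiveb F.
  by apply/negP => /injectiveP /leq_card; rewrite !card_ord ltnn.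
move=> /(congr1 (@nat_of_ord _)); rewrite /F !inordK ?ltnS; try by case: (itP t1); case: (itP t2).
move=> eit.
have {ne eit} [a [b [lt eab]]] : exists a b, (a < b)%N /\ it a = it b.
  move: ne; rewrite -val_eqE neq_ltn => /orP[lt|lt]; first by exists t1, t2.
  by exists t2, t1.
exists (b - a)%N; first by rewrite subn_gt0.
move=> g cg; pose g' := g ^ (y ^- a).
have cg' : commute g' (weval c).
  have -> : weval c = weval c ^ (y ^- a).
    by rewrite commute_fix //; apply: commuteV; apply: commuteX; apply: commute_sym.
  exact: commute_conj.
have ga := (itP a).2 _ cg'; have gb := (itP b).2 _ cg'.
have : g ^ (y ^+ (b - a)) = g.
  rewrite -[in RHS](conjgKV (y ^+ a) g) -/g' ga eab -gb /g' -conjgM.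
  by rewrite -{2}(subnKC (ltnW lt)) expgnDr mulKg.
by rewrite conjgE => /(congr1 (mulg (y ^+ (b - a)))); rewrite mulKVg.
Qed.

(** Conjugate so that the common power [c] is cyclically reduced, and put
    [y = a^-1 b], an element of the free subgroup that commutes with [c].  A
    power of [y] commutes with [a], so [y] and [y ^ a] have a common power and
    are equal by uniqueness of roots.  Hence [a] and [b] commute,
    [y ^+ k = 1], and [y = 1] since the free subgroup has no torsion. *)
Lemma power_sigma_inj a b : a ^+ k = b ^+ k -> sigma a = sigma b -> a ^+ k != 1 -> a = b.
Proof.
move=> eab sab ne1.
have [w rw ew] := ker_weval (sigma_expk a).
have [s [c [es cc c0]]] := cyc_decomp rw.
have rc : red c by move: rw; rewrite es => /red_catr/red_catl.
have cn : c != [::].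
  by apply/eqP => c1; move: ne1; rewrite -ew es (c0 c1) c1 weval_nil eqxx.
pose x := weval s; pose a' := a ^ x; pose b' := b ^ x; pose y := a'^-1 * b'.
have ea' : a' ^+ k = weval c.
  by rewrite -conjXg -ew es !weval_cat weval_winv conjgE !mulgA mulVg mul1g mulgVK.
have eb' : b' ^+ k = weval c by rewrite -ea' -!conjXg eab.
have y1 : sigma y = 1 by rewrite sigmaM sigmaV /a' /b' !sigmaJ sab mulVg.
have ca : commute a' (weval c) by rewrite -ea'; apply: commuteX.
have cb : commute b' (weval c) by rewrite -eb'; apply: commuteX.
have cy : commute y (weval c).
  by apply: commute_sym; apply: commuteM; [apply: commuteV|]; apply: commute_sym.
have [p p0 hp] := power_central rc cc cn y1 cy.
have [wy ry ey] := ker_weval y1.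
have [wz rz ez] : exists2 w, red w & weval w = y ^ a' by apply: ker_weval; rewrite sigmaJ y1 conj1g.
have cya : commute y a'.
  have : weval wz = weval wy.
    apply: (weval_root_uniq rz ry p0); rewrite ey ez -conjXg commute_fix //.
    exact/commute_sym/hp.
  rewrite ez ey conjgE => /(congr1 (mulg a')); rewrite mulKVg => e.
  by rewrite /commute e.
have eb : b' = a' * y by rewrite mulKVg.
have yk : y ^+ k = 1.
  by apply: (mulgI (weval c)); rewrite mulg1 -{1}ea' -expgMn -?eb ?eb' //; apply: commute_sym.
have wy0 : wy = [::] by apply: (weval_torsion_free ry k_gt0); rewrite ey.
apply: (conjg_inj x); rewrite -/a' -/b' eb -ey wy0 weval_nil mulg1.
by [].
Qed.

Notation sigmaE := (fun e => sigma (ev e)).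
Lemma slide_sigma q w : slide sigmaE q w = q ^ sigma (weval w).
Proof.
elim: w q => [|e w IH] q /=; first by rewrite weval_nil sigma1 conjg1.
by rewrite [LHS]IH weval_cons sigmaM conjgM.
Qed.

(** When the labels close up around [c], going around the cycle from another
    starting point gives the same labels. *)
Lemma rot_labels q c r : slide sigmaE q c = q -> (r <= size c)%N ->
  rot r (labels sigmaE q c) = labels sigmaE (slide sigmaE q (take r c)) (rot r c).
Proof.
move=> hq lr; rewrite -{1}(cat_take_drop r c) labels_cat.
have sr : size (labels sigmaE q (take r c)) = r by rewrite size_labels size_takel.
rewrite -{1}sr rot_size_cat /rot labels_cat; congr (_ ++ labels _ _ _).
by move: hq; rewrite -{1}(cat_take_drop r c) /slide foldl_cat.
Qed.

(** From left to right, the conjugator acts on [u'], which commutes with its own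
    power [c], like a prefix of [c], and so the labels are rotated along with
    the letters.  From right to left, the letters give a conjugator [x] for the
    [k]-th powers, the first label says that [u' ^ x] and [v'] have the same
    image, and [power_sigma_inj] applies. *)
Lemma conj_iff_rot u v s c s' c' :
  red (s ++ c ++ winv s) -> cyc_reduced c -> c != [::] -> weval (s ++ c ++ winv s) = u ^+ k ->
  red (s' ++ c' ++ winv s') -> cyc_reduced c' -> weval (s' ++ c' ++ winv s') = v ^+ k ->
  (exists2 f, red f & u ^ weval f = v) <->
  exists r, rot r (labels sigmaE (slide sigmaE (sigma u) s) c) = labels sigmaE (slide sigmaE (sigma v) s') c'.
Proof.
move=> rw cc cn ew rw' cc' ew'.
have rc : red c by move: rw => /red_catr/red_catl.
have rc' : red c' by move: rw' => /red_catr/red_catl.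
pose u' := u ^ weval s; pose v' := v ^ weval s'.
have eu' : u' ^+ k = weval c.
  by rewrite -conjXg -ew !weval_cat weval_winv conjgE !mulgA mulVg mul1g mulgVK.
have ev' : v' ^+ k = weval c'.
  by rewrite -conjXg -ew' !weval_cat weval_winv conjgE !mulgA mulVg mul1g mulgVK.
have cu : commute u' (weval c) by rewrite -eu'; apply: commuteX.
rewrite !slide_sigma -!sigmaJ -/u' -/v'.
have close : slide sigmaE (sigma u') c = sigma u' by rewrite slide_sigma -sigmaJ commute_fix.
split=> [[f rf euv]|[r er]].
- have [f' rf' ef'] := red_exists (winv s ++ f ++ s').
  have euv' : u' ^ weval f' = v'.
    by rewrite ef' !weval_cat weval_winv /u' -conjgM mulKVg conjgM euv.
  have ecd : weval c ^ weval f' = weval c' by rewrite -eu' -ev' -euv' conjXg.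
  have [i [li ei hi]] := weval_conj_red rc cc cn rc' cc' rf' ecd.
  exists i; rewrite rot_labels // ei slide_sigma -sigmaJ -hi // euv'.
  by [].
- wlog lr : r er / (r <= size c)%N.
    move=> h; have [lr|/ltnW lr] := leqP r (size c); first exact: (h r).
    apply: (h 0%N) => //; rewrite rot0 -er rot_oversize // size_labels //.
  rewrite rot_labels // in er.
  have erc : rot r c = c' by have := congr1 (map snd) er; rewrite !map_labels.
  have sgb : sigma (u' ^ weval (take r c)) = sigma v'.
    move: er; rewrite erc slide_sigma -sigmaJ; case: c' {rw' cc' ew' rc' ev'} erc => [|x c'] erc.
      by move: cn; rewrite -size_eq0 -(size_rot r) erc.
    by case.
  have eb : (u' ^ weval (take r c)) ^+ k = weval c'.
    rewrite -conjXg eu' -erc -{1}(cat_take_drop r c) /rot !weval_cat conjgE mulgA mulKg.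
    by [].
  have euv : u' ^ weval (take r c) = v'.
    apply: power_sigma_inj => //; first by rewrite eb ev'.
    rewrite eb; apply/eqP => c1.
    have := weval_inj rc' (isT : red [::]); rewrite weval_nil => /(_ c1) c2.
    by move: cn; rewrite -size_eq0 -(size_rot r) erc c2.
  have [f rf ef] := red_exists (s ++ take r c ++ winv s').
  exists f => //; rewrite ef !weval_cat weval_winv !conjgM -/u' euv /v' -conjgM mulgV conjg1.
  by [].
Qed.
End Twisted.
End Free.

(** * Short conjugates of torsion elements: correctness *)

(** Each letter pushed removes at most one letter of the stack. *)
Lemma take_pushrs (E : finType) (inv : E -> E) (st ws : seq E) l : (l + size ws <= size st)%N ->
  take l (rev (foldl (pushr inv) st ws)) = take l (rev st) /\
  (l <= size (foldl (pushr inv) st ws))%N.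
Proof.
elim: ws st => [|e ws IH] st /= le; first by split=> //; lia.
have key : take l (rev (pushr inv st e)) = take l (rev st) /\ (l + size ws <= size (pushr inv st e))%N.
  case: st le => [|y st] /= le; first by lia.
  have tk a x : (l <= size a)%N -> take l (rcons a x) = take l a.
    by move=> h; rewrite -cats1 takel_cat.
  case: eqP => _; split => /=; try lia; rewrite !rev_cons.
  - by rewrite tk // size_rev; lia.
  - by rewrite tk // size_rcons size_rev; lia.
by have [e1 e2] := IH _ key.2; rewrite e1 key.1.
Qed.

Section Torsion.
Variables (G : groupType) (E : finType) (inv : E -> E) (ev : E -> G) (m : nat).
Notation Q := {perm 'I_m}.
Variables (sigmaE : E -> Q) (rho : 'I_m -> G) (tabE : 'I_m -> E -> seq E)
  (rtab : 'I_m -> 'I_m -> seq E) (rnext : 'I_m -> 'I_m -> 'I_m) (L : nat).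
Local Notation red := (red inv).
Local Notation weval := (weval ev).
Local Notation pushr := (pushr inv).
Local Notation orbit_step := (orbit_step inv sigmaE tabE).
Hypotheses (invK : involutive inv) (evV : forall e, ev (inv e) = (ev e)^-1)
  (tabE_spec : forall i e, rho i * ev e = weval (tabE i e) * rho (sigmaE e i))
  (rtab_spec : forall i a, rho i * rho a = weval (rtab i a) * rho (rnext i a))
  (nf_ex : forall g, exists w i, red w /\ g = weval w * rho i)
  (nf_uniq : forall w w' i j, red w -> red w' -> weval w * rho i = weval w' * rho j -> w = w' /\ i = j)
  (tabE_L : forall i e, (size (tabE i e) <= L)%N) (rtab_L : forall i a, (size (rtab i a) <= L)%N)
  (rho1 : exists i, rho i = 1).

(** The equation determines [y], and there are finitely many choices for the
    other four unknowns. *)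
Lemma bounded_diff : exists M, forall z z' a b y, (size z <= L)%N -> (size z' <= L)%N -> red y ->
  weval z * rho b * weval y = weval z' * rho a -> (size y <= M)%N.
Proof.
pose T := ({bseq L of E} * {bseq L of E} * 'I_m * 'I_m)%type.
pose P (t : T) n := forall y, red y -> weval t.1.1.1 * rho t.1.2 * weval y = weval t.1.1.2 * rho t.2 -> (size y <= n)%N.
have /choice[f fP] : forall t : T, exists n, P t n.
  move=> t; have [[y ry ey]|ny] := pselect (exists2 y, red y & weval t.1.1.1 * rho t.1.2 * weval y = weval t.1.1.2 * rho t.2).
  - exists (size y) => y' ry' ey'.
    have [i ri] := rho1.
    have /nf_uniq : weval y * rho i = weval y' * rho i.
      by congr (_ * _); apply: (mulgI (weval t.1.1.1 * rho t.1.2)); rewrite ey ey'.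
    by move=> /(_ ry ry') [->].
  - by exists 0%N => y ry ey; case: ny; exists y.
exists (\max_t f t)%N => z z' a b y lz lz' ry ey.
have := fP (Bseq lz, Bseq lz', b, a) y ry ey.
by move/leq_trans; apply; apply: leq_bigmax.
Qed.

Section Orbit.
Variables (M : nat) (g : G) (h : seq E) (i1 : 'I_m).
Hypothesis MP : forall z z' a b y, (size z <= L)%N -> (size z' <= L)%N -> red y ->
  weval z * rho b * weval y = weval z' * rho a -> (size y <= M)%N.
Hypotheses (rh : red h) (eg : g = weval h * rho i1).
Local Notation C := (M + L + 1)%N.

(** The stack [Sw k] after [k] steps is the part in [H] of [g] times the prefix
    of [h] of length [k]; consecutive stacks differ by at most [L] letters at
    the end. *)
Definition orbit_run k := foldl orbit_step (i1, rev h) (take k h).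
Lemma orbit_runS e k : (k < size h)%N -> orbit_run k.+1 = orbit_step (orbit_run k) (nth e h k).
Proof. by move=> lt; rewrite /orbit_run (take_nth e) // -cats1 foldl_cat. Qed.

Lemma orbit_step_spec d e x : red d.2 -> g * x = weval (rev d.2) * rho d.1 ->
  red (orbit_step d e).2 /\ g * (x * ev e) = weval (rev (orbit_step d e).2) * rho (orbit_step d e).1.
Proof.
move=> rd ed; split; first exact: red_pushrs.
by rewrite /orbit_step /= weval_pushrs // mulgA ed -mulgA tabE_spec mulgA.
Qed.

Lemma orbit_run_spec k : red (orbit_run k).2 /\ g * weval (take k h) = weval (rev (orbit_run k).2) * rho (orbit_run k).1.
Proof.
rewrite /orbit_run; elim/last_ind: (take k h) => [|w e [r IH]] /=.
  by rewrite red_rev // revK weval_nil mulg1.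
by rewrite -cats1 foldl_cat /= weval_cat weval_cons weval_nil mulg1; apply: orbit_step_spec.
Qed.

Local Notation Sw k := (rev (orbit_run k).2).
Lemma red_Sw k : red (Sw k). Proof. by rewrite red_rev //; case: (orbit_run_spec k). Qed.

(** Let [X] be the prefix of [h] of length [l].  Then [g] maps the cone of the
    reduced words that start with [X] into itself, and so no power of [g] is
    trivial.  The image [w] of [X y] starts with [X] and is more than [L] letters
    longer when [y] is empty, and each further letter of [y] changes at most [L]
    letters of [w].  So to leave the cone [w] must first come within [L] letters
    of [X].  But the image of the prefix of [X] of length [j] is that close to
    [X] as well, and [MP] bounds the distance in the source of two points whose
    images are so close, whereas it is at least [l - j] here. *)
Lemma no_torsion l j z p : (l <= size h)%N -> take l (Sw l) = take l h ->
  (l + C < size (Sw l))%N -> (j <= l)%N -> Sw j = take l h ++ z -> (size z <= L)%N ->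
  (M < l - j)%N -> (0 < p)%N -> g ^+ p != 1.
Proof.
move=> ln pl big jl ej lz far p0.
set X := take l h in pl ej.
have sX : size X = l by rewrite size_takel.
have cone y w i : red (X ++ y) -> red w -> g * weval (X ++ y) = weval w * rho i ->
    take l w = X /\ (l + L < size w)%N.
  elim/last_ind: y w i => [|y e IH] w i ry rw ew.
    rewrite cats0 in ew; have [_] := orbit_run_spec l; rewrite -/X ew => /nf_uniq.
    by move=> /(_ rw (red_Sw l)) [-> _]; split=> //; lia.
  have ry' : red (X ++ y) by move: ry; rewrite -rcons_cat -cats1 => /red_catl.
  have [w1 [i2 [rw1 ew1]]] := nf_ex (g * weval (X ++ y)).
  have [t1 s1] := IH w1 i2 ry' rw1 ew1.
  pose w2 := rev (foldl pushr (rev w1) (tabE i2 e)).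
  have [e2 _] : w = w2 /\ i = sigmaE e i2.
    apply: nf_uniq; rewrite // ?red_rev ?red_pushrs ?red_rev //.
    rewrite -ew -rcons_cat weval_rcons mulgA ew1 weval_pushrs // revK -!mulgA tabE_spec //.
  have [|t2 s2] := @take_pushrs E inv (rev w1) (tabE i2 e) l.
    by rewrite size_rev; have := tabE_L i2 e; lia.
  rewrite revK in t2; rewrite e2 /w2 t2; split=> //.
  rewrite ltnNge; apply/negP => small.
  have [_ oj] := orbit_run_spec j.
  have ew2 : w = X ++ drop l w by rewrite -{1}(cat_take_drop l w) e2 /w2 t2 t1.
  have sz' : (size (drop l w) <= L)%N by rewrite size_drop e2 /w2; lia.
  have ry2 : red (drop j (X ++ rcons y e)) by move: ry; rewrite -{1}(cat_take_drop j (X ++ _)) => /red_catr.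
  have := @MP z (drop l w) i (orbit_run j).1 _ lz sz' ry2.
  rewrite size_drop size_cat size_rcons sX => /(_ _) hM.
  suff /hM : weval z * rho (orbit_run j).1 * weval (drop j (X ++ rcons y e)) = weval (drop l w) * rho i by lia.
  apply: (mulgI (weval X)); rewrite !mulgA -!weval_cat -ej -oj -ew2 -ew -mulgA -weval_cat.
  congr (_ * weval _); rewrite -[in RHS](cat_take_drop j (X ++ _)); congr (_ ++ _).
  by rewrite takel_cat ?sX // /X take_takel.
have l0 : (0 < l)%N by lia.
have pow q w i : red w -> g ^+ q.+1 = weval w * rho i -> take l w = X.
  elim: q w i => [|q IH] w i rw.
    by rewrite expg1 eg => /nf_uniq => /(_ rh rw) [<-].
  rewrite expgS; have [w1 [i2 [rw1 ew1]]] := nf_ex (g ^+ q.+1); rewrite ew1 => ew.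
  have t1 := IH w1 i2 rw1 ew1.
  have ex1 : w1 = X ++ drop l w1 by rewrite -{1}(cat_take_drop l w1) t1.
  have [w2 [i3 [rw2 ew2]]] := nf_ex (g * weval w1).
  have [||t2 s2] := cone (drop l w1) w2 i3 _ rw2; try by rewrite -ex1.
  have [e3 _] : w = rev (foldl pushr (rev w2) (rtab i3 i2)) /\ i = rnext i3 i2.
    apply: nf_uniq; rewrite // ?red_rev ?red_pushrs ?red_rev //.
    by rewrite -ew mulgA ew2 weval_pushrs // revK -!mulgA rtab_spec.
  have [|t3 _] := @take_pushrs E inv (rev w2) (rtab i3 i2) l.
    by rewrite size_rev; have := rtab_L i3 i2; lia.
  by rewrite e3 t3 revK.
case: p p0 => // p _; apply/eqP => e1.
have [i ri] := rho1.
have := pow p [::] i isT; rewrite e1 weval_nil mul1g ri => /(_ erefl) /(congr1 size).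
by rewrite sX /=; lia.
Qed.

(** Let [l] be the first step that is short, or at which [Sw l] does not continue
    along [h], or at which [h] ends.  Suppose that step [l] is not short.  If
    [h] ends, then [no_torsion] applies with [j = 0], because [Sw 0 = h].
    Otherwise [Sw 0] starts with the first [l.+1] letters of [h] and [Sw l] does
    not; let [j] be the last step before these letters are first damaged.  A
    step changes at most [L] letters, so [Sw j] has at most [l + L] letters; as
    step [j] is not short, [l - j] is large and [no_torsion] applies. *)
Lemma torsion_short p : (0 < p)%N -> g ^+ p = 1 -> exists j,
  [/\ (j <= size h)%N, (j <= size (Sw j))%N, (size (Sw j) <= j + C)%N,
    forall k, (k < j)%N -> (k + C < size (Sw k))%N & take j (Sw j) = take j h].
Proof.
move=> p0 gp.
pose bad l := [|| (size (Sw l) <= l + C)%N, (l < size h)%N && (take l.+1 (Sw l) != take l.+1 h) | l == size h].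
have exb : exists l, bad l by exists (size h); rewrite /bad eqxx !orbT.
case: (ex_minnP exb) => l bl minl.
have good k : (k < l)%N -> [/\ (k < size h)%N, (k + C < size (Sw k))%N & take k.+1 (Sw k) = take k.+1 h].
  have lle : (l <= size h)%N by apply: minl; rewrite /bad eqxx !orbT.
  move=> lk; have : ~~ bad k by apply/negP => /minl; lia.
  rewrite /bad !negb_or -ltnNge negb_and negbK => /and3P[h1 h2 h3].
  by split=> //; [lia|move: h2 => /orP[|/eqP//]; lia].
have lle : (l <= size h)%N by apply: minl; rewrite /bad eqxx !orbT.
have e0 : (0 < size h)%N -> E by case: h => // e0 ? _; exact: e0.
have SwS k e : (k < size h)%N -> Sw k.+1 = rev (foldl pushr (rev (Sw k)) (tabE (orbit_run k).1 (nth e h k))).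
  by move=> lt; rewrite (orbit_runS e) // revK.
have Sw0 : Sw 0 = h by rewrite /orbit_run take0 /= revK.
have [tl sl] : take l (Sw l) = take l h /\ (l <= size (Sw l))%N.
  case: (l) good lle => [|k] good lle; first by rewrite !take0.
  have [ck bk tk] := good k (leqnn _).
  have e := e0 (leq_ltn_trans (leq0n _) ck).
  rewrite (SwS k e) // size_rev.
  have [|t1 s1] := @take_pushrs E inv (rev (Sw k)) (tabE (orbit_run k).1 (nth e h k)) k.+1.
    by rewrite size_rev; have := tabE_L (orbit_run k).1 (nth e h k); lia.
  by rewrite t1 revK tk.
have [found|notfound] := leqP (size (Sw l)) (l + C).
  by exists l; split=> // k /good[].
exfalso.
have [ln|ne] := eqVneq l (size h).
  have hn : (M < size h)%N by have := good 0%N; rewrite -ln Sw0; case: (l) ln notfound => [|l'] ln; rewrite ?Sw0 -?ln; [lia | move=> _ /(_ isT) []; lia].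
  have := @no_torsion l 0%N [::] p lle tl notfound (leq0n _).
  rewrite cats0 Sw0 ln take_size subn0 => /(_ erefl (leq0n _) hn p0).
  by rewrite gp eqxx.
have ll : (l < size h)%N by rewrite ltn_neqAle ne lle.
have e := e0 (leq_ltn_trans (leq0n _) ll).
have ntl : take l.+1 (Sw l) != take l.+1 h.
  by move: bl; rewrite /bad leqNgt notfound (negPf ne) orbF ll.
have [j [jl tj ntj]] : exists j, [/\ (j < l)%N, take l.+1 (Sw j) = take l.+1 h & take l.+1 (Sw j.+1) != take l.+1 h].
  have exn : exists j, take l.+1 (Sw j) != take l.+1 h by exists l.
  case: (ex_minnP exn) => -[|j] nj minj; first by rewrite Sw0 eqxx in nj.
  exists j; split=> //; first exact: minj.
  by apply/eqP; apply/negPn/negP => /minj; rewrite ltnn.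
have [jh bj _] := good j jl.
have sj : (size (Sw j) <= l + L)%N.
  rewrite leqNgt; apply/negP => big; move: ntj; rewrite (SwS j e) //.
  have [|t1 _] := @take_pushrs E inv (rev (Sw j)) (tabE (orbit_run j).1 (nth e h j)) l.+1.
    by rewrite size_rev; have := tabE_L (orbit_run j).1 (nth e h j); lia.
  by rewrite t1 revK tj eqxx.
have tj' : take l (Sw j) = take l h.
  by have := congr1 (take l) tj; rewrite !take_takel.
have := @no_torsion l j (drop l (Sw j)) p lle tl notfound (ltnW jl).
rewrite -tj' cat_take_drop size_drop gp eqxx => H.
suff : ~~ true by [].
apply: H => //; lia.
Qed.
End Orbit.
End Torsion.

Local Open Scope classical_set_scope.
Local Open Scope group_scope.

(** * Cosets, transversal and alphabet *)

Section Cosets.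
Variables (G : groupType) (H : set G).
Hypotheses (subH : is_subgroup H) (finH : finite_index H).

(** The machine reads words from the left, which calls for right cosets; the
    class of [g] is the left coset of its inverse, since the index counts left
    cosets. *)
Lemma coset_action : exists m (cls : G -> 'I_m) (rho : 'I_m -> G) (sigma : G -> {perm 'I_m}),
  [/\ (forall g g', cls g = cls g' <-> H (g * g'^-1)), (forall i, cls (rho i) = i), rho (cls 1) = 1,
      {morph sigma : x y / x * y} & forall g i, sigma g i = cls (rho i * g)].
Proof.
have [H1 HM HV] := subH.
pose F (g : G) : set G := [set g * h | h in H].
have FP a b : F a = F b <-> H (a^-1 * b).
  split=> [e|h].
    have : F a b by rewrite e; exists 1; rewrite ?mulg1.
    by case=> h Hh <-; rewrite mulKg.
  rewrite eqEsubset; split=> x [y Hy <-].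
    exists ((a^-1 * b)^-1 * y); first by apply: HM => //; apply: HV.
    by rewrite invgM invgK !mulgA mulgV mul1g.
  by exists (a^-1 * b * y); [apply: HM | rewrite !mulgA mulgV mul1g].
have [s es] : exists s : seq (set G), range F = [set` s] by apply/finite_seqP; exact: finH.
pose t := undup s; pose m := size t.
have Ft g : F g \in t.
  by rewrite mem_undup; have : range F (F g) by [exists g]; rewrite es.
have lt g : (index (F g^-1) t < m)%N by rewrite index_mem.
pose cls g : 'I_m := Ordinal (lt g).
have clsP g g' : cls g = cls g' <-> H (g * g'^-1).
  have -> : cls g = cls g' <-> F g^-1 = F g'^-1.
    split=> [/(congr1 (@nat_of_ord _)) /= e|e]; last by apply: val_inj; rewrite /= e.
    by rewrite -(nth_index set0 (Ft g^-1)) e nth_index.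
  by rewrite FP invgK.
have /choice[rho0 rho0P] : forall i : 'I_m, exists g, cls g = i.
  move=> i; have : range F (nth set0 t i).
    by rewrite es /=; rewrite -mem_undup mem_nth.
  case=> g _ eg; exists g^-1; apply: val_inj; rewrite /= invgK eg index_uniq //.
  exact: undup_uniq.
pose rho i := if i == cls 1 then 1 else rho0 i.
have rhoP i : cls (rho i) = i by rewrite /rho; case: eqP => [->|].
have act g g' : cls (rho (cls g) * g') = cls (g * g').
  apply/clsP; have /clsP h := rhoP (cls g).
  by rewrite invgM mulgA -(mulgA _ g') mulgV mulg1.
have sinj g : injective (fun i => cls (rho i * g)).
  move=> i j /clsP; rewrite invgM mulgA -(mulgA _ g) mulgV mulg1 => /clsP.
  by rewrite !rhoP.
exists m, cls, rho, (fun g => perm (@sinj g)); split=> //.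
- by rewrite /rho eqxx.
- by move=> x y; apply/permP => i; rewrite permM !permE mulgA act.
- by move=> g i; rewrite permE.
Qed.

End Cosets.

Section Letters.
Variables (G : groupType) (X H : set G) (J : finType) (raw : J -> seq (G * bool)).
Hypotheses (subH : is_subgroup H) (basisX : free_basis X H)
  (rawX : forall j l, l \in raw j -> X l.1).

(** The basis may be infinite, but finitely many words use finitely many of its
    letters, and these generate a free subgroup on a finite alphabet. *)
Lemma free_alphabet : exists (E : finType) (inv : E -> E) (ev : E -> G) (tab : J -> seq E),
  [/\ involutive inv, (forall e, inv e != e), (forall e, ev (inv e) = (ev e)^-1),
    (forall w w', red inv w -> red inv w' -> weval ev w = weval ev w' -> w = w') &
    (forall w, H (weval ev w)) /\ (forall j, weval ev (tab j) = \big[*%g/1]_(l <- raw j) signed_val l)].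
Proof.
have [H1 HM HV] := subH; have [XH uniqX] := basisX.
pose X0 := flatten [seq map fst (raw j) | j <- enum J].
have memX0 x : x \in X0 -> X x.
  by move=> /flattenP[_ /mapP[j _ ->] /mapP[l lj ->]]; apply: rawX lj.
pose E := (seq_sub X0 * bool)%type.
pose emb (e : E) : G * bool := (val e.1, e.2).
pose inv (e : E) : E := (e.1, ~~ e.2).
pose ev (e : E) : G := signed_val (emb e).
have emb_inj : injective emb by move=> [a b] [a' b'] [/val_inj-> ->].
have wvE w : weval ev w = \big[*%g/1]_(l <- map emb w) signed_val l by rewrite big_map.
have redE w : reduced (map emb w) = red inv w.
  rewrite /reduced /red sorted_map; apply: eq_sorted => -[a b] [a' b'] /=.
  rewrite /relpre /inv /emb /= -[(a', b') == _]/((a' == a) && (b' == ~~ b)) [val a == _](inj_eq val_inj) eq_sym.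
  by case: (a' == a); case: b; case: b'.
have embX w l : l \in map emb w -> X l.1.
  by move=> /mapP[e _ ->] /=; apply: memX0; apply: valP.
have Hw w : H (weval ev w).
  elim: w => [|e w IH]; first by rewrite weval_nil.
  rewrite weval_cons; apply: HM => //; rewrite /ev /signed_val /=.
  have He : H (val e.1) by apply/XH/memX0/valP.
  by case: (e.2) => //; apply: HV.
have pull j : exists w : seq E, map emb w = raw j.
  have : forall l, l \in raw j -> l.1 \in X0.
    move=> l lj; apply/flattenP; exists (map fst (raw j)); last exact: map_f.
    by apply: map_f; rewrite mem_enum.
  elim: (raw j) => [|[x b] w IH] h; first by exists [::].
  have [w' <-] : exists w', map emb w' = w by apply: IH => l lw; apply: h; rewrite inE lw orbT.
  have hx : x \in X0 by apply: (h (x, b)); rewrite mem_head.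
  by exists ((SeqSub hx, b) :: w').
have [tab tabP] := choice pull.
exists E, inv, ev, tab; split.
- by move=> [a b]; rewrite /inv /= negbK.
- by move=> [a b]; rewrite /inv -[_ == _]/((a == a) && (~~ b == b)) eqxx; case: b.
- by move=> [a []]; rewrite /ev /signed_val /= ?invgK.
- move=> w w' rw rw' eww.
  have [v [_ vu]] := uniqX _ (Hw w).
  apply: (inj_map emb_inj); rewrite -(vu (map emb w)); last by rewrite redE -wvE; split=> // l /embX.
  by apply: vu; rewrite redE -wvE; split=> // l /embX.
- by split=> // j; rewrite wvE tabP.
Qed.
End Letters.

Lemma total_cost_linear (S : finType) (m reps C L : nat) : exists c, forall u v : seq S,
  (total_cost m reps C L u v <= c * (size u + size v).+1)%N.
Proof.
pose P := (reps.+1 * (4 * L + 7 + 5) + 2)%N.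
pose T := (4 * L + 7 + 5 + (5 * L + 20) * L + 20 * C + 40)%N.
pose c := (8 + ((150 * (P + P) + 251) * size (enum 'I_m) + 1) + T + T + 1)%N.
exists c => u v; set N := (size u + size v).+1.
have pc n : (n < N)%N -> (prep_cost reps L n <= P * N)%N.
  move=> lt; rewrite /prep_cost /P; move: (4 * L + 7)%N => a.
  rewrite mulnDl -mulnA; apply: leq_add; last by lia.
  by rewrite leq_mul2l mulnDl; apply/orP; right; apply: leq_add; [rewrite leq_mul2l ltnW ?orbT|lia].
have tc n : (n < N)%N -> (tors_cost C L n <= T * N)%N.
  move=> lt; rewrite /tors_cost /T mulnA; move: (4 * L + 7)%N ((5 * L + 20) * L)%N (20 * C)%N => a b d.
  have N0 x : (x <= x * N)%N by rewrite leq_pmulr.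
  have ln x : (x * n <= x * N)%N by rewrite leq_mul2l ltnW ?orbT.
  rewrite !mulnDl; apply: leq_add; last exact: N0.
  by do 2 (apply: leq_add; last by [exact: N0|exact: ln]); apply: leq_add.
have := leq_add (pc (size u) (leq_addr _ _)) (pc (size v) (leq_addl _ _)).
have := tc (size u) (leq_addr _ _); have := tc (size v) (leq_addl _ _).
rewrite /total_cost /try_cost -mulnDl /c; move: (size (enum _)) (P + P)%N => e p.
move: (tors_cost _ _ _) (tors_cost _ _ _) (prep_cost _ _ _ + prep_cost _ _ _)%N => a b d hb ha hd.
have h1 : ((150 * d + 250 + 1) * e <= (150 * p + 251) * e * N)%N.
  rewrite mulnAC leq_mul2r; apply/orP; right.
  rewrite (mulnDl (150 * p)%N) -mulnA -addnA; apply: leq_add; last by rewrite leq_pmulr.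
  by rewrite leq_mul2l hd.
move: h1; move: ((150 * d + 250 + 1) * e)%N ((150 * p + 251) * e)%N => f q h1.
move: (T) ha hb => T' ha hb; rewrite !mulnDl !mul1n; have : (size u + size v < N)%N by [].
move: (q * N)%N (T' * N)%N h1 ha hb => q' t' h1 ha hb; lia.
Qed.

(** * Correctness of the algorithm *)

Section Assembly.
Variables (G : groupType) (S E : finType) (sval : S -> G) (inv : E -> E) (ev : E -> G) (m : nat).
Variables (rho : 'I_m -> G) (i0 : 'I_m) (sigma : G -> {perm 'I_m}) (tab : 'I_m -> S -> seq E).
Local Notation red := (red inv).
Local Notation weval := (weval ev).
Hypotheses (invK : involutive inv) (inv_ne : forall e, inv e != e)
  (evV : forall e, ev (inv e) = (ev e)^-1)
  (weval_inj : forall w w', red w -> red w' -> weval w = weval w' -> w = w')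
  (sigmaM : {morph sigma : x y / x * y}) (rho_i0 : rho i0 = 1)
  (tab_spec : forall i s, rho i * sval s = weval (tab i s) * rho (sigma (sval s) i))
  (sigma_weval : forall w i, sigma (weval w * rho i) i0 = i)
  (gen : forall g, exists w : seq S, \big[*%g/1]_(s <- w) sval s = g).

Local Notation sv w := (\big[*%g/1]_(s <- w) sval s).
Local Notation sigmaS := (fun s => sigma (sval s)).
Local Notation sigmaE := (fun e => sigma (ev e)).
Local Notation Q := {perm 'I_m}.
Local Notation k := #|{: Q}|.

Lemma nf_at i g : exists2 w, red w & rho i * g = weval w * rho (sigma g i).
Proof.
have [w <-] := gen g; suff [v ev1] : exists v, rho i * sv w = weval v * rho (sigma (sv w) i).
  by have [v' rv' ev'] := red_exists invK evV v; exists v'; rewrite ?ev'.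
elim: w i => [|s w IH] i; first by exists [::]; rewrite big_nil weval_nil mulg1 mul1g (sigma1 sigmaM) perm1.
have [v ev1] := IH (sigma (sval s) i); exists (tab i s ++ v).
by rewrite big_cons mulgA tab_spec -mulgA ev1 sigmaM permM weval_cat mulgA.
Qed.

Lemma nf_ex g : exists w i, red w /\ g = weval w * rho i.
Proof. by have [w rw ew] := nf_at i0 g; exists w, (sigma g i0); rewrite -ew rho_i0 mul1g. Qed.

Lemma nf_uniq w w' i j : red w -> red w' -> weval w * rho i = weval w' * rho j -> w = w' /\ i = j.
Proof.
move=> rw rw' e; have eij : i = j by rewrite -(sigma_weval w i) e sigma_weval.
by split=> //; apply: weval_inj => //; move: e; rewrite eij => /mulIg.
Qed.

Lemma ker_weval g : sigma g = 1 -> exists2 w, red w & weval w = g.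
Proof.
move=> g1; have [w rw ew] := nf_at i0 g; exists w => //.
by move: ew; rewrite g1 perm1 rho_i0 mul1g mulg1.
Qed.

Lemma read_step_spec j w q st x : q = sigma x -> rho j * x = weval (rev st) * rho (q j) -> red st ->
  let d := foldl (read_step inv sigmaS tab j) (q, st) w in
  [/\ d.1 = sigma (x * sv w), rho j * (x * sv w) = weval (rev d.2) * rho (d.1 j) & red d.2].
Proof.
elim: w q st x => [|s w IH] q st x eq es rs; first by rewrite /= big_nil mulg1.
have [|||h1 h2 h3] := IH (q * sigma (sval s)) (foldl (pushr inv) st (tab (q j) s)) (x * sval s).
- by rewrite eq sigmaM.
- by rewrite mulgA es -mulgA tab_spec mulgA weval_pushrs // permM.
- exact: red_pushrs.
by rewrite /= big_cons !mulgA in h1 h2 h3 *; split.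
Qed.

Lemma prep_label_spec j w :
  prep_label inv sigmaS tab (fun j => sigma (rho j)) j w = sigma (sv w ^ (rho j)^-1).
Proof.
have [|||h _ _] := @read_step_spec j w 1 [::] 1; rewrite ?(sigma1 sigmaM) // ?perm1 ?weval_nil ?mul1g ?mulg1 //.
by rewrite /prep_label h mul1g (sigmaJ sigmaM) (sigmaV sigmaM).
Qed.

Lemma push_run_spec j n w :
  let d := push_run inv sigmaS tab j n w (1, [::]) in
  [/\ d.1 = sigma (sv w ^+ n), rho j * sv w ^+ n = weval (rev d.2) * rho (d.1 j) & red d.2].
Proof.
elim: n => [|n [h1 h2 h3]]; first by rewrite /= expg0 (sigma1 sigmaM) perm1 weval_nil mulg1 mul1g.
rewrite /push_run iterS -/(push_run _ _ _ _ _ _ _) [push_run _ _ _ _ _ _ _]surjective_pairing expgSr.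
exact: read_step_spec.
Qed.

Lemma prep_stack_spec j w :
  let st := prep_stack inv sigmaS tab k.-1 j w in
  red (rev st) /\ weval (rev st) = (sv w ^ (rho j)^-1) ^+ k.
Proof.
have [h1 h2 h3] := push_run_spec j k w.
rewrite /prep_stack prednK ?k_gt0 //; split; first by rewrite red_rev.
rewrite h1 (sigma_expk sigmaM) perm1 in h2.
rewrite -conjXg conjgE invgK mulgA.
by rewrite h2 mulgK.
Qed.

Lemma bounded_sizes (J : finType) (f : J -> seq E) : exists L, forall x, (size (f x) <= L)%N.
Proof. by exists (\max_x size (f x))%N => x; apply: leq_bigmax. Qed.

Section TorsionWord.
Variables (tabE : 'I_m -> E -> seq E) (rtab : 'I_m -> 'I_m -> seq E) (rnext : 'I_m -> 'I_m -> 'I_m) (L M : nat).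
Hypotheses (tabE_spec : forall i e, rho i * ev e = weval (tabE i e) * rho (sigmaE e i))
  (rtab_spec : forall i a, rho i * rho a = weval (rtab i a) * rho (rnext i a))
  (tabEL : forall i e, (size (tabE i e) <= L)%N) (rtabL : forall i a, (size (rtab i a) <= L)%N)
  (MP : forall z z' a b y, (size z <= L)%N -> (size z' <= L)%N -> red y ->
     weval z * rho b * weval y = weval z' * rho a -> (size y <= M)%N).
Local Notation C := (M + L + 1)%N.

Definition rep_elt (r : {bseq C of E} * 'I_m) : G := weval r.1 * rho r.2.

(** The conjugator is the prefix of [h] that has been read when the counter first
    shows a value: dividing the stack by this prefix leaves the letters that the
    counter counts. *)
Lemma tors_find w : sv w ^+ k = 1 -> exists2 j, tors_ok inv sigmaS sigmaE tab tabE i0 C w j &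
  exists x, sv w ^ x = rep_elt (tors_word inv sigmaS sigmaE tab tabE i0 C w j).
Proof.
move=> wk; pose d0 := foldl (read_step inv sigmaS tab i0) (1, [::]) w.
have [|||h1 h2 h3] := @read_step_spec i0 w 1 [::] 1; rewrite ?(sigma1 sigmaM) // ?perm1 ?weval_nil ?mul1g ?mulg1 //.
rewrite mul1g rho_i0 mul1g -/d0 in h1 h2 h3.
have rh : red (rev d0.2) by rewrite red_rev.
have [j [l1 l2 l3 l4 ej]] := torsion_short invK evV tabE_spec rtab_spec nf_ex nf_uniq tabEL rtabL
   (ex_intro _ i0 rho_i0) MP rh h2 (k_gt0 m) wk.
have runE n : orbit_run inv sigmaE tabE (rev d0.2) (d0.1 i0) n = tors_run inv sigmaS sigmaE tab tabE i0 w n.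
  by rewrite /orbit_run /tors_run revK.
have [ro eo] := orbit_run_spec invK evV tabE_spec rh h2 j.
rewrite !runE !size_rev in l1 l2 l3 ej ro eo.
exists j.
  split=> //; first by rewrite /tors_run take0.
  by move=> n lt; have := l4 n lt; rewrite runE size_rev.
exists (weval (take j (rev d0.2))); rewrite /rep_elt /tors_word /=.
set Sj := (tors_run _ _ _ _ _ _ _ _).2 in l2 l3 ej ro eo *.
have -> : insub_bseq C (rev (take (size Sj - j) Sj)) = drop j (rev Sj) :> seq E.
  rewrite /insub_bseq insubdK -?topredE /= ?size_rev ?size_take_min; last by lia.
  by rewrite drop_rev.
apply: (mulgI (weval (take j (rev d0.2)))).
by rewrite conjgE mulVKg eo mulgA -weval_cat -{1}ej cat_take_drop.
Qed.
End TorsionWord.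

(** The verdict on short representatives is a finite table, so it may be any
    function on them.  If [u] has finite order, all cyclic words of [u] are
    empty, and a rotation exists exactly when [v] has finite order too. *)
Lemma conj_decidable : exists M : turing_machine (option S),
  decides_in_linear_time M (@encode_pair S) (fun p => (size p.1 + size p.2)%N)
   (fun p => Defs.conjugate (sv p.1) (sv p.2)).
Proof.
have /choice[tabE0 tabE0P] : forall ie : 'I_m * E, exists w, rho ie.1 * ev ie.2 = weval w * rho (sigmaE ie.2 ie.1).
  by move=> [i e]; have [w _ ew] := nf_at i (ev e); exists w.
have /choice[rtab0 rtab0P] : forall ia : 'I_m * 'I_m, exists w, rho ia.1 * rho ia.2 = weval w * rho (sigma (rho ia.2) ia.1).
  by move=> [i a]; have [w _ ew] := nf_at i (rho a); exists w.
have [L1 L1P] := bounded_sizes (fun x : 'I_m * S => tab x.1 x.2).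
have [L2 L2P] := bounded_sizes tabE0.
have [L3 L3P] := bounded_sizes rtab0.
pose L := (L1 + L2 + L3)%N.
pose tabE i e := tabE0 (i, e); pose rtab i a := rtab0 (i, a); pose rnext i a := sigma (rho a) i.
have tabE_spec i e : rho i * ev e = weval (tabE i e) * rho (sigmaE e i) by apply: (tabE0P (i, e)).
have rtab_spec i a : rho i * rho a = weval (rtab i a) * rho (rnext i a) by apply: (rtab0P (i, a)).
have tabL i s : (size (tab i s) <= L)%N by have := L1P (i, s); rewrite /L /=; lia.
have tabEL i e : (size (tabE i e) <= L)%N by have := L2P (i, e); rewrite /L /tabE; lia.
have rtabL i a : (size (rtab i a) <= L)%N by have := L3P (i, a); rewrite /L /rtab; lia.
have rho1 : exists i, rho i = 1 by exists i0.
have [M MP] := bounded_diff L nf_uniq rho1.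
pose C := (M + L + 1)%N.
have LC : (L < C)%N by rewrite /C; lia.
pose verdict r r' := `[< Defs.conjugate (@rep_elt L M r) (@rep_elt L M r') >].
pose twist j := sigma (rho j).
pose prog := conj_program inv sigmaS sigmaE tab tabE twist i0 k.-1 verdict.
exists (tm_of prog).
have [c hc] := @total_cost_linear S m k.-1 C L; exists c => -[u v] /=.
suff [b [T' ex] hb] : exists2 b, exists T', exec prog (init_tapes _ 10 (encode_pair (u, v))) (total_cost m k.-1 C L u v) b T' & b <-> Defs.conjugate (sv u) (sv v).
  exists b; split=> //; apply: exec_tm; apply: exec_le ex _; exact: hc.
have dec j w : exists sc : seq E * seq E, [/\ rev (prep_stack inv sigmaS tab k.-1 j w) = sc.1 ++ sc.2 ++ inv_word inv sc.1,
   cyc_reduced inv sc.2 & sc.2 = [::] -> sc.1 = [::]].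
  have [rw _] := prep_stack_spec j w; have [s [c' h]] := cyc_decomp inv_ne rw.
  by exists (s, c').
have [[s cu] /= [es ccu cu0]] := dec i0 u.
have /choice[f fP] := fun j => dec j v.
pose s' j := (f j).1; pose c' j := (f j).2.
have es' j : rev (prep_stack inv sigmaS tab k.-1 j v) = s' j ++ c' j ++ inv_word inv (s' j) by case: (fP j).
have cc' j : cyc_reduced inv (c' j) by case: (fP j).
have c0' j : c' j = [::] -> s' j = [::] by case: (fP j).
have [ru wu] := prep_stack_spec i0 u; rewrite rho_i0 invg1 conjg1 in wu.
pose rotj := rot_at inv sigmaS sigmaE tab twist i0 u v s cu s' c'.
have [cun|cn] := eqVneq cu [::].
  have uk : sv u ^+ k = 1 by rewrite -wu es cun (cu0 cun) weval_nil.
  have rotP j : rotj j <-> sv v ^+ k = 1.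
    have [rv weval'] := prep_stack_spec j v.
    have c'P : c' j = [::] <-> sv v ^+ k = 1.
      split=> [cj0|vk].
        move: weval'; rewrite es' cj0 c0' // weval_nil -conjXg => /esym/eqP.
        by rewrite conjg_eq1 => /eqP.
      have : rev (prep_stack inv sigmaS tab k.-1 j v) = [::].
        by apply: weval_inj => //; rewrite weval' -conjXg vk conj1g weval_nil.
      by rewrite es' => /(congr1 size) /=; rewrite !size_cat; case: (c' j) => //= *; lia.
    rewrite -c'P /rotj /rot_at cun; split=> [[r er]|->]; last by exists 0%N.
    by apply/size0nil; rewrite -(size_labels sigmaE (slide sigmaE (prep_label inv sigmaS tab twist j v) (s' j))) -er size_rot.
  have conjk x : sv u ^ x = sv v -> sv v ^+ k = 1 by move=> <-; rewrite -conjXg uk conj1g.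
  have [vk|nvk] := pselect (sv v ^+ k = 1).
    have [ju oku [xu exu]] := tors_find tabE_spec rtab_spec tabEL rtabL MP uk.
    have [jv okv [xv exv]] := tors_find tabE_spec rtab_spec tabEL rtabL MP vk.
    eexists.
      apply: (exec_conj_program_tors tabL tabEL LC verdict es ccu cu0 es' cc' c0' _ cun oku okv).
      by exists i0; apply/rotP.
    rewrite /verdict -exu -exv; split=> [/asboolP[g eg]|[g eg]].
      by exists (xu * g * xv^-1); rewrite !conjgM eg -conjgM mulgV conjg1.
    by apply/asboolP; exists (xu^-1 * g * xv); rewrite !conjgM conjgK eg.
  exists false; last by split=> // -[g /conjk].
  apply: (exec_conj_program_fast tabE tabL LC verdict es ccu cu0 es' cc' c0') => //.
  by split=> // -[j /rotP].
have rotP j : rotj j <-> exists2 w, red w & sv u ^ weval w = sv v ^ (rho j)^-1.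
  have [rv weval'] := prep_stack_spec j v.
  rewrite /rotj /rot_at !prep_label_spec rho_i0 invg1 conjg1.
  apply: iff_sym; apply: (conj_iff_rot invK inv_ne evV weval_inj sigmaM ker_weval) => //.
  - by rewrite -es.
  - by rewrite -es wu.
  - by rewrite -es'.
  - by rewrite -es' weval'.
exists `[< exists j, rotj j >].
  apply: (exec_conj_program_fast tabE tabL LC verdict es ccu cu0 es' cc' c0').
    by split=> [/asboolP|/asboolP].
  by rewrite /nilp size_eq0 (negPf cn) andbF.
split=> [/asboolP[j /rotP[w _ ew]]|[g eg]].
  by exists (weval w * rho j); rewrite conjgM ew -conjgM mulVg conjg1.
apply/asboolP; have [w [j [rw ew]]] := nf_ex g.
by exists j; apply/rotP; exists w => //; rewrite -eg ew conjgM -!conjgM mulgV mulg1.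
Qed.
End Assembly.


Import Defs.

Theorem proposition6p1 (G : groupType) (S : {fset G}) :
  virtually_free G ->
  inv_closed S ->
  generates S ->
  exists M : turing_machine (option S),
    decides_in_linear_time M (@encode_pair S)
      (fun p : seq S * seq S => (size p.1 + size p.2)%N)
      (fun p : seq S * seq S => conjugate (word_val p.1) (word_val p.2)).
Proof.
move=> [H [subH [X basisX] finH]] _ genS.
have [m [cls [rho [sigma [clsP clsK rho1 sigmaM sigmaE]]]]] := coset_action subH finH.
have [H1 HM HV] := subH; have [XH uniqX] := basisX.
have Hstep i (s : S) : H (rho i * val s * (rho (sigma (val s) i))^-1)%g.
  by apply/clsP; rewrite clsK sigmaE.
have /choice[raw rawP] : forall x : 'I_m * S, exists w : seq (G * bool),
    [/\ reduced w, forall l, l \in w -> X l.1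
      & \big[*%g/1%g]_(l <- w) signed_val l = (rho x.1 * val x.2 * (rho (sigma (val x.2) x.1))^-1)%g].
  by move=> [i s]; have [w [h _]] := uniqX _ (Hstep i s); exists w.
have rawX x l : l \in raw x -> X l.1 by case: (rawP x) => _ h _; apply: h.
have [E [inv [ev [tab [invK inv_ne evV weval_inj [Hwv tabP]]]]]] := free_alphabet subH basisX rawX.
apply: (@conj_decidable G S E val inv ev m rho (cls 1%g) sigma (fun i s => tab (i, s))) => //.
- by move=> i s; rewrite tabP; case: (rawP (i, s)) => _ _ ->; rewrite mulgVK.
- move=> w i; rewrite sigmaE rho1 mul1g -[RHS]clsK; apply/clsP.
  by rewrite -mulgA mulgV mulg1.
Qed.
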